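(* Let $(\mathbf M,\circ)$ be one of the semigroups $(\mathcal M,\boxplus)$, $(\mathcal M_+,\boxtimes)$, $(\mathcal M_*,\boxtimes)$. The class of indecomposable elements of $(\mathbf M,\circ)$ is dense in $\mathbf M$ in the weak topology.
   Context: Notation: $\mathbb C^+$ is the open upper half-plane, $\mathbb R_+=[0,\infty)$, $\mathbb D$ the open unit disk, $\mathbb T$ the unit circle, $\mathcal N$ the class of analytic $f:\mathbb C^+\to\mathbb C^+\cup\mathbb R$, $\delta_a$ the Dirac measure at $a$. $(\mathbf M,\circ)$ is one of three commutative semigroups: (i) $(\mathcal M,\boxplus)$: $\mathcal M$ is the set of Borel probability measures on $\mathbb R$. For $\mu\in\mathcal M$, $F_\mu(z)=\big(\int_{\mathbb R}\frac{\mu(dt)}{z-t}\big)^{-1}$, $z\in\mathbb C^+$, and $\mathcal F=\{F_\mu:\mu\in\mathcal M\}$. Given $\mu_1,\mu_2$ there are unique $Z_1,Z_2\in\mathcal F$ with $z=Z_1(z)+Z_2(z)-F_{\mu_1}(Z_1(z))$, $F_{\mu_1}(Z_1(z))=F_{\mu_2}(Z_2(z))$ on $\mathbb C^+$; $\mu_1\boxplus\mu_2$ is the measure in $\mathcal M$ with $F_{\mu_1\boxplus\mu_2}(z)=F_{\mu_1}(Z_1(z))$ (free additive convolution). (ii) $(\mathcal M_+,\boxtimes)$: $\mathcal M_+$ is the set of Borel probability measures on $\mathbb R_+$ with $\mu(\{0\})<1$; $\psi_\mu(z)=\int_{\mathbb R_+}\frac{z\xi}{1-z\xi}\mu(d\xi)$,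 $K_\mu=\psi_\mu/(1+\psi_\mu)$ on $\mathbb C\setminus\mathbb R_+$; $\mathcal K$ is the class of $f\in\mathcal N$ analytic and nonpositive on $(-\infty,0)$ with $f(-x)\to0$ as $x\downarrow0$. Given $\mu_1,\mu_2$ there are unique $Z_1,Z_2\in\mathcal K$ (not identically zero) with $Z_1(z)Z_2(z)=zK_{\mu_1}(Z_1(z))$, $K_{\mu_1}(Z_1(z))=K_{\mu_2}(Z_2(z))$ on $\mathbb C^+$; $\mu_1\boxtimes\mu_2$ is the measure in $\mathcal M_+$ with $K_{\mu_1\boxtimes\mu_2}(z)=K_{\mu_1}(Z_1(z))$ (free multiplicative convolution). (iii) $(\mathcal M_*,\boxtimes)$: $\mathcal M_*$ is the set of Borel probability measures on $\mathbb T$ with $\int_{\mathbb T}\xi\,\mu(d\xi)\ne0$; $\psi_\mu(z)=\int_{\mathbb T}\frac{z\xi}{1-z\xi}\mu(d\xi)$, $Q_\mu=\psi_\mu/(1+\psi_\mu)$ on $\mathbb D$; $\mathcal S_*$ is the class of analytic $Q:\mathbb D\to\overline{\mathbb D}$ with $Q(0)=0$, $Q'(0)\ne0$. Given $\mu_1,\mu_2$ there are unique $Z_1,Z_2\in\mathcal S_*$ with $Z_1(z)Z_2(z)=zQ_{\mu_1}(Z_1(z))$, $Q_{\mu_1}(Z_1(z))=Q_{\mu_2}(Z_2(z))$ on $\mathbb D$; $\mu_1\boxtimes\mu_2$ is the measure in $\mathcal M_*$ with $Q_{\mu_1\boxtimes\mu_2}(z)=Q_{\mu_1}(Z_1(z))$.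 Arithmetic: $\mu_1\in\mathbf M$ is a factor of $\mu\in\mathbf M$ if $\mu=\mu_1\circ\mu_2$ for some $\mu_2\in\mathbf M$. The Dirac measures in $\mathbf M$ are $\delta_a$ with $a\in\mathbb R$, $a>0$, $a\in\mathbb T$, respectively. The improper factors of $\mu$ are the measures $\delta_a$ and $\mu\circ\delta_b$, with $a,b$ in the respective range. $\mu$ is indecomposable if it is not a Dirac measure and has improper factors only. *)

(* Defs.v *)
From HB Require Import structures.
From mathcomp Require Import all_boot all_order all_algebra.
From mathcomp Require Import complex.
From mathcomp Require Import all_classical all_reals all_analysis.

Set Implicit Arguments.
Unset Strict Implicit.
Unset Printing Implicit Defensive.

Import Order.TTheory GRing.Theory Num.Theory numFieldNormedType.Exports.

Local Open Scope classical_set_scope.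
Local Open Scope ring_scope.

(* The alias [^o] is what carries the topology of the field R[i]. *)
Notation cplx R := (R[i]^o).

Section BorelProbability.
Context (R : realType) (X : ptopologicalType).

Definition borel := g_sigma_algebraType (@open X).

Definition bounded_continuous : set (X -> R) :=
  [set f | continuous f /\ bounded_fun f].

Definition test_integrals (mu : probability borel R)
    (f : bounded_continuous) : R :=
  Rintegral mu setT (set_val f).

(* Borel probability measures with the weak topology: the coarsest one making
   mu |-> \int f dmu continuous for every bounded continuous f. *)
Definition prob := initial_topology
  (test_integrals : probability borel R -> {ptws bounded_continuous -> R}).

HB.instance Definition _ := Topological.on prob.

Definition prob_measure (mu : prob) : probability borel R := mu.
Coercion prob_measure : prob >-> probability.

Definition cintegral (mu : prob) (f : X -> R[i]) : R[i] :=
  Complex (Rintegral mu setT (fun x => complex.Re (f x)))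
          (Rintegral mu setT (fun x => complex.Im (f x))).

(* A [probability] is a function on all subsets, so equality of measures has
   to be tested on Borel sets rather than with [=]. *)
Definition is_dirac_at (a : X) (mu : prob) : Prop :=
  forall A : set borel, measurable A -> mu A = \d_(a : borel) A.

End BorelProbability.

Section Domains.
Variable R : realType.

Definition nonneg_reals : Type := [set x : R | 0 <= x].
HB.instance Definition _ := Topological.on nonneg_reals.
HB.instance Definition _ :=
  isPointed.Build nonneg_reals (SigSub (mem_set (lexx 0 : [set x : R | 0 <= x] 0))).

Definition unit_circle : Type := [set z : cplx R | `|z| = 1].
HB.instance Definition _ := Topological.on unit_circle.
HB.instance Definition _ :=
  isPointed.Build unit_circle
   (SigSub (mem_set (normr1 _ : [set z : cplx R | `|z| = 1] 1))).

Definition upper_half_plane : set (cplx R) := [set z | 0 < complex.Im z].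

Definition unit_disk : set (cplx R) := [set z | `|z| < 1].

(* Real numbers x < 0 seen in the complex plane; the order of R[i] compares
   only numbers with equal imaginary parts. *)
Definition negative_axis : set (cplx R) := [set z | z < 0].

(* Over the field R[i], [derivable f w 1] is complex differentiability at w. *)
Definition analytic_on (A : set (cplx R)) (f : cplx R -> cplx R) : Prop :=
  forall z, A z -> \forall w \near z, derivable f w 1.

Definition class_N (f : cplx R -> cplx R) : Prop :=
  analytic_on upper_half_plane f /\
  forall z, upper_half_plane z -> 0 <= complex.Im (f z).

End Domains.

(* A convolution is given by its graph: [conv mu1 mu2 mu] reads
   "mu is the convolution of mu1 and mu2", so that its totality and
   functionality, which are theorems, are not needed to define it. *)
Section Arithmetic.
Variables (M : Type) (conv : M -> M -> M -> Prop) (is_dirac : set M).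

Definition factor (mu1 mu : M) : Prop := exists mu2, conv mu1 mu2 mu.

Definition improper_factor (nu mu : M) : Prop :=
  is_dirac nu \/ exists2 delta, is_dirac delta & conv mu delta nu.

Definition indecomposable (mu : M) : Prop :=
  ~ is_dirac mu /\ forall nu, factor nu mu -> improper_factor nu mu.

End Arithmetic.

Section FreeAdditive.
Variable R : realType.

Definition Madd : Type := prob R R.
HB.instance Definition _ := Topological.on Madd.

Definition F_transform (mu : Madd) (z : cplx R) : cplx R :=
  (cintegral mu (fun t : R => (z - t%:C%C)^-1))^-1.

Definition class_F (f : cplx R -> cplx R) : Prop :=
  exists mu : Madd, forall z, upper_half_plane z -> f z = F_transform mu z.

Definition free_add (mu1 mu2 mu : Madd) : Prop :=
  exists Z1 Z2 : cplx R -> cplx R,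
  [/\ class_F Z1, class_F Z2 &
    forall z, upper_half_plane z ->
    [/\ z = Z1 z + Z2 z - F_transform mu1 (Z1 z),
        F_transform mu1 (Z1 z) = F_transform mu2 (Z2 z) &
        F_transform mu z = F_transform mu1 (Z1 z)]].

Definition dirac_add : set Madd :=
  [set mu | exists a : R, is_dirac_at a mu].

End FreeAdditive.

Section FreeMultiplicativePositive.
Variable R : realType.

Definition Mpos : Type :=
  [set mu : prob R (nonneg_reals R) |
    (mu [set x | set_val x = 0%R] < 1)%E].
HB.instance Definition _ := Topological.on Mpos.

Definition psi_pos (mu : Mpos) (z : cplx R) : cplx R :=
  cintegral (set_val mu)
    (fun x : nonneg_reals R =>
       z * (set_val x)%:C%C / (1 - z * (set_val x)%:C%C)).

Definition K_transform (mu : Mpos) (z : cplx R) : cplx R :=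
  psi_pos mu z / (1 + psi_pos mu z).

(* [f z <= 0] in R[i] says that f z is real and nonpositive. *)
Definition class_K (f : cplx R -> cplx R) : Prop :=
  [/\ class_N f,
      analytic_on (@negative_axis R) f,
      forall z, negative_axis z -> f z <= 0 &
      f (- x%:C%C) @[x --> (0 : R)^'+] --> (0 : cplx R)].

Definition not_identically_zero (f : cplx R -> cplx R) : Prop :=
  exists2 z, upper_half_plane z & f z != 0.

Definition free_mul_pos (mu1 mu2 mu : Mpos) : Prop :=
  exists Z1 Z2 : cplx R -> cplx R,
  [/\ class_K Z1 /\ not_identically_zero Z1,
      class_K Z2 /\ not_identically_zero Z2 &
    forall z, upper_half_plane z ->
    [/\ Z1 z * Z2 z = z * K_transform mu1 (Z1 z),
        K_transform mu1 (Z1 z) = K_transform mu2 (Z2 z) &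
        K_transform mu z = K_transform mu1 (Z1 z)]].

Definition dirac_pos : set Mpos :=
  [set mu | exists2 a : nonneg_reals R,
     0 < set_val a & is_dirac_at a (set_val mu)].

End FreeMultiplicativePositive.

Section FreeMultiplicativeCircle.
Variable R : realType.

Definition Mcirc : Type :=
  [set mu : prob R (unit_circle R) |
    cintegral mu (fun x : unit_circle R => set_val x) != 0].
HB.instance Definition _ := Topological.on Mcirc.

Definition psi_circ (mu : Mcirc) (z : cplx R) : cplx R :=
  cintegral (set_val mu)
    (fun x : unit_circle R => z * set_val x / (1 - z * set_val x)).

Definition Q_transform (mu : Mcirc) (z : cplx R) : cplx R :=
  psi_circ mu z / (1 + psi_circ mu z).

Definition class_S (f : cplx R -> cplx R) : Prop :=
  [/\ analytic_on (@unit_disk R) f,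
      forall z, unit_disk z -> `|f z| <= 1,
      f 0 = 0 &
      'D_1 f 0 != 0].

Definition free_mul_circ (mu1 mu2 mu : Mcirc) : Prop :=
  exists Z1 Z2 : cplx R -> cplx R,
  [/\ class_S Z1, class_S Z2 &
    forall z, unit_disk z ->
    [/\ Z1 z * Z2 z = z * Q_transform mu1 (Z1 z),
        Q_transform mu1 (Z1 z) = Q_transform mu2 (Z2 z) &
        Q_transform mu z = Q_transform mu1 (Z1 z)]].

Definition dirac_circ : set Mcirc :=
  [set mu | exists a : unit_circle R, is_dirac_at a (set_val mu)].

End FreeMultiplicativeCircle.

(* Main.v *)
Require Import Defs.
From HB Require Import structures.
From mathcomp Require Import all_boot all_order all_algebra.
From mathcomp Require Import complex ring lra.
From mathcomp Require Import all_classical all_reals all_analysis.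
From mathcomp Require Import measurable_realfun.

Set Implicit Arguments.
Unset Strict Implicit.
Unset Printing Implicit Defensive.

Import Order.TTheory GRing.Theory Num.Theory numFieldNormedType.Exports.

Local Open Scope classical_set_scope.
Local Open Scope ring_scope.

(** Why indecomposable measures are dense.

    Finitely supported measures charging at least two points are dense, and
    every such measure mu is indecomposable (with all atoms positive in the
    case of the half-line).  The reason is a rule for atoms.  Let mu be the
    free convolution of mu1 and mu2, with subordination functions Z1 and Z2,
    and let a be an atom of mu.  When z approaches a (or 1/a, in the
    multiplicative cases) nontangentially, Z1(z) and Z2(z) approach, along a
    subsequence and again nontangentially, points b1 and b2 (or their
    inverses) such that
        a = b1 o b2   and   mu1{b1} + mu2{b2} = 1 + mu{a}.
    If the pairs (b1, b2) of two atoms of mu differed in both coordinates,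
    mu1 and mu2 together would have mass more than 2.  So all the pairs share
    one coordinate, and since the masses mu{a} add up to 1 the shared point
    has mass 1: see [dirac_factor_of_atoms].  Hence mu1 or mu2 is a Dirac
    measure.  In the second case mu1 is a translate of mu by the inverse of
    that point, and the subordination functions showing that mu1 is the
    convolution of mu with a Dirac measure are explicit rational functions.

    The three convolutions are handled through one kernel
    k(z, t) = u(t) - z v(t), equal to z - t or to 1 - z t, and the transform
    B(z) = int mu(dt) / k(z, t); then F = 1/B, and K and Q are 1 - 1/B.  The
    rule for atoms needs no theory of analytic functions:
    - |int f|^2 <= int |f|^2 gives Im F(z) >= Im z, Im (K(z)/z) >= 0 and
      |Q(z)| <= |z|; with the subordination equations this bounds
      |k(Z_j(z), t)| from below, uniformly in t, by the distance s of z to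
      the boundary, up to a constant;
    - near an atom of mu the quantity s |B| stays away from 0, so that mu_j
      puts a fixed mass on the set of the t with |k(Z_j(z), t)| <= C s; by
      the reverse Fatou lemma some point b_j lies in infinitely many of these
      sets, which plays the role of the Julia-Caratheodory theorem:
      see [concentration_point];
    - by dominated convergence k(Z_j(z), b_j) B tends to mu_j{b_j}, see
      [ccvg_mass], and the rule for atoms is the first-order expansion of the
      subordination equation: see [subordination_atoms],
      [additive_atom_relation] and [multiplicative_atom_relation].

    In the additive case one of the explicit subordination functions is F + c,
    with F the transform of the finitely supported measure mu1 and c a real
    constant.  That it is again the transform of a probability measure is the
    spectral theorem for a diagonal matrix perturbed by a matrix of rank one:
    see [rank_one_perturbation].

    For the density, a measure mu is approximated by its images under
    finite-range maps converging pointwise to the identity, mixed with a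
    small multiple of two fixed Dirac measures so that two atoms are always
    present: see [finite_support_approximation]. *)

Local Notation Re := complex.Re.
Local Notation Im := complex.Im.

(** * Squared modulus and bounded integrals *)

Section SquaredModulus.
Variable R : realType.
Implicit Types z w : R[i].

(** The norm of [R[i]] takes values in [R[i]]; its square, read in [R], is
    multiplicative and lets all estimates take place in the real field. *)
Definition sqmod z : R := Re z ^+ 2 + Im z ^+ 2.

Lemma sqmod_ge0 z : 0 <= sqmod z.
Proof. by rewrite addr_ge0 ?sqr_ge0. Qed.

Lemma sqmod_eq0 z : (sqmod z == 0) = (z == 0).
Proof.
by case: z => a b; rewrite /sqmod paddr_eq0 ?sqr_ge0 ?expf_eq0 // eq_complex.
Qed.

Lemma sqmod_gt0 z : (0 < sqmod z) = (z != 0).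
Proof. by rewrite lt_def sqmod_ge0 sqmod_eq0 andbT. Qed.

Lemma sqmodM z w : sqmod (z * w) = sqmod z * sqmod w.
Proof. by case: z w => a b [c d]; rewrite /sqmod /=; ring. Qed.

Lemma sqmod1 : sqmod 1 = 1.
Proof. by rewrite /sqmod /= expr0n expr1n addr0. Qed.

Lemma sqmodV z : sqmod z^-1 = (sqmod z)^-1.
Proof.
have [->|z0] := eqVneq z 0.
  by rewrite invr0 /sqmod /= expr0n addr0 invr0.
have sz0 : sqmod z != 0 by rewrite sqmod_eq0.
by apply: (mulfI sz0); rewrite -sqmodM divff // sqmod1 divff.
Qed.

Lemma sqmodN z : sqmod (- z) = sqmod z.
Proof. by case: z => a b; rewrite /sqmod /= !sqrrN. Qed.

Lemma Re_add z w : Re (z + w) = Re z + Re w. Proof. by case: z w => ? ? []. Qed.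
Lemma Im_add z w : Im (z + w) = Im z + Im w. Proof. by case: z w => ? ? []. Qed.
Lemma Re_opp z : Re (- z) = - Re z. Proof. by case: z. Qed.
Lemma Im_opp z : Im (- z) = - Im z. Proof. by case: z. Qed.
Lemma Re_mul z w : Re (z * w) = Re z * Re w - Im z * Im w.
Proof. by case: z w => ? ? []. Qed.
Lemma Im_mul z w : Im (z * w) = Re z * Im w + Im z * Re w.
Proof. by case: z w => ? ? []. Qed.
Lemma Re_inv z : Re z^-1 = Re z / sqmod z. Proof. by case: z. Qed.
Lemma Im_inv z : Im z^-1 = - Im z / sqmod z.
Proof. by case: z => a b; rewrite /= mulNr. Qed.
Lemma Im_real (x : R) : Im x%:C%C = 0. Proof. by []. Qed.

Lemma complex_eqP z w : Re z = Re w -> Im z = Im w -> z = w.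
Proof. by case: z w => a b [c d] /= -> ->. Qed.

Lemma normr_Re_le_sqmod z (c : R) : 0 <= c -> sqmod z <= c ^+ 2 -> `|Re z| <= c.
Proof.
move=> c0 h; rewrite -ler_sqr ?nnegrE // real_normK ?num_real //.
by apply: le_trans h; rewrite lerDl sqr_ge0.
Qed.

Lemma normr_Im_le_sqmod z (c : R) : 0 <= c -> sqmod z <= c ^+ 2 -> `|Im z| <= c.
Proof.
move=> c0 h; rewrite -ler_sqr ?nnegrE // real_normK ?num_real //.
by apply: le_trans h; rewrite lerDr sqr_ge0.
Qed.

Lemma normc_sqmod z : `|z| ^+ 2 = (sqmod z)%:C%C.
Proof.
case: z => a b; rewrite /Num.norm /= -rmorphXn /= sqr_sqrtr //.
by rewrite addr_ge0 ?sqr_ge0.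
Qed.

End SquaredModulus.

Section RealIntegral.
Context {d} {T : measurableType d} {R : realType} (P : probability T R).
Implicit Types f g : T -> R.

Definition bounded_meas f := measurable_fun setT f /\ exists M, forall x, `|f x| <= M.

Lemma bounded_meas_integrable f : bounded_meas f ->
  P.-integrable setT (EFin \o f).
Proof.
move=> [mf [M hM]]; apply: measurable_bounded_integrable => //.
  by rewrite (le_lt_trans (probability_le1 _ _)) // ltry.
by exists M; split; rewrite ?num_real // => x Mx y _ /=; rewrite (le_trans (hM y)) // ltW.
Qed.

Lemma bounded_meas_cst (c : R) : bounded_meas (fun=> c).
Proof. by split => //; exists `|c|. Qed.

Lemma bounded_measD f g : bounded_meas f -> bounded_meas g ->
  bounded_meas (fun x => f x + g x).
Proof.
move=> [mf [M hM]] [mg [N hN]]; split; first exact: measurable_funD.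
by exists (M + N) => x; rewrite (le_trans (ler_normD _ _)) // lerD.
Qed.

Lemma bounded_measM f g : bounded_meas f -> bounded_meas g ->
  bounded_meas (fun x => f x * g x).
Proof.
move=> [mf [M hM]] [mg [N hN]]; split; first exact: measurable_funM.
by exists (M * N) => x; rewrite normrM ler_pM.
Qed.

Lemma bounded_measN f : bounded_meas f -> bounded_meas (fun x => - f x).
Proof.
move=> [mf [M hM]]; split; first exact: measurableT_comp.
by exists M => x; rewrite normrN.
Qed.

Lemma Rintegral_prob_cst (c : R) : Rintegral P setT (fun=> c) = c.
Proof.
by rewrite Rintegral_cst //= [X in fine X](_ : _ = 1%E) ?mulr1 //; exact: probability_setT.
Qed.

Lemma Rintegral_bdD f g : bounded_meas f -> bounded_meas g ->
  Rintegral P setT (fun x => f x + g x) = Rintegral P setT f + Rintegral P setT g.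
Proof. by move=> bf bg; rewrite RintegralD // ; exact: bounded_meas_integrable. Qed.

Lemma Rintegral_bdZ (c : R) f : bounded_meas f ->
  Rintegral P setT (fun x => c * f x) = c * Rintegral P setT f.
Proof. by move=> bf; rewrite RintegralZl // ; exact: bounded_meas_integrable. Qed.

Lemma Rintegral_bd_le f g : bounded_meas f -> bounded_meas g ->
  (forall x, f x <= g x) -> Rintegral P setT f <= Rintegral P setT g.
Proof. by move=> bf bg fg; apply: le_Rintegral => //; exact: bounded_meas_integrable. Qed.

Lemma bounded_convergence (f_ : nat -> T -> R) f (M : R) :
  (forall n, measurable_fun setT (f_ n)) -> measurable_fun setT f ->
  (forall n x, `|f_ n x| <= M) ->
  (forall x, f_ n x @[n --> \oo] --> f x) ->
  Rintegral P setT (f_ n) @[n --> \oo] --> Rintegral P setT f.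
Proof.
move=> mf_ mf fM fcv.
have iM : P.-integrable setT (EFin \o (fun=> M)).
  exact/bounded_meas_integrable/bounded_meas_cst.
have [iF _ cvg] : [/\ P.-integrable setT (EFin \o f),
    [sequence \int[P]_(x in setT) `|(f_ n x)%:E - (f x)%:E|]_n @ \oo --> 0 &
    [sequence \int[P]_(x in setT) (f_ n x)%:E]_n @ \oo -->
      \int[P]_(x in setT) (f x)%:E]%E.
  apply: (@dominated_convergence _ T R P setT measurableT
    (fun n x => (f_ n x)%:E) (EFin \o f) (EFin \o (fun=> M))) => //.
  - by move=> n; exact/measurable_EFinP.
  - exact/measurable_EFinP.
  - by apply: aeW => x _; apply: cvg_EFin; [exact: nearW|exact: fcv].
  - by apply: aeW => x n _; rewrite /= lee_fin.
by apply: fine_cvg; rewrite fineK //; exact: integrable_fin_num.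
Qed.

(** If the integral vanished, those of min(1, n f), which are at most n times
    it, would vanish too; but these functions increase to 1. *)
Lemma Rintegral_gt0 f : bounded_meas f -> (forall x, 0 < f x) ->
  0 < Rintegral P setT f.
Proof.
move=> bf f0; rewrite lt_def Rintegral_ge0 ?andbT; last by move=> x _; exact: ltW.
apply/eqP => If; have mf := bf.1.
pose g n x := Num.min 1 (n%:R * f x).
have mg n : measurable_fun setT (g n).
  by apply: measurable_minr => //; exact: measurable_funM.
have gb n x : `|g n x| <= 1.
  by rewrite ger0_norm /g ?ge_min ?lexx // le_min ler01 mulr_ge0 // ltW.
have cg : Rintegral P setT (g n) @[n --> \oo] --> Rintegral P setT (fun=> 1 : R).
  apply: (@bounded_convergence _ _ 1) => // x.
  apply: cvg_near_cst; near=> n; apply/min_idPl.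
  rewrite -ler_pdivrMr // mul1r; near: n; exact: nbhs_infty_ger.
have : (1 : R) <= 0.
  rewrite -(Rintegral_prob_cst 1); apply: (cvgr_to_le cg); apply: nearW => n.
  apply: (@le_trans _ _ (Rintegral P setT (fun x => n%:R * f x))).
    apply: Rintegral_bd_le => [||x]; last by rewrite /g ge_min lexx orbT.
      by split => //; exists 1.
    by apply: bounded_measM => //; exact: bounded_meas_cst.
  by rewrite Rintegral_bdZ // If mulr0.
by rewrite ler10.
Unshelve. all: by end_near. Qed.

End RealIntegral.

(** * Complex sequences, functions and integrals by components *)

Section ComplexLimits.
Variable R : realType.
Implicit Types z w l : R[i].
Local Notation cseq := (nat -> R[i]).

(** Componentwise convergence: with it the limits of complex integrals follow
    from those of the two real integrals that define them. *)
Definition ccvg (z_ : cseq) l : Prop :=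
  (Re (z_ n) @[n --> \oo] --> Re l) /\ (Im (z_ n) @[n --> \oo] --> Im l).

Lemma ccvg_ext (z_ w_ : cseq) l : (forall n, z_ n = w_ n) -> ccvg z_ l -> ccvg w_ l.
Proof. by move=> /funext ->. Qed.

Lemma ccvg_cst l : ccvg (fun=> l) l.
Proof. by split; exact: cvg_cst. Qed.

Lemma ccvgD (z_ w_ : cseq) z w : ccvg z_ z -> ccvg w_ w -> ccvg (fun n => z_ n + w_ n) (z + w).
Proof.
move=> [rz iz] [rw iw]; split.
  by rewrite Re_add; under eq_fun do rewrite Re_add; exact: cvgD.
by rewrite Im_add; under eq_fun do rewrite Im_add; exact: cvgD.
Qed.

Lemma ccvgN (z_ : cseq) z : ccvg z_ z -> ccvg (fun n => - z_ n) (- z).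
Proof.
move=> [rz iz]; split.
  by rewrite Re_opp; under eq_fun do rewrite Re_opp; exact: cvgN.
by rewrite Im_opp; under eq_fun do rewrite Im_opp; exact: cvgN.
Qed.

Lemma ccvgM (z_ w_ : cseq) z w : ccvg z_ z -> ccvg w_ w -> ccvg (fun n => z_ n * w_ n) (z * w).
Proof.
move=> [rz iz] [rw iw]; split.
  by rewrite Re_mul; under eq_fun do rewrite Re_mul; apply: cvgB; exact: cvgM.
by rewrite Im_mul; under eq_fun do rewrite Im_mul; apply: cvgD; exact: cvgM.
Qed.

Lemma ccvg_sqmod (z_ : cseq) z : ccvg z_ z -> sqmod (z_ n) @[n --> \oo] --> sqmod z.
Proof. by move=> [rz iz]; rewrite /sqmod; apply: cvgD; apply: cvgM. Qed.

Lemma ccvgV (z_ : cseq) z : z != 0 -> ccvg z_ z -> ccvg (fun n => (z_ n)^-1) z^-1.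
Proof.
move=> z0 cz; have sz := ccvg_sqmod cz; have sz0 : sqmod z != 0 by rewrite sqmod_eq0.
case: cz => rz iz; split.
  by rewrite Re_inv; under eq_fun do rewrite Re_inv; apply: cvgM => //; exact: cvgV.
rewrite Im_inv; under eq_fun do rewrite Im_inv; apply: cvgM; last exact: cvgV.
exact: cvgN.
Qed.

Lemma ccvg_unique (z_ : cseq) z w : ccvg z_ z -> ccvg z_ w -> z = w.
Proof.
move=> [rz iz] [rw iw]; apply: complex_eqP.
  exact: (cvg_unique _ rz rw).
exact: (cvg_unique _ iz iw).
Qed.

Lemma ccvg_sub (z_ : cseq) z (e : nat -> nat) : (forall n, n <= e n)%N ->
  ccvg z_ z -> ccvg (z_ \o e) z.
Proof.
move=> he.
have ecvg : e n @[n --> \oo] --> \oo.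
  move=> A [N _ hN]; exists N => // n /= Nn; apply: hN => /=.
  exact: leq_trans Nn (he n).
move=> [rz iz]; split; first exact: (cvg_comp _ (fun m => Re (z_ m)) ecvg).
exact: (cvg_comp _ (fun m => Im (z_ m)) ecvg).
Qed.

Lemma ccvg0_sqmod (z_ : cseq) : sqmod (z_ n) @[n --> \oo] --> (0 : R) -> ccvg z_ 0.
Proof.
move=> h.
have hs : Num.sqrt (sqmod (z_ n)) @[n --> \oo] --> (0 : R).
  have := @cvg_comp _ _ _ (fun n => sqmod (z_ n)) Num.sqrt _ _ _ h (@sqrt_continuous R 0).
  by rewrite sqrtr0.
have key (f : nat -> R) : (forall n, `|f n| <= Num.sqrt (sqmod (z_ n))) ->
    f n @[n --> \oo] --> (0 : R).
  move=> hf; apply/norm_cvg0P.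
  apply: (@squeeze_cvgr _ _ _ _ (fun=> 0) (fun n => Num.sqrt (sqmod (z_ n)))) => //.
    by apply: nearW => n; rewrite normr_ge0 hf.
  exact: cvg_cst.
split; apply: key => n.
  by rewrite normr_Re_le_sqmod ?sqrtr_ge0 // sqr_sqrtr // sqmod_ge0.
by rewrite normr_Im_le_sqmod ?sqrtr_ge0 // sqr_sqrtr // sqmod_ge0.
Qed.

End ComplexLimits.

Section BorelFunctions.
Context {R : realType} {X : ptopologicalType}.
Implicit Types (f g : X -> R[i]).

Lemma continuous_borel_measurable (f : X -> R) : continuous f ->
  measurable_fun setT (f : borel X -> R).
Proof.
move=> /continuousP cf.
apply: (measurability _ (RGenOInfty.measurableE R)).
move=> _ [_ [x ->] <-]; rewrite setTI; apply: sub_sigma_algebra.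
by apply: cf; exact: rray_open.
Qed.

Definition ccont f := continuous (fun x => Re (f x)) /\ continuous (fun x => Im (f x)).

Definition cbounded_meas f :=
  bounded_meas (T := borel X) (fun x => Re (f x)) /\
  bounded_meas (T := borel X) (fun x => Im (f x)).

Lemma ccont_cst (c : R[i]) : ccont (fun=> c).
Proof. by split => x; exact: cvg_cst. Qed.

Lemma ccontD f g : ccont f -> ccont g -> ccont (fun x => f x + g x).
Proof.
move=> [rf jf] [rg jg]; split => x.
  by under eq_fun do rewrite Re_add; apply: cvgD; [exact: rf|exact: rg].
by under eq_fun do rewrite Im_add; apply: cvgD; [exact: jf|exact: jg].
Qed.

Lemma ccontN f : ccont f -> ccont (fun x => - f x).
Proof.
move=> [rf jf]; split => x.
  by under eq_fun do rewrite Re_opp; apply: cvgN; exact: rf.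
by under eq_fun do rewrite Im_opp; apply: cvgN; exact: jf.
Qed.

Lemma ccontM f g : ccont f -> ccont g -> ccont (fun x => f x * g x).
Proof.
move=> [rf jf] [rg jg]; split => x.
  under eq_fun do rewrite Re_mul; apply: cvgB; apply: cvgM;
    by [exact: rf|exact: rg|exact: jf|exact: jg].
under eq_fun do rewrite Im_mul; apply: cvgD; apply: cvgM;
  by [exact: rf|exact: rg|exact: jf|exact: jg].
Qed.

Lemma ccont_sqmod f : ccont f -> continuous (fun x => sqmod (f x)).
Proof.
by move=> [rf jf] x; apply: cvgD; apply: cvgM; by [exact: rf|exact: jf].
Qed.

Lemma ccontV f : (forall x, f x != 0) -> ccont f -> ccont (fun x => (f x)^-1).
Proof.
move=> f0 cf; have sf := ccont_sqmod cf.
have s0 x : sqmod (f x) != 0 by rewrite sqmod_eq0.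
case: cf => rf jf; split => x.
  under eq_fun do rewrite Re_inv; apply: cvgM; first exact: rf.
  by apply: cvgV => //; exact: sf.
under eq_fun do rewrite Im_inv; apply: cvgM; first by apply: cvgN; exact: jf.
by apply: cvgV => //; exact: sf.
Qed.

Lemma ccont_bounded_meas f (M : R) : ccont f -> (forall x, sqmod (f x) <= M ^+ 2) ->
  cbounded_meas f.
Proof.
move=> [rf jf] hM.
have hM' x : sqmod (f x) <= `|M| ^+ 2 by rewrite real_normK ?num_real.
split; split; try exact: continuous_borel_measurable.
  by exists `|M| => x; exact: normr_Re_le_sqmod.
by exists `|M| => x; exact: normr_Im_le_sqmod.
Qed.

Lemma cbounded_meas_inv f (s : R) : 0 < s -> ccont f ->
  (forall x, s ^+ 2 <= sqmod (f x)) -> cbounded_meas (fun x => (f x)^-1).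
Proof.
move=> s0 cf sf; have pos x : 0 < sqmod (f x).
  by apply: lt_le_trans (sf x); rewrite exprn_gt0.
apply: (@ccont_bounded_meas _ s^-1).
  by apply: ccontV => // x; rewrite -sqmod_gt0.
by move=> x; rewrite sqmodV exprVn lef_pV2 ?posrE ?exprn_gt0.
Qed.

Lemma cbounded_meas_cst (c : R[i]) : cbounded_meas (fun=> c).
Proof. by split; exact: bounded_meas_cst. Qed.

Lemma cbounded_measM f g : cbounded_meas f -> cbounded_meas g ->
  cbounded_meas (fun x => f x * g x).
Proof.
move=> [rf jf] [rg jg]; split.
  under eq_fun do rewrite Re_mul; apply: bounded_measD; first exact: bounded_measM.
  by apply: bounded_measN; exact: bounded_measM.
by under eq_fun do rewrite Im_mul; apply: bounded_measD; exact: bounded_measM.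
Qed.

Lemma bounded_meas_sqmod f : cbounded_meas f ->
  bounded_meas (T := borel X) (fun x => sqmod (f x)).
Proof. by move=> [rf jf]; apply: bounded_measD; exact: bounded_measM. Qed.

End BorelFunctions.

Section ComplexIntegral.
Context {R : realType} {X : ptopologicalType} (mu : prob R X).
Implicit Types (f g : X -> R[i]).

Lemma cintegral_ext f g : (forall x, f x = g x) -> cintegral mu f = cintegral mu g.
Proof. by move=> /funext ->. Qed.

Lemma cintegral_cst (c : R[i]) : cintegral mu (fun=> c) = c.
Proof. by rewrite /cintegral !Rintegral_prob_cst; case: c. Qed.

Lemma cintegralD f g : cbounded_meas f -> cbounded_meas g ->
  cintegral mu (fun x => f x + g x) = cintegral mu f + cintegral mu g.
Proof.
move=> [rf jf] [rg jg]; apply: complex_eqP; rewrite ?Re_add ?Im_add /=.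
  by under eq_Rintegral do rewrite Re_add; exact: Rintegral_bdD.
by under eq_Rintegral do rewrite Im_add; exact: Rintegral_bdD.
Qed.

Lemma cintegralZ (c : R[i]) f : cbounded_meas f ->
  cintegral mu (fun x => c * f x) = c * cintegral mu f.
Proof.
move=> [rf jf]; have Z (a : R) (h : X -> R) : bounded_meas (T := borel X) h ->
    bounded_meas (T := borel X) (fun x => a * h x).
  by move=> bh; apply: bounded_measM => //; exact: bounded_meas_cst.
apply: complex_eqP; rewrite ?Re_mul ?Im_mul /=.
  under eq_Rintegral do rewrite Re_mul -mulNr.
  by rewrite Rintegral_bdD ?Rintegral_bdZ ?mulNr //; exact: Z.
under eq_Rintegral do rewrite Im_mul.
by rewrite Rintegral_bdD ?Rintegral_bdZ //; exact: Z.
Qed.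

(** This is int |f - c|^2 >= 0 for c the integral of f.  It is the source of
    all the estimates on subordination functions. *)
Lemma sqmod_cintegral_le f : cbounded_meas f ->
  sqmod (cintegral mu f) <= Rintegral mu setT (fun x => sqmod (f x)).
Proof.
move=> bf; have bs := bounded_meas_sqmod bf; case: bf => rf jf.
set a := Re (cintegral mu f); set b := Im (cintegral mu f).
have Z (c : R) (h : X -> R) : bounded_meas (T := borel X) h ->
    bounded_meas (T := borel X) (fun x => c * h x).
  by move=> bh; apply: bounded_measM => //; exact: bounded_meas_cst.
have : 0 <= Rintegral mu setT (fun x => sqmod (f x) + (- (2 * a) * Re (f x) +
    (- (2 * b) * Im (f x) + (a ^+ 2 + b ^+ 2)))).
  apply: Rintegral_ge0 => x _; rewrite /sqmod.
  rewrite [leRHS](_ : _ = (Re (f x) - a) ^+ 2 + (Im (f x) - b) ^+ 2); last by ring.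
  by rewrite addr_ge0 ?sqr_ge0.
have bc := bounded_meas_cst (T := borel X) (a ^+ 2 + b ^+ 2).
rewrite Rintegral_bdD //; last first.
  by apply: bounded_measD; [exact: Z rf|apply: bounded_measD => //; exact: Z jf].
rewrite [X in _ + X]Rintegral_bdD; [|exact: Z rf|by apply: bounded_measD => //; exact: Z jf].
rewrite [X in _ + (_ + X)]Rintegral_bdD //; last exact: Z jf.
rewrite !Rintegral_bdZ // Rintegral_prob_cst -[Rintegral _ _ (fun x => Re _)]/a.
rewrite -[Rintegral _ _ (fun x => Im _)]/b /sqmod -/a -/b.
by move=> h; rewrite -subr_ge0; apply: le_trans h _; lra.
Qed.

Lemma cintegral_bounded_convergence (f_ : nat -> X -> R[i]) f (M : R) :
  (forall n, cbounded_meas (f_ n)) -> cbounded_meas f ->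
  (forall n x, sqmod (f_ n x) <= M ^+ 2) ->
  (forall x, ccvg (f_ ^~ x) (f x)) ->
  ccvg (fun n => cintegral mu (f_ n)) (cintegral mu f).
Proof.
move=> bf_ bf fM fcv.
have hM n x : sqmod (f_ n x) <= `|M| ^+ 2 by rewrite real_normK ?num_real.
split; rewrite /cintegral /=; apply: (@bounded_convergence _ _ _ _ _ _ `|M|).
- by move=> n; case: (bf_ n) => -[].
- by case: bf => -[].
- by move=> n x; exact: normr_Re_le_sqmod.
- by move=> x; case: (fcv x).
- by move=> n; case: (bf_ n) => _ [].
- by case: bf => _ [].
- by move=> n x; exact: normr_Im_le_sqmod.
- by move=> x; case: (fcv x).
Qed.

End ComplexIntegral.

(** * Atoms found by concentration *)

Lemma frequently_subsequence (P : nat -> Prop) :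
  (forall N, exists2 n, (N <= n)%N & P n) ->
  exists2 e : nat -> nat, (forall n, (n <= e n)%N) & forall n, P (e n).
Proof.
move=> h; exists (fun N => sval (cid2 (h N))) => n; by case: cid2.
Qed.

Section Concentration.
Context {R : realType} {X : ptopologicalType} (mu : prob R X).

Definition mass (b : X) : R := fine (mu [set b]).

(** The sets T_n of the points where |k_n| is at most a multiple of s_n have
    mass at least c/2, since outside them s_n^2 / |k_n|^2 is below c/2 and
    everywhere it is at most 1.  Their upper limit then has positive measure,
    so some point lies in infinitely many of them. *)
Lemma concentration_point (k : nat -> X -> R[i]) (s : nat -> R) (c : R) :
  (forall n, 0 < s n) -> 0 < c -> (forall n, ccont (k n)) ->
  (forall n x, s n ^+ 2 <= sqmod (k n x)) ->
  (forall n, c <= s n ^+ 2 * sqmod (cintegral mu (fun x => (k n x)^-1))) ->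
  exists b, forall N, exists2 n, (N <= n)%N & sqmod (k n b) <= 2 / c * s n ^+ 2.
Proof.
move=> s0 c0 ck sk hc.
pose T n : set (borel X) := [set x | sqmod (k n x) <= 2 / c * s n ^+ 2].
have mT n : measurable (T n).
  have mf := continuous_borel_measurable (ccont_sqmod (ck n)).
  rewrite -[T n]setTI.
  have -> : T n = (fun x : borel X => sqmod (k n x)) @^-1` `]-oo, (2 / c * s n ^+ 2)].
    by apply/seteqP; split => x; rewrite /T /= in_itv.
  exact: mf.
have s20 n : 0 < s n ^+ 2 by rewrite exprn_gt0.
(* s_n^2 / |k_n|^2 is at most 1 on T_n and at most c/2 off T_n. *)
have heavy n : c / 2 <= fine (mu (T n)).
  have kp x : 0 < sqmod (k n x) by exact: lt_le_trans (sk n x).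
  have bk := cbounded_meas_inv (s0 n) (ck n) (sk n).
  have bI : bounded_meas (T := borel X) (\1_(T n) : borel X -> R).
    split; first exact: measurable_indic.
    by exists 1 => x; rewrite indicE; case: (_ \in _); rewrite ?normr1 ?normr0.
  have bc := bounded_meas_cst (T := borel X) (c / 2).
  have II : Rintegral mu setT (\1_(T n) : borel X -> R) = fine (mu (T n)).
    by rewrite /Rintegral integral_indic // setIT.
  have := hc n; have := ler_wpM2l (ltW (s20 n)) (sqmod_cintegral_le mu bk).
  move=> /[swap] /le_trans /[apply].
  rewrite -Rintegral_bdZ; last exact: bounded_meas_sqmod.
  have /(@Rintegral_bd_le _ _ _ mu) h : bounded_meas (T := borel X)
      (fun x => s n ^+ 2 * sqmod (k n x)^-1).
    by apply: bounded_measM; [exact: bounded_meas_cst|exact: bounded_meas_sqmod].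
  have {}h := h _ (bounded_measD bI bc).
  move=> /le_trans /(_ (h _)).
  rewrite Rintegral_bdD // Rintegral_prob_cst II => h'.
  suff : c <= fine (mu (T n)) + c / 2 by lra.
  apply: h' => x; rewrite sqmodV.
  have [xT|xT] := boolP (x \in T n); rewrite indicE.
    rewrite xT /=; have : s n ^+ 2 / sqmod (k n x) <= 1.
      by rewrite ler_pdivrMr // mul1r.
    by move: c0; lra.
  rewrite (negbTE xT) add0r; move: xT; rewrite notin_setE /T /= => /negP.
  rewrite -ltNge => xT.
  rewrite ler_pdivrMr //.
  rewrite [leLHS](_ : _ = c / 2 * (2 / c * s n ^+ 2)); last by field; lra.
  by rewrite ler_pM2l ?divr_gt0 // ltW.
(* The mass of the upper limit is a limit of masses at least c/2. *)
have [b hb] : lim_sup_set T !=set0.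
  apply/set0P/eqP => L0.
  have hc0 : (mu (\bigcup_(j >= 0) T j) < +oo)%E.
    by rewrite (le_lt_trans (probability_le1 _ _)) ?ltry //; exact: bigcup_measurable.
  have := lim_sup_set_cvg mu T mT hc0.
  rewrite L0 measure0 => /fine_cvgP[_] cv0.
  have : c / 2 <= 0.
    apply: (@cvgr_to_ge _ _ _ _ _ _ _ cv0); apply: nearW => n /=.
    apply: le_trans (heavy n) _; apply: fine_le.
    - by rewrite fin_num_measure.
    - by rewrite fin_num_measure //; exact: bigcup_measurable.
    - rewrite le_measure ?inE //; first exact: bigcup_measurable.
      by apply: bigcup_sup => /=.
  by move: c0; lra.
by exists b => N; have [n /= Nn Tn] := hb N I; exists n.
Qed.

(** The integrand k_n(b) / k_n(x) equals 1 at b, tends to 0 elsewhere, and is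
    bounded because |k_n(b)| is comparable to the lower bound s_n of |k_n|. *)
Lemma ccvg_mass (k : nat -> X -> R[i]) (s : nat -> R) (C : R) (b : X) :
  measurable ([set b] : set (borel X)) ->
  (forall n, 0 < s n) -> (forall n, ccont (k n)) ->
  (forall n x, s n ^+ 2 <= sqmod (k n x)) ->
  (forall n, sqmod (k n b) <= C * s n ^+ 2) ->
  (forall x, x <> b -> ccvg (fun n => k n b / k n x) 0) ->
  ccvg (fun n => k n b * cintegral mu (fun x => (k n x)^-1)) (mass b)%:C%C.
Proof.
move=> mb s0 ck sk hC hk.
have s20 n : 0 < s n ^+ 2 by rewrite exprn_gt0.
have kp n x : 0 < sqmod (k n x) by exact: lt_le_trans (sk n x).
have bk n := cbounded_meas_inv (s0 n) (ck n) (sk n).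
have C1 : 1 <= C.
  by have := le_trans (sk 0 b) (hC 0); rewrite -{1}[_ ^+ 2]mul1r ler_pM2r.
have C0 : 0 <= C by exact: le_trans C1.
have mI : bounded_meas (T := borel X) (\1_[set b] : borel X -> R).
  split; first exact: measurable_indic.
  by exists 1 => x; rewrite indicE; case: (_ \in _); rewrite ?normr1 ?normr0.
have -> : ((mass b)%:C)%C = cintegral mu (fun x => ((\1_[set b] x : R)%:C)%C).
  rewrite /cintegral /=; congr Complex; last by rewrite Rintegral_prob_cst.
  by rewrite /Rintegral integral_indic // setIT.
apply: (@ccvg_ext _ (fun n => cintegral mu (fun x => k n b / k n x))).
  by move=> n; rewrite cintegralZ.
apply: (@cintegral_bounded_convergence _ _ _ _ _ (Num.sqrt C)).
- by move=> n; apply: cbounded_measM => //; exact: cbounded_meas_cst.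
- by split => //=; exact: bounded_meas_cst.
- move=> n x; rewrite sqr_sqrtr // sqmodM sqmodV.
  rewrite ler_pdivrMr //; apply: le_trans (hC n) _.
  exact: ler_wpM2l.
- move=> x; rewrite indicE; have [/set_mem /= ->|] := boolP (x \in [set b]).
    apply: (@ccvg_ext _ (fun=> 1)); last exact: ccvg_cst.
    by move=> n; rewrite divff // -sqmod_gt0.
  by rewrite notin_setE /= => /hk.
Qed.

End Concentration.

(** * Affine kernels *)

Section AffineKernel.
Context {R : realType} {X : ptopologicalType} (u v : X -> R[i]).
Hypotheses (cu : ccont u) (cv : ccont v).
Hypothesis uv_indep : forall b t, t <> b -> u t * v b - u b * v t != 0.
Hypothesis measurable_point : forall b, measurable ([set b] : set (borel X)).

(** With u(t) = -t, v(t) = -1 this is z - t, the kernel of the Cauchy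
    transform; with u(t) = 1, v(t) = t it is 1 - z t, the kernel of the
    multiplicative transforms. *)
Definition akernel (Z : R[i]) (t : X) : R[i] := u t - Z * v t.
Definition atransform (mu : prob R X) (Z : R[i]) : R[i] :=
  cintegral mu (fun t => (akernel Z t)^-1).

Lemma ccont_akernel Z : ccont (akernel Z).
Proof. by apply: ccontD => //; apply: ccontN; apply: ccontM => //; exact: ccont_cst. Qed.

(** Eliminating the parameter between the values at b and at t gives
    v(b) k(Z, t) = D + v(t) k(Z, b), where D = u(t) v(b) - u(b) v(t) is not 0:
    when k(Z_n, b) tends to 0, k(Z_n, t) tends to a nonzero limit. *)
Lemma akernel_ratio_cvg0 (Z : nat -> R[i]) b t : t <> b ->
  ccvg (fun n => akernel (Z n) b) 0 -> ccvg (fun n => akernel (Z n) b / akernel (Z n) t) 0.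
Proof.
move=> tb cb; have D0 := uv_indep tb; set D := _ - _ in D0.
have vb0 : v b != 0.
  apply: contraNneq D0 => vb0; have ub0 : u b = 0.
    apply: (ccvg_unique _ cb); apply: ccvg_ext (ccvg_cst _) => n.
    by rewrite /akernel vb0 mulr0 subr0.
  by rewrite /D vb0 ub0 mulr0 mul0r subr0.
have E n : akernel (Z n) t = (D + v t * akernel (Z n) b) / v b.
  by rewrite /akernel /D; field.
rewrite -[0](mul0r ((D + v t * 0) / v b)^-1); apply: ccvgM => //.
apply: ccvgV; first by rewrite mulr0 addr0 mulf_neq0 // invr_eq0.
apply: (@ccvg_ext _ (fun n => (D + v t * akernel (Z n) b) / v b)) => //.
apply: ccvgM; last exact: ccvg_cst.
by apply: ccvgD; [exact: ccvg_cst|apply: ccvgM => //; exact: ccvg_cst].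
Qed.

Lemma akernel_cvg0 (Z : nat -> R[i]) (s : nat -> R) (C : R) b :
  s n @[n --> \oo] --> 0 -> (forall n, sqmod (akernel (Z n) b) <= C * s n ^+ 2) ->
  ccvg (fun n => akernel (Z n) b) 0.
Proof.
move=> scv hC; apply: ccvg0_sqmod.
apply: (@squeeze_cvgr _ _ _ _ (fun=> 0) (fun n => C * s n ^+ 2)).
- by apply: nearW => n; rewrite sqmod_ge0 hC.
- exact: cvg_cst.
- rewrite -[0](mulr0 C) -[X in C * X](mulr0 0); apply: cvgM; first exact: cvg_cst.
  exact: cvgM.
Qed.

Lemma akernel_ccvg_mass (mu : prob R X) (Z : nat -> R[i]) (s : nat -> R) (C : R) b :
  (forall n, 0 < s n) -> s n @[n --> \oo] --> 0 ->
  (forall n x, s n ^+ 2 <= sqmod (akernel (Z n) x)) ->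
  (forall n, sqmod (akernel (Z n) b) <= C * s n ^+ 2) ->
  ccvg (fun n => akernel (Z n) b) 0 /\
  ccvg (fun n => akernel (Z n) b * atransform mu (Z n)) (mass mu b)%:C%C.
Proof.
move=> s0 scv sk hC; have cb := akernel_cvg0 scv hC; split => //.
apply: (@ccvg_mass _ _ mu (fun n => akernel (Z n)) s C) => //.
- by move=> n; exact: ccont_akernel.
- by move=> x xb; exact: akernel_ratio_cvg0.
Qed.

Lemma akernel_concentration (mu : prob R X) (Z : nat -> R[i]) (s : nat -> R) (c : R) :
  (forall n, 0 < s n) -> s n @[n --> \oo] --> 0 -> 0 < c ->
  (forall n x, s n ^+ 2 <= sqmod (akernel (Z n) x)) ->
  (forall n, c <= s n ^+ 2 * sqmod (atransform mu (Z n))) ->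
  exists b, exists2 e : nat -> nat, (forall n, (n <= e n)%N) &
    ccvg (fun n => akernel (Z (e n)) b) 0 /\
    ccvg (fun n => akernel (Z (e n)) b * atransform mu (Z (e n))) (mass mu b)%:C%C.
Proof.
move=> s0 scv c0 sk hc.
have [b /frequently_subsequence[e ne he]] := concentration_point s0 c0
  (fun n => ccont_akernel (Z n)) sk hc.
exists b; exists e => //.
apply: (@akernel_ccvg_mass _ _ (s \o e) (2 / c)) => //.
- by move=> n; exact: s0.
- have ecvg : e n @[n --> \oo] --> \oo.
    move=> A [N _ hN]; exists N => // n /= Nn; apply: hN => /=.
    exact: leq_trans Nn (ne n).
  exact: (cvg_comp _ s ecvg).
- by move=> n x; exact: sk.
Qed.

(** Here Z tends to the boundary point of the atom a of mu, Z1 and Z2 are the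
    values of the subordination functions, and 1/eps is the common value of
    the three transforms.  As k(Z, a) / eps tends to mu{a} > 0 and k(Z, a) is
    of order s, the product of s and the transform stays away from 0, so that
    concentration applies to mu1, then to mu2 along a further subsequence. *)
Lemma subordination_atoms (mu mu1 mu2 : prob R X) (Z Z1 Z2 : nat -> R[i])
    (s : nat -> R) (C : R) (a : X) :
  (forall n, 0 < s n) -> s n @[n --> \oo] --> 0 ->
  (forall n x, s n ^+ 2 <= sqmod (akernel (Z n) x)) ->
  (forall n, sqmod (akernel (Z n) a) <= C * s n ^+ 2) ->
  0 < mass mu a ->
  (\forall n \near \oo, forall x, s n ^+ 2 <= sqmod (akernel (Z1 n) x)) ->
  (\forall n \near \oo, forall x, s n ^+ 2 <= sqmod (akernel (Z2 n) x)) ->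
  (\forall n \near \oo, atransform mu1 (Z1 n) = atransform mu (Z n)) ->
  (\forall n \near \oo, atransform mu2 (Z2 n) = atransform mu (Z n)) ->
  exists b1 b2, exists2 e : nat -> nat, (forall n, (n <= e n)%N) &
    let eps n := (atransform mu (Z (e n)))^-1 in
    [/\ ccvg (fun n => akernel (Z (e n)) a) 0 /\
          ccvg (fun n => akernel (Z (e n)) a / eps n) (mass mu a)%:C%C,
        ccvg (fun n => akernel (Z1 (e n)) b1) 0 /\
          ccvg (fun n => akernel (Z1 (e n)) b1 / eps n) (mass mu1 b1)%:C%C,
        ccvg (fun n => akernel (Z2 (e n)) b2) 0 /\
          ccvg (fun n => akernel (Z2 (e n)) b2 / eps n) (mass mu2 b2)%:C%C &
        ccvg eps 0 /\ forall n, eps n != 0].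
Proof.
move=> s0 scv sk hC m0 sk1 sk2 B1 B2.
have [ka kB] := akernel_ccvg_mass mu s0 scv sk hC.
set B := fun n => atransform mu (Z n).
have s20 n : 0 < s n ^+ 2 by rewrite exprn_gt0.
have C0 : 0 < C.
  have := le_trans (sk 0 a) (hC 0); have := s20 0; nra.
have m20 : 0 < mass mu a ^+ 2 by rewrite exprn_gt0.
pose c := mass mu a ^+ 2 / 2 / C.
have c0 : 0 < c by rewrite !divr_gt0.
have hB : \forall n \near \oo, c <= s n ^+ 2 * sqmod (B n).
  have := ccvg_sqmod kB; rewrite [sqmod (_%:C%C)]/sqmod /= expr0n addr0 => cvB.
  have : \forall n \near \oo, mass mu a ^+ 2 / 2 <= sqmod (akernel (Z n) a * B n).
    have h : mass mu a ^+ 2 / 2 < mass mu a ^+ 2 by lra.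
    exact: cvgr_ge cvB _ h.
  apply: filterS => n; rewrite sqmodM /c => h.
  rewrite ler_pdivrMr // [leRHS]mulrAC; apply: le_trans h _.
  rewrite ler_wpM2r ?sqmod_ge0 // mulrC; exact: hC.
(* All the eventual hypotheses hold from N on; the sequences are shifted by N. *)
have [N _ hN] := filterI (filterI hB (filterI sk1 sk2)) (filterI B1 B2).
pose sh n := (n + N)%N.
have shN n : (N <= sh n)%N by rewrite leq_addl.
have ecvg (e : nat -> nat) : (forall n, (n <= e n)%N) -> e n @[n --> \oo] --> \oo.
  move=> ne A [M _ hM]; exists M => // n /= Mn; apply: hM => /=.
  exact: leq_trans Mn (ne n).
have ssh : s (sh n) @[n --> \oo] --> 0.
  by apply: (cvg_comp _ s (ecvg sh _)) => // n; exact: leq_addr.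
have [|||||b1 [e1 he1 [k1 kB1]]] := @akernel_concentration mu1 (Z1 \o sh) (s \o sh) c.
- by move=> n; exact: s0.
- by [].
- by [].
- by move=> n x /=; have [[_ [h _]] _] := hN _ (shN n); exact: h.
- by move=> n /=; have [[h _] [-> _]] := hN _ (shN n).
have he1' n : (n <= e1 n)%N by [].
pose sh1 n := sh (e1 n).
have sh1N n : (N <= sh1 n)%N by exact: shN.
have le_sh1 n : (n <= sh1 n)%N by rewrite (leq_trans (he1 n)) // leq_addr.
have [|||||b2 [e2 he2 [k2 kB2]]] := @akernel_concentration mu2 (Z2 \o sh1) (s \o sh1) c.
- by move=> n; exact: s0.
- exact: (cvg_comp _ s (ecvg _ le_sh1)).
- by [].
- by move=> n x /=; have [[_ [_ h]] _] := hN _ (sh1N n); exact: h.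
- by move=> n /=; have [[h _] [_ ->]] := hN _ (sh1N n).
pose e n := sh1 (e2 n).
have ne n : (n <= e n)%N by rewrite (leq_trans (he2 n)) // le_sh1.
have eN n : (N <= e n)%N by exact: sh1N.
exists b1, b2; exists e => //=.
have kae := ccvg_sub ne ka; have kBe := ccvg_sub ne kB.
have B0 n : B (e n) != 0.
  have [[h _] _] := hN _ (eN n); rewrite -sqmod_gt0.
  by have := lt_le_trans c0 h; rewrite pmulr_rgt0.
split.
- by split => //; apply: ccvg_ext kBe => n /=; rewrite invrK.
- split; first exact: (ccvg_sub he2 k1).
  apply: ccvg_ext (ccvg_sub he2 kB1) => n /=; rewrite invrK.
  by have [_ [h _]] := hN _ (eN n); rewrite -h.
- split => //.
  apply: ccvg_ext kB2 => n /=; rewrite invrK.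
  by have [_ [_ h]] := hN _ (eN n); rewrite -h.
- split; last by move=> n; rewrite invr_eq0; exact: B0.
  have m0' : ((mass mu a)%:C)%C != 0 by rewrite eq_complex /= negb_and gt_eqF.
  rewrite -[0](mul0r ((mass mu a)%:C%C)^-1).
  apply: ccvg_ext (ccvgM kae (ccvgV m0' kBe)) => n /=.
  have ka0 : akernel (Z (e n)) a != 0.
    by rewrite -sqmod_gt0; apply: lt_le_trans (sk _ _).
 
  by rewrite invfM mulrA divff // mul1r.
Qed.

End AffineKernel.

(** * Finitely supported measures *)

Section FiniteSupport.
Context {R : realType} {X : ptopologicalType}.
Hypothesis measurable_point : forall b, measurable ([set b] : set (borel X)).
Implicit Types (mu nu : prob R X) (s : seq X).

Lemma bounded_meas_point (x : X) :
  bounded_meas (T := borel X) (fun t => (t == x)%:R : R).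
Proof.
have -> : (fun t : borel X => (t == x)%:R : R) = \1_[set x].
  apply/funext => t; rewrite indicE; case: eqP => [->|tx]; first by rewrite mem_set.
  by rewrite memNset.
split; first exact: measurable_indic.
by exists 1 => t; rewrite indicE; case: (_ \in _); rewrite ?normr1 ?normr0.
Qed.

Lemma Rintegral_point mu (x : X) :
  Rintegral mu setT (fun t => (t == x)%:R) = mass mu x.
Proof.
have -> : (fun t : borel X => (t == x)%:R : R) = \1_[set x].
  apply/funext => t; rewrite indicE; case: eqP => [->|tx]; first by rewrite mem_set.
  by rewrite memNset.
by rewrite /Rintegral integral_indic // setIT.
Qed.

Lemma mass_ge0 mu x : 0 <= mass mu x.
Proof. by rewrite fine_ge0. Qed.

Lemma massE mu x : mu [set x] = (mass mu x)%:E.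
Proof. by rewrite fineK // fin_num_measure. Qed.

Lemma bounded_meas_sum (I : Type) (r : seq I) (F : I -> X -> R) :
  (forall i, bounded_meas (T := borel X) (F i)) ->
  bounded_meas (T := borel X) (fun t => \sum_(i <- r) F i t).
Proof.
move=> bF; elim: r => [|i r IH].
  by under eq_fun do rewrite big_nil; exact: bounded_meas_cst.
by under eq_fun do rewrite big_cons; exact: bounded_measD.
Qed.

Lemma Rintegral_bd_sum mu (I : Type) (r : seq I) (F : I -> X -> R) :
  (forall i, bounded_meas (T := borel X) (F i)) ->
  Rintegral mu setT (fun t => \sum_(i <- r) F i t) =
  \sum_(i <- r) Rintegral mu setT (F i).
Proof.
move=> bF; elim: r => [|i r IH].
  by under eq_Rintegral do rewrite big_nil; rewrite big_nil Rintegral_prob_cst.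
under eq_Rintegral do rewrite big_cons.
by rewrite big_cons Rintegral_bdD ?IH //; exact: bounded_meas_sum.
Qed.

Lemma sum_point s (t : X) : uniq s -> \sum_(x <- s) (t == x)%:R = (t \in s)%:R :> R.
Proof.
move=> us; have [ts|ts] := boolP (t \in s).
  rewrite (bigD1_seq t) //= eqxx big1 ?addr0 // => x /negPf; rewrite eq_sym.
  by move=> ->.
rewrite big_seq big1 // => x xs; case: eqP => // tx.
by move: ts; rewrite tx xs.
Qed.

Lemma Rintegral_mem mu s : uniq s ->
  Rintegral mu setT (fun t => (t \in s)%:R) = \sum_(x <- s) mass mu x.
Proof.
move=> us; under eq_Rintegral do rewrite -sum_point //.
rewrite Rintegral_bd_sum; first by under eq_bigr do rewrite Rintegral_point.
exact: bounded_meas_point.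
Qed.

Lemma bounded_meas_mem s : uniq s ->
  bounded_meas (T := borel X) (fun t => (t \in s)%:R : R).
Proof.
move=> us; under eq_fun do rewrite -sum_point //.
exact/bounded_meas_sum/bounded_meas_point.
Qed.

Lemma sum_mass_le1 mu s : uniq s -> \sum_(x <- s) mass mu x <= 1.
Proof.
move=> us; rewrite -Rintegral_mem // -[leRHS](Rintegral_prob_cst mu 1).
apply: Rintegral_bd_le; first exact: bounded_meas_mem.
  exact: bounded_meas_cst.
by move=> t; case: (_ \in _).
Qed.

Lemma mass_le1 mu x : mass mu x <= 1.
Proof. by have := @sum_mass_le1 mu [:: x] isT; rewrite big_seq1. Qed.

(** The function g agrees with f on s and vanishes elsewhere, so |f - g| is at
    most M off s, where the measure has no mass. *)
Lemma Rintegral_finite_support mu s (f : X -> R) : uniq s ->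
  \sum_(x <- s) mass mu x = 1 -> bounded_meas (T := borel X) f ->
  Rintegral mu setT f = \sum_(x <- s) mass mu x * f x.
Proof.
move=> us s1 bf; have [mf [M hM]] := bf.
pose g t := \sum_(x <- s) f x * (t == x)%:R.
have bg1 x : bounded_meas (T := borel X) (fun t => f x * (t == x)%:R).
  by apply: bounded_measM; [exact: bounded_meas_cst|exact: bounded_meas_point].
have bg : bounded_meas (T := borel X) g by exact: bounded_meas_sum.
have Ig : Rintegral mu setT g = \sum_(x <- s) mass mu x * f x.
  rewrite Rintegral_bd_sum //; apply: eq_bigr => x _.
  rewrite Rintegral_bdZ; last exact: bounded_meas_point.
  by rewrite Rintegral_point mulrC.
rewrite -Ig.
pose h t : R := M * (1 + (-1) * (t \in s)%:R).
have bm := bounded_meas_mem us.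
have bh1 : bounded_meas (T := borel X) (fun t => (-1) * (t \in s)%:R : R).
  by apply: bounded_measM => //; exact: bounded_meas_cst.
have bc (c : R) := bounded_meas_cst (T := borel X) c.
have bh2 : bounded_meas (T := borel X) (fun t => 1 + (-1) * (t \in s)%:R : R).
  exact: bounded_measD.
have bh : bounded_meas (T := borel X) h by exact: bounded_measM.
have Ih : Rintegral mu setT h = 0.
  rewrite Rintegral_bdZ // Rintegral_bdD // Rintegral_bdZ // Rintegral_mem //.
  by rewrite s1 Rintegral_prob_cst mulN1r subrr mulr0.
have gE t : g t = f t * (t \in s)%:R.
  rewrite /g -sum_point // mulr_sumr; apply: eq_bigr => x _.
  by case: eqP => [->|] //; rewrite !mulr0.
have fgh t : f t <= g t + h t /\ g t <= f t + h t.
  rewrite gE /h; have := hM t; rewrite ler_norml => /andP[h1 h2].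
  by case: (t \in s) => /=; split; lra.
apply/eqP; rewrite eq_le; apply/andP; split.
  rewrite -[leRHS]addr0 -Ih -Rintegral_bdD //; apply: Rintegral_bd_le => //.
    exact: bounded_measD.
  by move=> t; case: (fgh t).
rewrite -[leRHS]addr0 -Ih -Rintegral_bdD //; apply: Rintegral_bd_le => //.
  exact: bounded_measD.
by move=> t; case: (fgh t).
Qed.

Lemma cintegral_finite_support mu s (f : X -> R[i]) : uniq s ->
  \sum_(x <- s) mass mu x = 1 -> cbounded_meas f ->
  cintegral mu f = \sum_(x <- s) (mass mu x)%:C%C * f x.
Proof.
move=> us s1 [rf jf].
rewrite /cintegral !(Rintegral_finite_support us s1) //.
elim: {us s1} s => [|x s IH]; first by rewrite !big_nil.
by rewrite !big_cons -IH; apply: complex_eqP => /=;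
  rewrite ?Re_add ?Im_add ?Re_mul ?Im_mul /= !mul0r ?subr0 ?addr0.
Qed.

Lemma is_dirac_at_mass mu a : is_dirac_at a mu -> forall b, mass mu b = (a == b)%:R.
Proof.
move=> h b; rewrite /mass (h [set b]) // diracE /=; congr (_%:R).
by congr nat_of_bool; apply/idP/eqP; rewrite inE.
Qed.

(** [is_dirac_at] only concerns Borel sets: a set containing a has mass 1 and
    a set avoiding a lies in the null complement of a. *)
Lemma mass1_is_dirac_at mu a : mass mu a = 1 -> is_dirac_at a mu.
Proof.
move=> ma A mA; have mua : mu [set a] = 1%E by rewrite massE ma.
rewrite diracE; have [/set_mem aA|] := boolP ((a : borel X) \in A).
  apply/eqP; rewrite eq_le probability_le1 //= -mua.
  by rewrite le_measure ?inE // => x ->.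
move=> /= /negP; rewrite in_setE => aA; apply/eqP.
rewrite eq_le measure_ge0 andbT.
have := probability_setC mu (measurable_point a); rewrite mua subee // => mC.
rewrite [leRHS](_ : _ = mu (~` [set a])); last by rewrite mC.
by rewrite le_measure ?inE //; [exact: measurableC|move=> x Ax xa; rewrite xa in Ax].
Qed.

(** Existence of a discrete measure with prescribed weights, characterized by
    its integrals; the index set is not empty because the weights add up
    to 1. *)
Let finite_prob_ord (n : nat) (w : 'I_n -> R) (a : 'I_n -> X) :
  (forall i, 0 <= w i) -> \sum_i w i = 1 ->
  exists nu : prob R X, forall f, bounded_meas (T := borel X) f ->
    Rintegral nu setT f = \sum_i w i * f (a i).
Proof.
case: n w a => [|n] w a w0 w1.
  by move: w1; rewrite big_ord0 => /esym/eqP; rewrite oner_eq0.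
(* Only the indices k < n.+1 matter; [inord] extends the family to nat. *)
pose m (k : nat) : {measure set (borel X) -> \bar R} :=
  mscale (NngNum (w0 (inord k))) (dirac (a (inord k) : borel X)).
pose nu0 : set (borel X) -> \bar R := msum m n.+1.
have nuT : msum m n.+1 setT = 1%E.
  rewrite /msum -[RHS]/(1%:E) -w1 -sumEFin; apply: eq_bigr => i _.
  by rewrite /m /= /mscale /= diracT mule1 inord_val.
pose nu : probability (borel X) R :=
  HB.pack nu0 (Measure.on (msum m n.+1)) (Measure_isProbability.Build _ _ _ _ nuT).
exists nu => f [mf [M hM]].
(* The integral against a sum of measures is first computed for nonnegative
   functions; f is then shifted by its bound M. *)
have pos (g : X -> R) : measurable_fun setT (g : borel X -> R) -> (forall x, 0 <= g x) ->
    Rintegral nu setT g = \sum_i w i * g (a i).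
  move=> mg g0; rewrite /Rintegral /=.
  have mg' : measurable_fun [set: borel X] (fun x => (g x)%:E) by exact/measurable_EFinP.
  rewrite [X in fine X](_ : _ = (\sum_i w i * g (a i))%:E) //.
  rewrite -sumEFin [LHS](@ge0_integral_measure_sum _ _ _ m setT measurableT
    (fun x => (g x)%:E)) //; last by move=> x _; rewrite lee_fin.
  apply: eq_bigr => i _; rewrite /m ge0_integral_mscale //; last first.
    by move=> x _; rewrite lee_fin.
  by rewrite integral_dirac // diracT mul1e /= inord_val.
have bf : bounded_meas (T := borel X) f by split => //; exists M.
have bc := bounded_meas_cst (T := borel X) M.
have := Rintegral_bdD nu bf bc; rewrite Rintegral_prob_cst pos.
- under eq_bigr do rewrite mulrDr.
  rewrite big_split /= -mulr_suml w1 mul1r => /addIr <-.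
  by [].
- by apply: measurable_funD.
- by move=> x; have := hM x; rewrite ler_norml => /andP[h _]; lra.
Qed.

Lemma finite_prob (I : finType) (w : I -> R) (a : I -> X) :
  (forall k, 0 <= w k) -> \sum_k w k = 1 ->
  exists nu : prob R X, forall f, bounded_meas (T := borel X) f ->
    Rintegral nu setT f = \sum_k w k * f (a k).
Proof.
move=> w0 w1.
have [||nu hnu] := @finite_prob_ord #|I| (fun k => w (enum_val k)) (fun k => a (enum_val k)).
- by [].
- by rewrite -w1 [RHS](reindex (@enum_val I predT)) //; exact/onW_bij/enum_val_bij.
exists nu => f /hnu ->.
by rewrite [RHS](reindex (@enum_val I predT)) //; exact/onW_bij/enum_val_bij.
Qed.

End FiniteSupport.

(** * Dirac factors from the rule for atoms *)

(** Summing p + m2 (B a) = 1 + m a over the n atoms gives n p + (at most 1) on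
    the left and n + 1 on the right, whence p >= 1. *)
Lemma common_first_atom {R : realType} {X : choiceType} (m m1 m2 : X -> R) (s : seq X)
    (a0 : X) (B : X -> X) (p : R) :
  uniq s -> a0 \in s -> \sum_(a <- s) m a = 1 -> p <= 1 ->
  (forall t, uniq t -> \sum_(x <- t) m2 x <= 1) ->
  (forall a, a \in s -> p + m2 (B a) = 1 + m a) ->
  {in s &, injective B} -> p = 1.
Proof.
move=> us a0s s1 p1 hm2 hB iB.
have uB : uniq (map B s) by rewrite map_inj_in_uniq.
have := hm2 _ uB; rewrite big_map => h2.
have : \sum_(a <- s) (p + m2 (B a)) = \sum_(a <- s) (1 + m a).
  by rewrite !big_seq; apply: eq_bigr => a /hB.
rewrite !big_split /= s1 !big_const_seq !count_predT !iter_addr_0 => e.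
have sz : 1 <= (size s)%:R :> R.
  by rewrite ler1n; case: s a0s {us s1 hB iB uB h2 e}.
apply/eqP; rewrite eq_le p1 /=.
move: e h2; rewrite -(mulr_natr p) => e h2.
rewrite -(ler_pM2r (lt_le_trans ltr01 sz)); move: e; set q := \sum_(_ <- _) _ in h2 *.
lra.
Qed.

(** Two pairs (A a, B a) and (A b, B b) distinct in both coordinates would give
    m1 or m2 a total mass above 1, so any two of them share a coordinate.  A
    family of distinct pairs with this property has a coordinate common to all
    its members, and [common_first_atom] applies to it. *)
Lemma dirac_factor_of_atoms {R : realType} {X : choiceType} (m m1 m2 : X -> R)
    (s : seq X) (A B : X -> X) :
  uniq s -> (forall a, a \in s -> 0 < m a) -> \sum_(a <- s) m a = 1 ->
  (forall t, uniq t -> \sum_(x <- t) m1 x <= 1) ->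
  (forall t, uniq t -> \sum_(x <- t) m2 x <= 1) ->
  (forall a, a \in s -> m1 (A a) + m2 (B a) = 1 + m a) ->
  (forall a b, a \in s -> b \in s -> A a = A b -> B a = B b -> a = b) ->
  exists2 a, a \in s & m1 (A a) = 1 \/ m2 (B a) = 1.
Proof.
move=> us m0 s1 h1 h2 hAB inj.
have [a0 a0s] : exists a, a \in s.
  case: s s1 {us m0 hAB inj} => [|a s _]; last by exists a; rewrite mem_head.
  by rewrite big_nil => /esym/eqP; rewrite oner_eq0.
have le1 (q : X -> R) : (forall t, uniq t -> \sum_(x <- t) q x <= 1) ->
    forall x, q x <= 1.
  by move=> hq x; have := hq [:: x] isT; rewrite big_seq1.
have le2 (q : X -> R) : (forall t, uniq t -> \sum_(x <- t) q x <= 1) ->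
    forall x y, x != y -> q x + q y <= 1.
  move=> hq x y xy; have := hq [:: x; y]; rewrite /= inE xy /= => /(_ isT).
  by rewrite big_cons big_seq1.
have share a b : a \in s -> b \in s -> A a != A b -> B a = B b.
  move=> sa sb nA; apply/eqP; apply: contraT => nB.
  have := le2 _ h1 _ _ nA; have := le2 _ h2 _ _ nB.
  have := hAB _ sa; have := hAB _ sb; have := m0 _ sa; have := m0 _ sb; lra.
exists a0 => //.
have [/allP hA|/allPn[b sb bA]] := boolP (all (fun a => A a == A a0) s).
  left; apply: (@common_first_atom _ _ m m1 m2 s a0 B) => //.
  - exact: le1.
  - by move=> a sa; rewrite -(eqP (hA _ sa)) hAB.
  - by move=> a b sa sb; apply: inj => //; rewrite (eqP (hA _ sa)) (eqP (hA _ sb)).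
have [/allP hB|/allPn[c sc cB]] := boolP (all (fun a => B a == B a0) s).
  right; apply: (@common_first_atom _ _ m m2 m1 s a0 A) => //.
  - exact: le1.
  - by move=> a sa; rewrite -(eqP (hB _ sa)) addrC hAB.
  - move=> a d sa sd e; apply: inj => //.
    by rewrite (eqP (hB _ sa)) (eqP (hB _ sd)).
have bB := share _ _ sb a0s bA.
have cA : A c = A a0.
  by apply/eqP; apply: contraNT cB => h; rewrite (share _ _ sc a0s h).
have : B b = B c by apply: share => //; rewrite cA.
by rewrite bB => e; rewrite e eqxx in cB.
Qed.

(** * Subordination equations near an atom *)

Section PointsAreMeasurable.
Context {R : realType} {X : ptopologicalType} (i : X -> R[i]).

Lemma measurable_point_ccont : ccont i -> injective i ->
  forall b, measurable ([set b] : set (borel X)).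
Proof.
move=> [ri ji] inj b.
have -> : ([set b] : set (borel X)) =
    ((fun x : borel X => Re (i x)) @^-1` [set Re (i b)]) `&`
    ((fun x : borel X => Im (i x)) @^-1` [set Im (i b)]).
  apply/seteqP; split => x /=; first by move=> ->.
  by move=> [h1 h2]; apply: inj; exact: complex_eqP.
have mr := continuous_borel_measurable ri; have mj := continuous_borel_measurable ji.
by apply: measurableI; rewrite -[X in measurable X]setTI; [exact: mr|exact: mj].
Qed.

End PointsAreMeasurable.

Lemma Re_cvg_gt0 {R : realType} (z : nat -> R[i]) (m : R) : 0 < m ->
  ccvg z m%:C%C -> \forall n \near \oo, m / 2 < Re (z n).
Proof.
move=> m0 [cz _]; have h : m / 2 < m by lra.
exact: cvgr_gt cz _ h.
Qed.

Section LimitRelations.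
Context {R : realType}.

(** With f, g, h the differences z - a, z1 - b1, z2 - b2, the equation reads
    f + a = g + b1 + h + b2 - eps: in the limit a = b1 + b2, and after division
    by eps, m = m1 + m2 - 1. *)
Lemma additive_atom_relation (z z1 z2 eps : nat -> R[i]) (a b1 b2 m m1 m2 : R) :
  (forall n, z n = z1 n + z2 n - eps n) -> (forall n, eps n != 0) -> ccvg eps 0 ->
  ccvg (fun n => z n - a%:C%C) 0 -> ccvg (fun n => (z n - a%:C%C) / eps n) m%:C%C ->
  ccvg (fun n => z1 n - b1%:C%C) 0 -> ccvg (fun n => (z1 n - b1%:C%C) / eps n) m1%:C%C ->
  ccvg (fun n => z2 n - b2%:C%C) 0 -> ccvg (fun n => (z2 n - b2%:C%C) / eps n) m2%:C%C ->
  a = b1 + b2 /\ m1 + m2 = 1 + m.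
Proof.
move=> hz e0 ce f0 f1 g0 g1 h0 h1.
have ab : a = b1 + b2.
  have e : (b1 + b2 - a)%:C%C = 0 + 0 + - 0 + - 0 :> R[i].
    apply: ccvg_unique (ccvgD (ccvgD (ccvgD f0 ce) (ccvgN g0)) (ccvgN h0)).
    apply: ccvg_ext (ccvg_cst _) => n; rewrite hz !rmorphB rmorphD /=; ring.
  by move/(congr1 (@complex.Re R)): e => /=; lra.
split=> //.
have e : m%:C%C = m1%:C%C + m2%:C%C + -1 :> R[i].
  apply: ccvg_unique f1 _; apply: ccvg_ext (ccvgD (ccvgD g1 h1) (ccvg_cst (-1))) => n /=.
  by rewrite hz ab rmorphD /=; field.
by move/(congr1 (@complex.Re R)): e => /=; lra.
Qed.

(** With f, g, h the differences 1 - z a, 1 - z1 b1, 1 - z2 b2, the equation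
    multiplied by a b1 b2 reads (1 - g)(1 - h) a = (1 - f)(1 - eps) b1 b2: in
    the limit a = b1 b2, and the remaining identity
    g + h - g h = f + eps - f eps divided by eps gives m1 + m2 = m + 1. *)
Lemma multiplicative_atom_relation (z z1 z2 eps : nat -> R[i]) (a b1 b2 : R[i])
    (m m1 m2 : R) :
  (forall n, z1 n * z2 n = z n * (1 - eps n)) -> (forall n, eps n != 0) -> ccvg eps 0 ->
  ccvg (fun n => 1 - z n * a) 0 -> ccvg (fun n => (1 - z n * a) / eps n) m%:C%C ->
  ccvg (fun n => 1 - z1 n * b1) 0 -> ccvg (fun n => (1 - z1 n * b1) / eps n) m1%:C%C ->
  ccvg (fun n => 1 - z2 n * b2) 0 -> ccvg (fun n => (1 - z2 n * b2) / eps n) m2%:C%C ->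
  a = b1 * b2 /\ m1 + m2 = 1 + m.
Proof.
move=> hz e0 ce; set f := fun n => 1 - z n * a; set g := fun n => 1 - z1 n * b1.
set h := fun n => 1 - z2 n * b2 => f0 f1 g0 g1 h0 h1.
have one := ccvg_cst (1 : R[i]).
have E n : (1 - g n) * (1 - h n) * a = (1 - f n) * (1 - eps n) * (b1 * b2).
  rewrite /f /g /h !subKr.
  transitivity (z1 n * z2 n * (b1 * b2 * a)); first by ring.
  by rewrite hz; ring.
have ab : a = b1 * b2.
  have c1 := ccvgM (ccvgM (ccvgD one (ccvgN g0)) (ccvgD one (ccvgN h0))) (ccvg_cst a).
  have c2 := ccvgM (ccvgM (ccvgD one (ccvgN f0)) (ccvgD one (ccvgN ce))) (ccvg_cst (b1 * b2)).
  have := ccvg_unique c1 (ccvg_ext (fun n => esym (E n)) c2).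
  by rewrite oppr0 !addr0 !mulr1 !mul1r.
split=> //.
(* If a were 0, 1 - z a would be constantly 1 and could not tend to 0. *)
have a0 : a != 0.
  apply/eqP => a0; have e : 1 = 0 :> R[i].
    by apply: ccvg_unique f0; apply: ccvg_ext (ccvg_cst _) => n; rewrite /f a0 mulr0 subr0.
  by move/eqP: e; rewrite oner_eq0.
have {}E n : (1 - g n) * (1 - h n) = (1 - f n) * (1 - eps n).
  by apply: (mulIf a0); rewrite E -ab.
have e : m1%:C%C + m2%:C%C + - (0 * m2%:C%C) = m%:C%C + 1 + - 0 :> R[i].
  apply: ccvg_unique (ccvgD (ccvgD g1 h1) (ccvgN (ccvgM g0 h1))) _.
  apply: ccvg_ext (ccvgD (ccvgD f1 one) (ccvgN f0)) => n.
  have := E n; have := e0 n; rewrite -/(f n) -/(g n) -/(h n).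
  move: (f n) (g n) (h n) (eps n) => F G H e ne EE.
  have -> : F / e + 1 - F = (1 - (1 - F) * (1 - e)) / e by field.
  by rewrite -EE; field.
by move/(congr1 (@complex.Re R)): e => /=; lra.
Qed.

End LimitRelations.

(** * The rule for atoms: additive case *)

Section FreeAdditiveAtoms.
Context {R : realType}.
Implicit Types (mu nu : Madd R) (z : R[i]).

Let u (t : R) : R[i] := - t%:C%C.
Let v (t : R) : R[i] := -1.

Lemma ccont_real : ccont (fun t : R => t%:C%C).
Proof. by split => t; [exact: cvg_id|exact: cvg_cst]. Qed.

Let cu : ccont u. Proof. exact/ccontN/ccont_real. Qed.
Let cv : ccont v. Proof. exact: ccont_cst. Qed.

Let uv_indep b t : t <> b -> u t * v b - u b * v t != 0.
Proof.
move=> tb; rewrite /u /v !mulrN1 !opprK -rmorphB /= eq_complex /= eqxx andbT.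
by rewrite subr_eq0; exact/eqP.
Qed.

Lemma measurable_point_real : forall b : R, measurable ([set b] : set (borel R)).
Proof. by apply: (measurable_point_ccont ccont_real) => x y [->]. Qed.

Lemma akernel_add z t : akernel u v z t = z - t%:C%C.
Proof. by rewrite /akernel /u /v mulrN1 opprK addrC. Qed.

Definition cauchy_transform mu z := cintegral mu (fun t : R => (z - t%:C%C)^-1).

Let atransform_add mu z : atransform u v mu z = cauchy_transform mu z.
Proof. by apply: cintegral_ext => t; rewrite akernel_add. Qed.

Lemma F_transformE mu z : F_transform mu z = (cauchy_transform mu z)^-1.
Proof. by []. Qed.

Lemma sqmod_shift_ge z (t : R) : Im z ^+ 2 <= sqmod (z - t%:C%C).
Proof. by rewrite /sqmod !Im_add !Im_opp /= subr0 lerDr sqr_ge0. Qed.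

Lemma cbounded_meas_cauchy z : 0 < Im z ->
  cbounded_meas (fun t : R => (z - t%:C%C)^-1).
Proof.
move=> z0; apply: cbounded_meas_inv z0 _ (sqmod_shift_ge z).
by apply: ccontD; [exact: ccont_cst|exact/ccontN/ccont_real].
Qed.

(** For G the Cauchy transform, - Im G(z) is Im z times the integral of
    1/|z - t|^2, which is at least |G(z)|^2; divide by |G(z)|^2, which is not
    0 since - Im G(z) > 0. *)
Lemma Im_F_transform_ge mu z : 0 < Im z -> Im z <= Im (F_transform mu z).
Proof.
move=> z0; have bf := cbounded_meas_cauchy z0.
have B : - Im (cauchy_transform mu z) =
    Im z * Rintegral mu setT (fun t : R => sqmod (z - t%:C%C)^-1).
  rewrite -Rintegral_bdZ; last exact: bounded_meas_sqmod.
  rewrite /cauchy_transform /= -mulN1r -Rintegral_bdZ; last by case: bf.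
  apply: eq_Rintegral => t _.
  by rewrite Im_inv sqmodV Im_add Im_opp /= subr0 mulN1r mulNr opprK.
have J := sqmod_cintegral_le mu bf.
have h : Im z * sqmod (cauchy_transform mu z) <= - Im (cauchy_transform mu z).
  by rewrite B ler_pM2l.
rewrite F_transformE Im_inv; have [e|ne] := eqVneq (cauchy_transform mu z) 0.
  have : 0 < Rintegral mu setT (fun t : R => sqmod (z - t%:C%C)^-1).
    apply: Rintegral_gt0; first exact: bounded_meas_sqmod.
    move=> t; rewrite sqmodV invr_gt0.
    by apply: lt_le_trans (sqmod_shift_ge z t); rewrite exprn_gt0.
  by move=> pos; move: B; rewrite e oppr0 => /esym/eqP; rewrite mulf_eq0 !gt_eqF.
by rewrite ler_pdivlMr // sqmod_gt0.
Qed.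

(** The measure mu is probed along z_n = a + i/(n+1).  The values of [class_F]
    functions at z_n have imaginary part at least 1/(n+1), which is the lower
    bound required on the kernels. *)
Lemma free_add_atom mu1 mu2 mu (a : R) : free_add mu1 mu2 mu -> 0 < mass mu a ->
  exists b1 b2, a = b1 + b2 /\ mass mu1 b1 + mass mu2 b2 = 1 + mass mu a.
Proof.
move=> [Z1 [Z2 [FZ1 FZ2 hZ]]] ma.
pose s n : R := n.+1%:R^-1.
pose z n : R[i] := (a +i* s n)%C.
have s0 n : 0 < s n by rewrite invr_gt0.
have Iz n : upper_half_plane (z n) by exact: s0.
have ker n : akernel u v (z n) a = (0 +i* s n)%C.
  by rewrite akernel_add /z; apply: complex_eqP; rewrite ?Re_add ?Im_add /= ?subrr ?oppr0 ?addr0.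
have FI Z n : class_F Z -> s n <= Im (Z (z n)).
  by move=> [nu hnu]; rewrite hnu //; exact: (@Im_F_transform_ge nu (z n) (s0 n)).
have sF Z n (x : R) : class_F Z -> s n ^+ 2 <= sqmod (akernel u v (Z (z n)) x).
  move=> FZ; rewrite akernel_add; apply: le_trans (sqmod_shift_ge _ _).
  by rewrite ler_sqr ?nnegrE ?FI // (le_trans (ltW (s0 n))) // FI.
have eqB Z nu n : F_transform nu (Z (z n)) = F_transform mu (z n) ->
    atransform u v nu ((Z \o z) n) = atransform u v mu (z n).
  by rewrite !F_transformE !atransform_add => /invr_inj.
have [|||||||||b1 [b2 [e he]]] := @subordination_atoms R R u v cu cv uv_indep
  measurable_point_real mu mu1 mu2 z (Z1 \o z) (Z2 \o z) s 1 a.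
- by [].
- exact: cvg_harmonic.
- by move=> n x; rewrite akernel_add; exact: (sqmod_shift_ge (z n)).
- by move=> n; rewrite ker /sqmod /= expr0n add0r mul1r.
- by [].
- by apply: nearW => n x; exact: sF.
- by apply: nearW => n x; exact: sF.
- by apply: nearW => n; apply: eqB; have [_ _ ->] := hZ _ (Iz n).
- by apply: nearW => n; apply: eqB; have [_ <- ->] := hZ _ (Iz n).
rewrite /=; set eps := fun n => _^-1.
have E (y : nat -> R[i]) b : (fun n => akernel u v (y n) b) = (fun n => y n - b%:C%C).
  by apply/funext => n; rewrite akernel_add.
have E' (y : nat -> R[i]) b :
    (fun n => akernel u v (y n) b / eps n) = (fun n => (y n - b%:C%C) / eps n).
  by apply/funext => n; rewrite akernel_add.
rewrite !E !E' => -[[f0 f1] [g0 g1] [h0 h1] [ce e0]].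
exists b1, b2; apply: (additive_atom_relation _ e0 ce f0 f1 g0 g1 h0 h1) => n.
have [h1' _ h3] := hZ _ (Iz (e n)); rewrite [LHS]h1' -h3.
by rewrite /eps F_transformE atransform_add.
Qed.
End FreeAdditiveAtoms.

(** * Multiplicative transforms of measures *)

Section MultiplicativeKernel.
Context {R : realType} {X : ptopologicalType} (i : X -> R[i]).
Hypotheses (ci : ccont i) (inji : injective i).
Implicit Types (mu nu : prob R X) (z : R[i]).

(** Common form of the transforms on the half-line and on the circle, i being
    the inclusion in the complex plane: [eta_transform] is K or Q. *)
Definition psi_transform mu z := cintegral mu (fun x => z * i x / (1 - z * i x)).
Definition eta_transform mu z := psi_transform mu z / (1 + psi_transform mu z).
(** The integral equal to 1 + psi, so that eta = 1 - 1/[mcauchy], as soon as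
    the denominators are bounded away from 0. *)
Definition mcauchy mu z := cintegral mu (fun x => (1 - z * i x)^-1).

Let mp := measurable_point_ccont ci inji.

Let cu : ccont (fun _ : X => 1 : R[i]) := ccont_cst 1.

Let uv_indep b t : t <> b -> 1 * i b - 1 * i t != 0.
Proof. by move=> tb; rewrite !mul1r subr_eq0; apply/eqP => /inji /esym. Qed.

Let atransformE mu z : atransform (fun=> 1) i mu z = mcauchy mu z. Proof. by []. Qed.

Lemma cbounded_meas_mcauchy z (s : R) : 0 < s ->
  (forall x, s ^+ 2 <= sqmod (1 - z * i x)) -> cbounded_meas (fun x => (1 - z * i x)^-1).
Proof.
move=> s0 hs; apply: cbounded_meas_inv s0 _ hs.
by apply: ccontD => //; apply/ccontN/ccontM => //; exact: ccont_cst.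
Qed.

Lemma psi_transformE mu z (s : R) : 0 < s ->
  (forall x, s ^+ 2 <= sqmod (1 - z * i x)) -> psi_transform mu z = mcauchy mu z - 1.
Proof.
move=> s0 hs; rewrite -[in RHS](cintegral_cst mu 1) -[X in _ - X]mul1r.
rewrite -mulNr -cintegralZ; last exact: cbounded_meas_cst.
rewrite -cintegralD; first last.
- by rewrite mulr1; exact: cbounded_meas_cst.
- exact: cbounded_meas_mcauchy hs.
apply: cintegral_ext => x; have k0 : 1 - z * i x != 0.
  by rewrite -sqmod_gt0; apply: lt_le_trans (hs x); rewrite exprn_gt0.
by field.
Qed.

Lemma eta_transformE mu z (s : R) : 0 < s ->
  (forall x, s ^+ 2 <= sqmod (1 - z * i x)) ->
  eta_transform mu z = (mcauchy mu z - 1) / mcauchy mu z.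
Proof.
by move=> s0 hs; rewrite /eta_transform (psi_transformE mu s0 hs) [1 + _]addrC subrK.
Qed.

Section NearAnAtom.
Variables (mu : prob R X) (z : nat -> R[i]) (s : nat -> R) (C : R) (a : X).
Hypotheses (s0 : forall n, 0 < s n) (scv : s n @[n --> \oo] --> 0).
Hypothesis sk : forall n x, s n ^+ 2 <= sqmod (1 - z n * i x).
Hypothesis hC : forall n, sqmod (1 - z n * i a) <= C * s n ^+ 2.
Hypothesis ma : 0 < mass mu a.

(** The kernel 1 - z_n i(a) tends to 0, while its product with the transform
    tends to mu{a} > 0. *)
Lemma mcauchy_near_atom : \forall n \near \oo,
  0 < Re ((1 - z n * i a) * mcauchy mu (z n)) /\ mcauchy mu (z n) != 1.
Proof.
have [ka kB] := akernel_ccvg_mass cu ci uv_indep mp mu s0 scv sk hC.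
have h1 := Re_cvg_gt0 ma kB.
have h2 : \forall n \near \oo, Re (1 - z n * i a) <= mass mu a / 2.
  have [c _] := ka; have h : Re (0 : R[i]) < mass mu a / 2 by rewrite divr_gt0.
  exact: cvgr_le c _ h.
near=> n.
have k1 : mass mu a / 2 < Re ((1 - z n * i a) * mcauchy mu (z n)) by near: n.
have k2 : Re (1 - z n * i a) <= mass mu a / 2 by near: n.
split; first by apply: lt_trans k1; rewrite divr_gt0.
by apply/eqP => e; move: k1; rewrite e mulr1 ltNge k2.
Unshelve. all: by end_near. Qed.

Lemma eta_transform_near_atom : \forall n \near \oo,
  mcauchy mu (z n) != 0 /\ eta_transform mu (z n) != 0.
Proof.
apply: filterS mcauchy_near_atom => n [h1 h2].
have B0 : mcauchy mu (z n) != 0.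
  by apply/eqP => e; move: h1; rewrite e mulr0 ltxx.
split=> //; rewrite (eta_transformE mu (s0 n) (sk n)).
by rewrite mulf_neq0 ?invr_eq0 // subr_eq0.
Qed.

(** An eta transform differing from 0 determines [mcauchy]; as eta is not 0
    near the atom, the transforms of the three measures coincide there and
    [subordination_atoms] applies. *)
Lemma multiplicative_subordination_atom (mu1 mu2 : prob R X) (z1 z2 : nat -> R[i]) :
  (forall n, z1 n * z2 n = z n * eta_transform mu1 (z1 n)) ->
  (forall n, eta_transform mu1 (z1 n) = eta_transform mu2 (z2 n)) ->
  (forall n, eta_transform mu (z n) = eta_transform mu1 (z1 n)) ->
  (\forall n \near \oo, forall x, s n ^+ 2 <= sqmod (1 - z1 n * i x)) ->
  (\forall n \near \oo, forall x, s n ^+ 2 <= sqmod (1 - z2 n * i x)) ->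
  exists b1 b2, i a = i b1 * i b2 /\ mass mu1 b1 + mass mu2 b2 = 1 + mass mu a.
Proof.
move=> hz h12 h1 sk1 sk2.
have eqB nu y n : (forall x, s n ^+ 2 <= sqmod (1 - y * i x)) ->
    eta_transform mu (z n) = eta_transform nu y -> mcauchy mu (z n) != 0 ->
    eta_transform mu (z n) != 0 -> mcauchy nu y = mcauchy mu (z n).
  move=> hk e B0 E0; move: e E0; rewrite (eta_transformE mu (s0 n) (sk n)).
  rewrite (eta_transformE nu (s0 n) hk) => e E0.
  have B1 : mcauchy nu y != 0.
    by apply: contraNneq E0; rewrite e => ->; rewrite invr0 mulr0.
  apply: invr_inj; move: e; rewrite !mulrBl !divff // !mul1r.
  by move=> /addrI /oppr_inj.
have [|||||||||b1 [b2 [e he]]] := @subordination_atoms R X (fun=> 1) i cu ci uv_indep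
  mp mu mu1 mu2 z z1 z2 s C a.
- by [].
- by [].
- exact: sk.
- exact: hC.
- by [].
- exact: sk1.
- exact: sk2.
- near=> n; rewrite !atransformE; apply: eqB => //; first by near: n.
    by near: n; apply: filterS eta_transform_near_atom => n [].
  by near: n; apply: filterS eta_transform_near_atom => n [].
- near=> n; rewrite !atransformE; apply: eqB; rewrite ?h1 ?h12 //; first by near: n.
    by near: n; apply: filterS eta_transform_near_atom => n [].
  rewrite -h12 -h1.
  by near: n; apply: filterS eta_transform_near_atom => n [].
rewrite /=; set eps := fun n => _^-1.
move=> [[f0 f1] [g0 g1] [k0 k1] [ce e0]].
exists b1, b2; apply: (multiplicative_atom_relation _ e0 ce f0 f1 g0 g1 k0 k1) => n.
rewrite hz -h1 (eta_transformE mu (s0 _) (sk _)) /eps atransformE.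
have := e0 n; rewrite /eps atransformE invr_eq0 => B0.
by rewrite mulrBl divff // mul1r.
Unshelve. all: by end_near. Qed.

End NearAnAtom.
End MultiplicativeKernel.

(** * The rule for atoms: half-line *)

Section PositiveAtoms.
Context {R : realType}.
Notation X := (nonneg_reals R).
Implicit Types (mu nu : prob R X) (z : R[i]).

Definition nnreal_val (x : X) : R[i] := (set_val x)%:C%C.

Lemma nnreal_ge0 (x : X) : 0 <= (set_val x : R).
Proof. exact: set_valP x. Qed.

Lemma nnreal_val_inj : injective nnreal_val.
Proof. by move=> x y [] /val_inj. Qed.

Lemma set_val_nnreal_continuous : continuous (set_val : X -> R).
Proof. exact: initial_continuous. Qed.

Lemma ccont_nnreal_val : ccont nnreal_val.
Proof. by split; [exact: set_val_nnreal_continuous|exact: cst_continuous]. Qed.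

Lemma K_transformE (mu : Mpos R) z : K_transform mu z = eta_transform nnreal_val (set_val mu) z.
Proof. by []. Qed.

(** Write 1 - z J = z (1/z - J): the imaginary parts of 1/z and of - J are both
    nonpositive, so that |1/z - J| is at least Im z / |z|^2. *)
Lemma sqmod_one_sub_mul_ge z (J : R[i]) : 0 < Im z -> 0 <= Im J ->
  Im z ^+ 2 / sqmod z <= sqmod (1 - z * J).
Proof.
move=> z0 J0; have zn0 : z != 0 by apply: contraTneq z0 => ->; rewrite ltxx.
have q0 : 0 < sqmod z by rewrite sqmod_gt0.
have -> : 1 - z * J = z * (z^-1 - J) by field.
have -> : Im z ^+ 2 / sqmod z = sqmod z * (Im z / sqmod z) ^+ 2 by field; rewrite gt_eqF.
rewrite sqmodM ler_pM2l //.
apply: (@le_trans _ _ (Im (z^-1 - J) ^+ 2)); last by rewrite lerDr sqr_ge0.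
rewrite Im_add Im_opp Im_inv mulNr -opprD sqrrN.
have h : 0 <= Im z / sqmod z by rewrite divr_ge0 // ltW.
by rewrite ler_sqr ?nnegrE ?addr_ge0 // lerDl.
Qed.

Let sz z := Im z / Num.sqrt (sqmod z).

Let sz_gt0 z : 0 < Im z -> 0 < sz z.
Proof.
move=> z0; rewrite divr_gt0 // sqrtr_gt0 sqmod_gt0.
by apply: contraTneq z0 => ->; rewrite ltxx.
Qed.

Let sz_le z : 0 < Im z -> forall x : X, sz z ^+ 2 <= sqmod (1 - z * nnreal_val x).
Proof.
move=> z0 x; rewrite /sz expr_div_n sqr_sqrtr ?sqmod_ge0 //.
exact: sqmod_one_sub_mul_ge.
Qed.

Lemma nnreal_kernel_bound z : 0 < Im z ->
  exists2 d : R, 0 < d & forall x : X, d ^+ 2 <= sqmod (1 - z * nnreal_val x).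
Proof. by move=> z0; exists (sz z); [exact: sz_gt0|exact: sz_le]. Qed.

(** For B = [mcauchy], eta(z)/z = 1/z - 1/(z B), so the claim is that
    Im (z B) >= Im z |B|^2.  Pointwise Im (z/(1 - z t)) = Im z / |1 - z t|^2
    for real t, and the integral of 1/|1 - z t|^2 is at least |B|^2. *)
Lemma Im_eta_div_ge0 nu z : 0 < Im z -> 0 <= Im (eta_transform nnreal_val nu z / z).
Proof.
move=> z0; have zn0 : z != 0 by apply: contraTneq z0 => ->; rewrite ltxx.
rewrite (eta_transformE ccont_nnreal_val nu (sz_gt0 z0) (sz_le z0)).
set B := mcauchy _ _ _; have [->|B0] := eqVneq B 0.
  by rewrite invr0 mulr0 mul0r.
have bf := cbounded_meas_mcauchy ccont_nnreal_val (sz_gt0 z0) (sz_le z0).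
have IB : Im (z * B) = Im z * Rintegral nu setT (fun x : X => sqmod (1 - z * nnreal_val x)^-1).
  rewrite -cintegralZ // -Rintegral_bdZ; last exact: bounded_meas_sqmod.
  apply: eq_Rintegral => x _; rewrite Im_mul Re_inv Im_inv sqmodV.
  rewrite Re_add Im_add Re_opp Im_opp Re_mul Im_mul /=.
  have q0 : 0 < sqmod (1 - z * nnreal_val x).
    by apply: lt_le_trans (sz_le z0 x); rewrite exprn_gt0 // sz_gt0.
  by field; rewrite gt_eqF.
have J := sqmod_cintegral_le nu bf.
have {J} J : Im z * sqmod B <= Im (z * B) by rewrite IB ler_pM2l.
have -> : (B - 1) / B / z = z^-1 - (z * B)^-1 by field; rewrite zn0 B0.
have q1 : 0 < sqmod z by rewrite sqmod_gt0.
have q2 : 0 < sqmod B by rewrite sqmod_gt0.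
rewrite Im_add Im_opp !Im_inv sqmodM.
have -> : - Im z / sqmod z - - Im (z * B) / (sqmod z * sqmod B) =
    (Im (z * B) - Im z * sqmod B) / (sqmod z * sqmod B).
  by field; rewrite !gt_eqF.
apply: divr_ge0; first by rewrite subr_ge0.
by rewrite ltW // mulr_gt0.
Qed.

(** Holds for every real z, even when some 1 - z t vanishes: the integrand is
    real in any case. *)
Lemma eta_transform_real nu z : Im z = 0 -> Im (eta_transform nnreal_val nu z) = 0.
Proof.
move=> z0; have rM (x y : R[i]) : Im x = 0 -> Im y = 0 -> Im (x * y) = 0.
  by move=> hx hy; rewrite Im_mul hx hy mulr0 mul0r addr0.
have rV (x : R[i]) : Im x = 0 -> Im x^-1 = 0.
  by move=> hx; rewrite Im_inv hx oppr0 mul0r.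
have psi0 : Im (psi_transform nnreal_val nu z) = 0.
  rewrite /psi_transform /= (_ : (fun x => _) = fun=> 0) ?Rintegral_prob_cst //.
  apply/funext => x; apply: (rM _ _ (rM _ _ z0 (Im_real _))); apply: rV.
  by rewrite Im_add Im_opp rM ?oppr0 ?addr0.
by apply: (rM _ _ psi0); apply: rV; rewrite Im_add psi0 addr0.
Qed.

(** The measure mu is probed along z_n = (1 + i/(n+1))/a, where the kernel at
    the atom is - i/(n+1).  Since Z1 = z (K_mu2(Z2)/Z2), the lower bound for
    |1 - Z1 t| is that of [sqmod_one_sub_mul_ge] with J = t K_mu2(Z2)/Z2. *)
Lemma free_mul_pos_atom (mu1 mu2 mu : Mpos R) (a : X) :
  free_mul_pos mu1 mu2 mu -> 0 < (set_val a : R) -> 0 < mass (set_val mu) a ->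
  exists b1 b2 : X, (set_val a : R) = set_val b1 * set_val b2 /\
    mass (set_val mu1) b1 + mass (set_val mu2) b2 = 1 + mass (set_val mu) a.
Proof.
move=> [Z1 [Z2 [[KZ1 _] [KZ2 _] hZ]]] a0 ma; set av : R := set_val a in a0.
pose y n : R := n.+1%:R^-1.
pose s n : R := y n / 2.
pose z n : R[i] := (av^-1 +i* (y n / av))%C.
have y0 n : 0 < y n by rewrite invr_gt0.
have s0 n : 0 < s n by rewrite divr_gt0.
have y1 n : y n <= 1 by rewrite invf_le1 // ler1n.
have Iz n : 0 < Im (z n) by rewrite divr_gt0.
have scv : s n @[n --> \oo] --> 0.
  rewrite -(mul0r 2^-1); apply: cvgM; last exact: cvg_cst.
  exact: cvg_harmonic.
have ker n : 1 - z n * nnreal_val a = (0 +i* - y n)%C.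
  apply: complex_eqP; rewrite ?Re_add ?Im_add ?Re_opp ?Im_opp ?Re_mul ?Im_mul /= -/av.
    by field; rewrite gt_eqF.
  by field; rewrite gt_eqF.
have sJ n (J : R[i]) : 0 <= Im J -> s n ^+ 2 <= sqmod (1 - z n * J).
  move=> J0; apply: le_trans (sqmod_one_sub_mul_ge (Iz n) J0).
  rewrite /sqmod /=.
  have -> : (y n / av) ^+ 2 / (av^-1 ^+ 2 + (y n / av) ^+ 2) = y n ^+ 2 / (1 + y n ^+ 2).
    by field; rewrite !gt_eqF // ?addr_gt0 ?exprn_gt0.
  rewrite /s expr_div_n ler_pM2l ?exprn_gt0 // lef_pV2 ?posrE ?addr_gt0 ?exprn_gt0 //.
  have : y n ^+ 2 <= 1 by rewrite expr_le1 // ltW.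
  lra.
have sk n (x : X) : s n ^+ 2 <= sqmod (1 - z n * nnreal_val x) by exact: sJ.
have hC n : sqmod (1 - z n * nnreal_val a) <= 4 * s n ^+ 2.
  by rewrite ker /sqmod /= expr0n add0r sqrrN /s; lra.
have near_im : \forall n \near \oo, 0 < Im (eta_transform nnreal_val (set_val mu) (z n))
    /\ eta_transform nnreal_val (set_val mu) (z n) != 0.
  have h1 := mcauchy_near_atom ccont_nnreal_val nnreal_val_inj s0 scv sk hC ma.
  have h2 := eta_transform_near_atom ccont_nnreal_val nnreal_val_inj s0 scv sk hC ma.
  near=> n.
  have [k1 _] : 0 < Re ((1 - z n * nnreal_val a) * mcauchy nnreal_val (set_val mu) (z n))
    /\ mcauchy nnreal_val (set_val mu) (z n) != 1 by near: n.
  have [B0 e0] : mcauchy nnreal_val (set_val mu) (z n) != 0 /\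
     eta_transform nnreal_val (set_val mu) (z n) != 0 by near: n.
  split=> //; rewrite (eta_transformE ccont_nnreal_val _ (s0 n) (sk n)).
  rewrite mulrBl divff // mul1r Im_add Im_opp Im_inv /= add0r mulNr opprK.
  rewrite divr_gt0 ?sqmod_gt0 //; move: k1; rewrite ker Re_mul /= mul0r sub0r mulNr opprK.
  by rewrite pmulr_rgt0.
have kernel_bound (nu : prob R X) (Z Z' : R[i]) n : 0 <= Im Z' ->
    Z * Z' = z n * eta_transform nnreal_val (set_val mu) (z n) ->
    eta_transform nnreal_val (set_val mu) (z n) = eta_transform nnreal_val nu Z' ->
    0 < Im (eta_transform nnreal_val (set_val mu) (z n)) ->
    eta_transform nnreal_val (set_val mu) (z n) != 0 ->
    forall x : X, s n ^+ 2 <= sqmod (1 - Z * nnreal_val x).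
  move=> Z'0 e1 e2 Ie e0 x.
  (* At a real Z' the transform of nu would be real, whereas Im K_mu(z_n) > 0. *)
  have {}Z'0 : 0 < Im Z'.
    rewrite lt_def Z'0 andbT; apply: contraTneq Ie => h.
    by rewrite e2 eta_transform_real // ltxx.
  have zn0 : Z' != 0 by apply: contraTneq Z'0 => ->; rewrite ltxx.
  have -> : Z = z n * (eta_transform nnreal_val nu Z' / Z').
    by apply: (mulIf zn0); rewrite e1 e2; field.
  rewrite -mulrA; apply: sJ; rewrite Im_mul /= mulr0 add0r mulr_ge0 ?nnreal_ge0 //.
  exact: Im_eta_div_ge0.
have NI Z n : class_K Z -> 0 <= Im (Z (z n)) by move=> [[_ h] _ _ _]; exact: (h _ (Iz n)).
have [|||||b1 [b2 [ab hm]]] := multiplicative_subordination_atom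
  ccont_nnreal_val nnreal_val_inj s0 scv sk hC ma (mu1 := set_val mu1)
  (mu2 := set_val mu2) (z1 := Z1 \o z) (z2 := Z2 \o z).
- by move=> n /=; have [-> _ _] := hZ _ (Iz n).
- by move=> n /=; have [_ + _] := hZ _ (Iz n); rewrite !K_transformE.
- by move=> n /=; have [_ _] := hZ _ (Iz n); rewrite !K_transformE.
- apply: filterS near_im => n [h1 h2]; have [e1 e2 e3] := hZ _ (Iz n).
  apply: (kernel_bound (set_val mu2) _ (Z2 (z n))) => //.
  + exact: NI.
  + by rewrite e1 -!K_transformE e3.
  + by rewrite -!K_transformE e3 e2.
- apply: filterS near_im => n [h1 h2]; have [e1 e2 e3] := hZ _ (Iz n).
  apply: (kernel_bound (set_val mu1) _ (Z1 (z n))) => //.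
  + exact: NI.
  + by rewrite mulrC e1 -!K_transformE e3.
exists b1, b2; split=> //.
by move: ab => /(congr1 (@complex.Re R)); rewrite Re_mul /= mulr0 subr0.
Unshelve. all: by end_near. Qed.

End PositiveAtoms.

(** * The topology of the complex plane *)

Section ComplexTopology.
Context {R : realType}.

Lemma normc_lt_real (z : R[i]) (e : R) : 0 < e ->
  (`|z| < e%:C%C) = (sqmod z < e ^+ 2).
Proof.
move=> e0; rewrite -(@ltr_pXn2r _ 2) ?nnegrE //; last by rewrite lecR ltW.
by rewrite normc_sqmod -rmorphXn /= ltcR.
Qed.

Lemma normc_le1 (z : R[i]) : (`|z| <= 1) = (sqmod z <= 1).
Proof.
rewrite -(@ler_pXn2r _ 2) ?nnegrE //.
by rewrite normc_sqmod expr1n -[1]/((1 : R)%:C%C) lecR.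
Qed.

Lemma normc_eq1 (z : R[i]) : `|z| = 1 <-> sqmod z = 1.
Proof.
split=> h.
  by have := normc_sqmod z; rewrite h expr1n => -[].
apply/eqP; rewrite -(@eqrXn2 _ 2) // normc_sqmod h expr1n.
by [].
Qed.

Lemma unit_diskP (z : R[i]) : unit_disk z <-> sqmod z < 1.
Proof. by rewrite /unit_disk /= -[1 in X in X <-> _]/((1 : R)%:C%C) normc_lt_real // expr1n. Qed.

Lemma Re_continuous : continuous (fun z : cplx R => Re z).
Proof.
move=> z; apply/(@cvgrPdist_lt _ _ _ _ (nbhs_filter (z : cplx R))) => e e0.
have e0' : (0 : R[i]) < e%:C%C by rewrite ltcR.
have : \forall w \near nbhs (z : cplx R), `|z - w| < e%:C%C.
  exact: (@cvgr_dist_lt _ _ _ _ (nbhs_filter (z : cplx R)) id z (fun A h => h) _ e0').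
apply: (@filterS _ _ (nbhs_filter (z : cplx R))) => w /= h.
have : sqmod (z - w) < e ^+ 2 by rewrite -normc_lt_real.
rewrite /sqmod Re_add Re_opp => h'.
rewrite /= -ltr_sqr ?nnegrE ?(ltW e0) // real_normK ?num_real //.
by apply: le_lt_trans h'; rewrite lerDl sqr_ge0.
Qed.

Lemma Im_continuous : continuous (fun z : cplx R => Im z).
Proof.
move=> z; apply/(@cvgrPdist_lt _ _ _ _ (nbhs_filter (z : cplx R))) => e e0.
have e0' : (0 : R[i]) < e%:C%C by rewrite ltcR.
have : \forall w \near nbhs (z : cplx R), `|z - w| < e%:C%C.
  exact: (@cvgr_dist_lt _ _ _ _ (nbhs_filter (z : cplx R)) id z (fun A h => h) _ e0').
apply: (@filterS _ _ (nbhs_filter (z : cplx R))) => w /= h.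
have : sqmod (z - w) < e ^+ 2 by rewrite -normc_lt_real.
rewrite /sqmod Im_add Im_opp => h'.
rewrite /= -ltr_sqr ?nnegrE ?(ltW e0) // real_normK ?num_real //.
by apply: le_lt_trans h'; rewrite lerDr sqr_ge0.
Qed.

Lemma ofreal_continuous : continuous (fun x : R => x%:C%C : cplx R).
Proof.
move=> x; apply/(@cvgrPdist_lt _ _ _ _ (nbhs_filter x)) => e e0.
have ee : e = (Re e)%:C%C.
  by apply: complex_eqP => //; move: e0; case: e => a b /=; rewrite ltcE /= => /andP[/eqP].
have r0 : 0 < Re e by move: e0; rewrite ee ltcR.
have := @cvgr_dist_lt _ _ _ _ (nbhs_filter x) id x (fun A h => h) _ r0.
apply: filterS => t /= h; rewrite ee -rmorphB /=.
by rewrite normc_lt_real // /sqmod /= expr0n addr0 -real_normK ?num_real // ltr_sqr ?nnegrE // ltW.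
Qed.

End ComplexTopology.

(** * The rule for atoms: circle *)

Section CircleAtoms.
Context {R : realType}.
Notation X := (unit_circle R).
Implicit Types (mu nu : prob R X) (z : R[i]).

Definition circ_val (x : X) : R[i] := set_val x.

Lemma sqmod_circ_val (x : X) : sqmod (circ_val x) = 1.
Proof. by apply/normc_eq1; exact: (set_valP x). Qed.

Lemma circ_val_inj : injective circ_val.
Proof. by move=> x y /val_inj. Qed.

Lemma ccont_circ_val : ccont circ_val.
Proof.
have c : continuous (set_val : X -> cplx R) by exact: initial_continuous.
by split => x; apply: continuous_comp; [exact: c|exact: Re_continuous|exact: c|exact: Im_continuous].
Qed.

Lemma Q_transformE (mu : Mcirc R) z :
  Q_transform mu z = eta_transform circ_val (set_val mu) z.
Proof. by []. Qed.

Lemma sqr_le_sqmod_one_sub z w (s : R) : 0 < s <= 1 -> sqmod z <= (1 - s) ^+ 2 ->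
  sqmod w = 1 -> s ^+ 2 <= sqmod (1 - z * w).
Proof.
move=> /andP[s0 s1] hz hw.
have : `|Re (z * w)| <= 1 - s.
  by apply: normr_Re_le_sqmod; rewrite ?subr_ge0 // sqmodM hw mulr1.
rewrite ler_norml => /andP[_ h].
apply: (@le_trans _ _ (Re (1 - z * w) ^+ 2)); last by rewrite lerDl sqr_ge0.
have h' : s <= Re (1 - z * w) by rewrite Re_add Re_opp /=; lra.
by rewrite ler_sqr ?nnegrE // (le_trans (ltW s0)).
Qed.

Let sz z := 1 - Num.sqrt (sqmod z).

Let sz_gt0 z : sqmod z < 1 -> 0 < sz z.
Proof. by move=> h; rewrite subr_gt0 -[ltRHS]sqrtr1 ltr_sqrt. Qed.

Let sz_le z : sqmod z < 1 -> forall x : X, sz z ^+ 2 <= sqmod (1 - z * circ_val x).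
Proof.
move=> h x; apply: sqr_le_sqmod_one_sub; last exact: sqmod_circ_val.
  by rewrite sz_gt0 // gerBl sqrtr_ge0.
by rewrite /sz subKr sqr_sqrtr ?sqmod_ge0.
Qed.

Lemma circ_kernel_bound z : sqmod z < 1 ->
  exists2 d : R, 0 < d & forall x : X, d ^+ 2 <= sqmod (1 - z * circ_val x).
Proof. by move=> z1; exists (sz z); [exact: sz_gt0|exact: sz_le]. Qed.

(** For f(t) = 1/(1 - z t) with |t| = 1 one has |1 - f|^2 = |z|^2 |f|^2, that is
    (1 - |z|^2) |f|^2 - 2 Re f + 1 = 0; integrate, and bound the integral of
    |f|^2 from below by |B|^2. *)
Lemma mcauchy_circ_bound nu z : sqmod z < 1 ->
  (1 - sqmod z) * sqmod (mcauchy circ_val nu z) - 2 * Re (mcauchy circ_val nu z) + 1 <= 0.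
Proof.
move=> z1; have bf := cbounded_meas_mcauchy ccont_circ_val (sz_gt0 z1) (sz_le z1).
have bs := bounded_meas_sqmod bf; have J := sqmod_cintegral_le nu bf.
have br : bounded_meas (T := borel X) (fun x => Re (1 - z * circ_val x)^-1) by case: bf.
have bc (c : R) := bounded_meas_cst (T := borel X) c.
have E : Rintegral nu setT (fun x : X => (1 - sqmod z) * sqmod (1 - z * circ_val x)^-1
   + ((- 2) * Re (1 - z * circ_val x)^-1 + 1)) = 0.
  rewrite -[RHS](Rintegral_prob_cst nu 0); apply: eq_Rintegral => x _.
  have q0 : 0 < sqmod (1 - z * circ_val x).
    by apply: lt_le_trans (sz_le z1 x); rewrite exprn_gt0 // sz_gt0.
  have qE : sqmod (1 - z * circ_val x) = 1 - 2 * Re (z * circ_val x) + sqmod z.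
    have : sqmod (z * circ_val x) = sqmod z by rewrite sqmodM sqmod_circ_val mulr1.
    by move=> <-; rewrite /sqmod !Re_add !Im_add !Re_opp !Im_opp /=; ring.
  rewrite sqmodV Re_inv Re_add Re_opp /=.
  set q := sqmod (1 - _) in q0 qE *; rewrite (_ : sqmod z = q - 1 + 2 * Re (z * circ_val x)).
    by field; rewrite gt_eqF.
  by rewrite qE; ring.
have {}E : (1 - sqmod z) * Rintegral nu setT (fun x : X => sqmod (1 - z * circ_val x)^-1)
   - 2 * Re (mcauchy circ_val nu z) + 1 = 0.
  have b1 := bounded_measM (bc (1 - sqmod z)) bs.
  have b2 := bounded_measM (bc (- 2)) br.
  have b3 := bounded_measD b2 (bc 1).
  rewrite -[RHS]E [RHS](Rintegral_bdD nu b1 b3) (Rintegral_bdD nu b2 (bc 1)).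
  by rewrite (Rintegral_bdZ nu _ bs) (Rintegral_bdZ nu _ br) Rintegral_prob_cst mulNr addrA.
rewrite -E lerD2r lerD2r ler_wpM2l // subr_ge0; exact: ltW.
Qed.

(** [mcauchy_circ_bound] says that |B - 1| <= |z| |B|, and eta = (B - 1)/B. *)
Lemma sqmod_eta_transform_le nu z : sqmod z < 1 ->
  sqmod (eta_transform circ_val nu z) <= sqmod z.
Proof.
move=> z1; have h := mcauchy_circ_bound nu z1.
rewrite (eta_transformE ccont_circ_val nu (sz_gt0 z1) (sz_le z1)).
set B := mcauchy _ _ _ in h *; have [->|B0] := eqVneq B 0.
  by rewrite invr0 mulr0 /sqmod /= expr0n addr0 addr_ge0 ?sqr_ge0.
rewrite sqmodM sqmodV ler_pdivrMr ?sqmod_gt0 //.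
have -> : sqmod (B - 1) = sqmod B - 2 * Re B + 1.
  by rewrite /sqmod !Re_add !Im_add !Re_opp !Im_opp /=; ring.
by move: h; lra.
Qed.

(** The measure mu is probed along z_n = (1 - 1/(n+1))/a, where the kernel at
    the atom is 1/(n+1).  Since |Q_mu2(Z2)| <= |Z2|, the equation
    Z1 Z2 = z Q_mu2(Z2) gives |Z1| <= |z|, hence |1 - Z1 t| >= 1 - |z|. *)
Lemma free_mul_circ_atom (mu1 mu2 mu : Mcirc R) (a : X) :
  free_mul_circ mu1 mu2 mu -> 0 < mass (set_val mu) a ->
  exists b1 b2 : X, circ_val a = circ_val b1 * circ_val b2 /\
    mass (set_val mu1) b1 + mass (set_val mu2) b2 = 1 + mass (set_val mu) a.
Proof.
move=> [Z1 [Z2 [SZ1 SZ2 hZ]]] ma.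
pose s n : R := n.+1%:R^-1.
have s0 n : 0 < s n by rewrite invr_gt0.
have s1 n : s n <= 1 by rewrite invf_le1 // ler1n.
pose z n : R[i] := (1 - s n)%:C%C * (circ_val a)^-1.
have scv : s n @[n --> \oo] --> 0 by exact: cvg_harmonic.
have a0 : circ_val a != 0 by rewrite -sqmod_gt0 sqmod_circ_val.
have qz n : sqmod (z n) = (1 - s n) ^+ 2.
  by rewrite sqmodM sqmodV sqmod_circ_val invr1 mulr1 /sqmod /= expr0n addr0.
have qz1 n : sqmod (z n) < 1.
  by rewrite qz expr_lt1 ?subr_ge0 // gtrBl.
have Iz n : unit_disk (z n) by apply/unit_diskP.
have ker n : 1 - z n * circ_val a = (s n)%:C%C.
  by rewrite /z mulfVK // rmorphB /= subKr.
have sZ n (Z : R[i]) : sqmod Z <= sqmod (z n) ->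
    forall x : X, s n ^+ 2 <= sqmod (1 - Z * circ_val x).
  move=> hZz x; apply: sqr_le_sqmod_one_sub; last exact: sqmod_circ_val.
    by rewrite s0 s1.
  by rewrite -qz.
have sk n (x : X) : s n ^+ 2 <= sqmod (1 - z n * circ_val x) by exact: sZ.
have hC n : sqmod (1 - z n * circ_val a) <= 1 * s n ^+ 2.
  by rewrite ker /sqmod /= expr0n addr0 mul1r.
have near_eta := eta_transform_near_atom ccont_circ_val circ_val_inj s0 scv sk hC ma.
have kernel_bound (nu : prob R X) (Z Z' : R[i]) n : sqmod Z' <= 1 ->
    Z * Z' = z n * eta_transform circ_val (set_val mu) (z n) ->
    eta_transform circ_val (set_val mu) (z n) = eta_transform circ_val nu Z' ->
    eta_transform circ_val (set_val mu) (z n) != 0 ->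
    forall x : X, s n ^+ 2 <= sqmod (1 - Z * circ_val x).
  move=> Z'1 e1 e2 e0; apply: sZ.
  have zn0 : Z' != 0.
    apply: contraTneq e0 => h; have : z n * eta_transform circ_val (set_val mu) (z n) = 0.
      by rewrite -e1 h mulr0.
    move/eqP; rewrite mulf_eq0 => /orP[|/eqP ->]; last by rewrite eqxx.
    move=> /eqP zn0; have := sqmod_eta_transform_le (set_val mu) (qz1 n).
    rewrite zn0 [X in _ <= X](_ : _ = 0); last by rewrite /sqmod /= expr0n addr0.
    by rewrite le_eqVlt ltNge sqmod_ge0 orbF sqmod_eq0 negbK.
  (* On the circle |Z'| = 1 the integral formula is not available, but there
     |Q_mu(z_n)| <= |z_n| < 1 is enough. *)
  have : sqmod (eta_transform circ_val (set_val mu) (z n)) <= sqmod Z'.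
    move: Z'1; rewrite le_eqVlt => /orP[/eqP ->|h].
      exact: le_trans (sqmod_eta_transform_le _ (qz1 n)) (ltW (qz1 n)).
    by rewrite e2; exact: sqmod_eta_transform_le.
  have q0 : 0 < sqmod Z' by rewrite sqmod_gt0.
  move=> h; rewrite -(ler_pM2r q0) -sqmodM e1 sqmodM.
  by rewrite ler_wpM2l ?sqmod_ge0.
have NI Z n : class_S Z -> sqmod (Z (z n)) <= 1.
  by move=> [_ h _ _]; rewrite -normc_le1; exact: (h _ (Iz n)).
have [|||||b1 [b2 [ab hm]]] := multiplicative_subordination_atom
  ccont_circ_val circ_val_inj s0 scv sk hC ma (mu1 := set_val mu1)
  (mu2 := set_val mu2) (z1 := Z1 \o z) (z2 := Z2 \o z).
- by move=> n /=; have [-> _ _] := hZ _ (Iz n).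
- by move=> n /=; have [_ + _] := hZ _ (Iz n); rewrite !Q_transformE.
- by move=> n /=; have [_ _] := hZ _ (Iz n); rewrite !Q_transformE.
- apply: filterS near_eta => n [_ h2]; have [e1 e2 e3] := hZ _ (Iz n).
  apply: (kernel_bound (set_val mu2) _ (Z2 (z n))) => //.
  + exact: NI.
  + by rewrite e1 -!Q_transformE e3.
  + by rewrite -!Q_transformE e3 e2.
- apply: filterS near_eta => n [_ h2]; have [e1 e2 e3] := hZ _ (Iz n).
  apply: (kernel_bound (set_val mu1) _ (Z1 (z n))) => //.
  + exact: NI.
  + by rewrite mulrC e1 -!Q_transformE e3.
by exists b1, b2.
Qed.

End CircleAtoms.

(** * Rank-one perturbations of diagonal matrices *)

Lemma conj_sqmod {R : realType} (z : R[i]) : Num.conj z * z = (sqmod z)%:C%C.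
Proof. by rewrite mulrC -normCK normc_sqmod. Qed.

Section RankOnePerturbation.
Context {R : realType}.
Local Notation C := R[i].
Local Open Scope sesquilinear_scope.

(** The function G is <e, (z - D)^-1 e> with D the diagonal matrix of the x_j
    and e the vector of the square roots of the m_j.  For B = D - c e e^T,
    (z - B) v = (1 + c G) e where v = (z - D)^-1 e.  In an orthonormal
    eigenbasis of B, with eigenvalues l_i and coordinates q_i of e, the
    coordinates of v are (1 + c G) q_i / (z - l_i), and the claim follows by
    taking the inner product with e, for p_i = |q_i|^2. *)
Lemma rank_one_perturbation (n : nat) (x m : 'I_n -> R) (c : R) :
  (forall j, 0 <= m j) -> \sum_j m j = 1 ->
  exists l p : 'I_n -> R, [/\ forall j, 0 <= p j, \sum_j p j = 1 &
    forall z : R[i], 0 < Im z ->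
      let G := \sum_j (m j)%:C%C / (z - (x j)%:C%C) in
      G = (1 + c%:C%C * G) * \sum_j (p j)%:C%C / (z - (l j)%:C%C)].
Proof.
move=> m0 m1.
pose e : 'cV[C]_n := \col_j (Num.sqrt (m j))%:C%C.
pose B : 'M[C]_n := diag_mx (\row_j (x j)%:C%C) - c%:C%C *: (e *m e^T).
have eT : e^t* = e^T.
  by apply/matrixP => i j; rewrite !mxE; apply/CrealP; rewrite complex_real.
have Bherm : B \is hermsymmx.
  apply: realsym_hermsym.
    apply/is_hermitianmxP; rewrite expr0 scale1r map_mx_id //.
    apply/matrixP => i j; rewrite !mxE eq_sym; congr (_ - _ * _).
      by case: eqP => // ->.
    by apply: eq_bigr => k _; rewrite !mxE mulrC.
  apply/mxOverP => i j; rewrite !mxE rpredB //.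
    by rewrite rpredMn // complex_real.
  rewrite rpredM ?complex_real // rpred_sum // => k _.
  by rewrite !mxE rpredM // complex_real.
pose P := spectralmx B; pose D := spectral_diag B.
have PU : P \is unitarymx := spectral_unitarymx B.
have PP : P^t* *m P = 1%:M by apply: mulmx1C; exact/unitarymxP.
have PB : P *m B = diag_mx D *m P.
  have /orthomx_spectralP E := hermitian_normalmx Bherm.
  by rewrite {1}E !mulmxA mulmxV ?spectral_unit // mul1mx.
pose q := P *m e.
exists (fun j => Re (D 0 j)), (fun j => sqmod (q j 0)); split.
- by move=> j; exact: sqmod_ge0.
- have qq : (q^t* *m q) 0 0 = (e^T *m e) 0 0.
    by rewrite /q trmx_mul map_mxM /= !mulmxA -[_ *m P]mulmxA PP mulmx1 eT.
  have {qq} : \sum_j (sqmod (q j 0))%:C%C = \sum_j (m j)%:C%C :> C.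
    transitivity ((q^t* *m q) 0 0).
      by rewrite mxE; apply: eq_bigr => j _; rewrite !mxE conj_sqmod.
    rewrite qq mxE; apply: eq_bigr => j _.
    by rewrite !mxE -rmorphM /= -expr2 sqr_sqrtr.
  by rewrite -!rmorph_sum m1 => -[].
move=> z z0 G.
have znx t : z - t%:C%C != 0.
  by rewrite -sqmod_gt0; apply: lt_le_trans (sqmod_shift_ge z t); rewrite exprn_gt0.
pose v : 'cV[C]_n := \col_j ((Num.sqrt (m j))%:C%C / (z - (x j)%:C%C)).
have ev : (e^T *m v) = G%:M.
  apply/matrixP => i j; rewrite !ord1 !mxE eqxx mulr1n; apply: eq_bigr => k _.
  by rewrite !mxE mulrA -rmorphM /= -expr2 sqr_sqrtr.
have Bv : B *m v = z *: v - (1 + c%:C%C * G) *: e.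
  rewrite mulmxBl -scalemxAl -mulmxA ev mul_mx_scalar scalerA scalerDl scale1r opprD addrA.
  congr (_ - _); apply/matrixP => i j; rewrite mul_diag_mx !mxE.
  move: (Num.sqrt _)%:C%C => t; have := znx (x i).
  move: (x i)%:C%C => y zy; rewrite -[X in _ = _ - X](mulVKf zy).
  by field.
have y_eq i : (P *m v) i 0 = (1 + c%:C%C * G) * (q i 0 / (z - (Re (D 0 i))%:C%C)).
  have DE : D 0 i = (Re (D 0 i))%:C%C.
    have /mxOverP/(_ 0 i) := hermitian_spectral_diag_real Bherm.
    by rewrite -/D; case/complex_realP => k ->.
  have := congr1 (fun M : 'cV[C]_n => (P *m M) i 0) Bv.
  rewrite mulmxA PB -mulmxA mul_diag_mx mulmxBr -!scalemxAr -/q.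
  rewrite !mxE -[\sum_j P i j * v j 0]/(_) => E.
  move: (znx (Re (D 0 i))); rewrite -DE => d0.
  apply: (mulIf d0); rewrite -mulrA mulfVK //.
  by move: E; rewrite DE; move: (\sum_j _) => y E; rewrite mulrBr [y * z]mulrC [y * _]mulrC E; ring.
have GE : G = (q^t* *m (P *m v)) 0 0.
  by rewrite /q trmx_mul map_mxM /= mulmxA -[_ *m P]mulmxA PP mulmx1 eT ev mxE eqxx mulr1n.
rewrite [LHS]GE mxE mulr_sumr; apply: eq_bigr => i _; rewrite y_eq.
have -> : (q^t*) 0 i = Num.conj (q i 0) by rewrite !mxE.
by rewrite mulrCA [_ * (q i 0 / _)]mulrA conj_sqmod.
Qed.

End RankOnePerturbation.

(** * Factors of finitely supported measures *)

Section FiniteSupportFactors.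
Context {R : realType} {X : ptopologicalType}.
Hypothesis measurable_point : forall b, measurable ([set b] : set (borel X)).
Implicit Types (mu nu : prob R X) (s : seq X).

Lemma cfinite_prob (I : finType) (w : I -> R) (a : I -> X) :
  (forall k, 0 <= w k) -> \sum_k w k = 1 ->
  exists nu : prob R X, forall f, cbounded_meas f ->
    cintegral nu f = \sum_k (w k)%:C%C * f (a k).
Proof.
move=> w0 w1; have [nu hnu] := finite_prob a w0 w1; exists nu => f [rf jf].
rewrite /cintegral !hnu //.
apply: complex_eqP => /=.
  rewrite (big_morph _ (@Re_add R) (erefl : Re 0 = 0)).
  by apply: eq_bigr => i _; rewrite Re_mul /= mul0r subr0.
rewrite (big_morph _ (@Im_add R) (erefl : Im 0 = 0)).
by apply: eq_bigr => i _; rewrite Im_mul /= mul0r addr0.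
Qed.

Lemma dirac_prob (a : X) : exists nu : prob R X,
  is_dirac_at a nu /\ forall f, cbounded_meas f -> cintegral nu f = f a.
Proof.
have [//||nu hnu] := @finite_prob R X 'I_1 (fun=> 1) (fun=> a).
  by rewrite big_ord1.
exists nu; split.
  apply: mass1_is_dirac_at => //.
  have := hnu _ (bounded_meas_point measurable_point a).
  by rewrite Rintegral_point // big_ord1 eqxx mulr1.
by move=> f [rf jf]; rewrite /cintegral !hnu // !big_ord1 !mul1r; case: (f a).
Qed.

(** [rel a b1 b2] stands for a = b1 o b2.  If mu2{b} = 1, every atom of mu
    comes from a pair with second component b, since the other points have
    mu2-mass 0 and cannot compensate mu1{b1} <= 1; then mu1{A a} = mu{a}. *)
Lemma atoms_of_factor mu mu1 mu2 s (rel : X -> X -> X -> Prop) :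
  (forall a a' b1 b2, rel a b1 b2 -> rel a' b1 b2 -> a = a') ->
  uniq s -> (forall a, a \in s -> 0 < mass mu a) -> \sum_(a <- s) mass mu a = 1 ->
  (forall a, a \in s -> exists b1 b2,
     rel a b1 b2 /\ mass mu1 b1 + mass mu2 b2 = 1 + mass mu a) ->
  (exists2 a, a \in s & exists b1 b2, rel a b1 b2 /\ mass mu1 b1 = 1) \/
  (exists b (A : X -> X), [/\ mass mu2 b = 1, {in s &, injective A} &
     forall a, a \in s -> rel a (A a) b /\ mass mu1 (A a) = mass mu a]).
Proof.
move=> rfun us s0 s1 hrel.
have /choice [AB hAB] : forall a, exists p : X * X, a \in s ->
    rel a p.1 p.2 /\ mass mu1 p.1 + mass mu2 p.2 = 1 + mass mu a.
  move=> a; have [/hrel [b1 [b2 h]]|_] := boolP (a \in s).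
    by exists (b1, b2).
  by exists (a, a).
pose A a := (AB a).1; pose B a := (AB a).2.
have [||a0 a0s] := @dirac_factor_of_atoms R X (mass mu) (mass mu1) (mass mu2) s A B
  us s0 s1 (sum_mass_le1 measurable_point mu1) (sum_mass_le1 measurable_point mu2).
- by move=> a /hAB [].
- move=> a b /hAB [ra _] /hAB [rb _] eA eB; apply: rfun ra _.
  by move: rb; rewrite -/(A b) -/(B b) -eA -eB.
move=> [m1|m2]; [left|right].
  by exists a0 => //; exists (A a0), (B a0); split => //; have [] := hAB _ a0s.
have Bb a : a \in s -> B a = B a0.
  move=> sa; apply/eqP; apply: contraT => ne.
  have := sum_mass_le1 measurable_point mu2 (s := [:: B a; B a0]).
  rewrite /= inE ne => /(_ isT); rewrite big_cons big_seq1 m2.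
  have := (hAB _ sa).2; rewrite -/(A a) -/(B a) => e.
  have := mass_le1 measurable_point mu1 (A a); have := s0 _ sa; lra.
exists (B a0), A; split => //.
  move=> a b sa sb eA; have [ra _] := hAB _ sa; have [rb _] := hAB _ sb.
  apply: rfun ra _; move: rb; rewrite -/(A a) -/(A b) -/(B a) -/(B b) -eA.
  by rewrite (Bb _ sa) (Bb _ sb).
move=> a sa; have [ra e] := hAB _ sa; move: ra e; rewrite -/(A a) -/(B a) (Bb _ sa) m2.
by move=> ra e; split=> //; lra.
Qed.

(** The masses mu1{A a} add up to 1, so mu1 has no mass elsewhere. *)
Lemma cintegral_transported mu mu1 s (A : X -> X) (f : X -> R[i]) : uniq s ->
  \sum_(a <- s) mass mu a = 1 -> {in s &, injective A} ->
  (forall a, a \in s -> mass mu1 (A a) = mass mu a) -> cbounded_meas f ->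
  cintegral mu1 f = \sum_(a <- s) (mass mu a)%:C%C * f (A a).
Proof.
move=> us s1 iA hA bf.
have uA : uniq (map A s) by rewrite map_inj_in_uniq.
rewrite (cintegral_finite_support measurable_point uA) //.
  by rewrite big_map !big_seq; apply: eq_bigr => a /hA ->.
by rewrite big_map -s1 !big_seq; apply: eq_bigr => a /hA.
Qed.

End FiniteSupportFactors.

(** * Indecomposability: additive case *)

Section AdditiveIndecomposable.
Context {R : realType}.
Let mp := @measurable_point_real R.

(** With G = 1/F, [rank_one_perturbation] gives G = (1 + c G) G' with G' the
    Cauchy transform of a probability measure, and 1/G' = 1/G + c. *)
Lemma F_transform_add_const (mu : Madd R) (s : seq R) (c : R) : uniq s ->
  \sum_(x <- s) mass mu x = 1 -> class_F (fun z => F_transform mu z + c%:C%C).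
Proof.
move=> us s1; pose n := size s; pose x (j : 'I_n) := tnth (in_tuple s) j.
have [||l [p [p0 p1 hp]]] := @rank_one_perturbation R n x (fun j => mass mu (x j)) c.
- by move=> j; exact: mass_ge0.
- by rewrite -s1 [RHS]big_tnth.
have [nu hnu] := cfinite_prob l p0 p1.
exists nu => z z0; have bf := cbounded_meas_cauchy z0.
have nuE : cauchy_transform nu z = \sum_i (p i)%:C%C / (z - (l i)%:C%C) by exact: hnu.
have muE : cauchy_transform mu z = \sum_i (mass mu (x i))%:C%C / (z - (x i)%:C%C).
  rewrite /cauchy_transform (cintegral_finite_support mp us s1 bf).
  by rewrite big_tnth.
have := hp z z0; rewrite /= -nuE -muE.
have : F_transform mu z != 0.
  have := Im_F_transform_ge mu z0; apply: contraTneq => ->; rewrite -ltNge; exact: z0.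
rewrite !F_transformE invr_eq0.
move: (cauchy_transform mu z) (cauchy_transform nu z) => G G' G0 E.
have k0 : 1 + c%:C%C * G != 0 by apply: contraNneq G0 => e; rewrite E e mul0r.
have -> : G' = G / (1 + c%:C%C * G) by apply: (mulfI k0); rewrite -E mulrC divfK.
by field; rewrite k0 G0.
Qed.

(** If mu2 is the Dirac measure at b, then F_mu1(z) = F_mu(z + b), and mu1 is
    the convolution of mu with the Dirac measure at - b for the subordination
    functions z + b and F_mu1 - b. *)
Lemma indecomposable_free_add (mu : Madd R) (s : seq R) : uniq s ->
  (forall a, a \in s -> 0 < mass mu a) -> \sum_(a <- s) mass mu a = 1 ->
  ~ dirac_add mu -> indecomposable (@free_add R) (@dirac_add R) mu.
Proof.
move=> us s0 s1 nd; split=> // mu1 [mu2 conv].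
have rfun (a a' b1 b2 : R) : a = b1 + b2 -> a' = b1 + b2 -> a = a' by move=> -> ->.
have [[_ _ [b1 [b2 [_ m1]]]]|[b [A [m2 iA hA]]]] :=
  atoms_of_factor mp rfun us s0 s1 (fun a sa => free_add_atom conv (s0 a sa)).
  by left; exists b1; exact: (mass1_is_dirac_at mp m1).
right; have [delta [ddelta idelta]] := @dirac_prob R R mp (- b).
exists delta; first by exists (- b).
have I1 z : 0 < Im z -> F_transform mu1 z = F_transform mu (z + b%:C%C).
  move=> z0; rewrite !F_transformE; congr (_^-1); rewrite /cauchy_transform.
  have z0' : 0 < Im (z + b%:C%C) by rewrite Im_add /= addr0.
  rewrite (cintegral_finite_support mp us s1 (cbounded_meas_cauchy z0')).
  rewrite (cintegral_transported mp us s1 iA _ (cbounded_meas_cauchy z0)); last first.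
    by move=> a /hA [].
  rewrite !big_seq; apply: eq_bigr => a /hA [e _].
  have ea : a%:C%C = (A a)%:C%C + b%:C%C :> R[i] by rewrite -rmorphD /= -e.
  by congr (_ * _^-1); rewrite ea; ring.
have Fd z : 0 < Im z -> F_transform delta z = z + b%:C%C.
  move=> z0; rewrite F_transformE /cauchy_transform idelta; last exact: cbounded_meas_cauchy.
  by rewrite invrK rmorphN opprK.
exists (fun z => z + b%:C%C), (fun z => F_transform mu1 z - b%:C%C); split.
- by exists delta => z z0; rewrite Fd.
- have um : uniq (map A s) by rewrite map_inj_in_uniq.
  have := @F_transform_add_const mu1 (map A s) (- b) um.
  rewrite big_map -s1 rmorphN; apply.
  by rewrite !big_seq; apply: eq_bigr => a /hA [].
- move=> z z0; have z1 : 0 < Im (F_transform mu1 z).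
    exact: lt_le_trans (Im_F_transform_ge mu1 z0).
  rewrite -I1 //; split=> //; first by ring.
  by rewrite Fd ?subrK // Im_add Im_opp /= oppr0 addr0.
Qed.

End AdditiveIndecomposable.

(** * Rational multiplicative transforms *)

Section RationalEta.
Context {R : realType} {X : choiceType}.
Variables (s : seq X) (w : X -> R) (x : X -> R[i]).

Definition rational_A (z : cplx R) : cplx R := \sum_(a <- s) (w a)%:C%C * x a / (1 - z * x a).
Definition rational_B (z : cplx R) : cplx R := \sum_(a <- s) (w a)%:C%C / (1 - z * x a).
(** The eta transform of the measure with masses w a at the points x a; the
    factor z replaces [rational_B] - 1 = z * [rational_A], which makes the
    value and the derivative at 0 apparent. *)
Definition rational_eta (z : cplx R) : cplx R := z * (rational_A z / rational_B z).

Lemma rational_B_sub1 z : \sum_(a <- s) w a = 1 ->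
  (forall a, a \in s -> 1 - z * x a != 0) -> rational_B z - 1 = z * rational_A z.
Proof.
move=> w1 nz; rewrite -[1 in LHS]/((1 : R)%:C%C) -w1 rmorph_sum /= -sumrB mulr_sumr.
rewrite !big_seq; apply: eq_bigr => a /nz; move: (w a)%:C%C => c h.
by field.
Qed.

Lemma derivable_linear_fraction (c y z : cplx R) : 1 - z * y != 0 ->
  derivable (fun z : cplx R => c / (1 - z * y)) z 1.
Proof.
move=> h; apply: (@derivableM _ _ (fun _ : cplx R => c) (fun z : cplx R => (1 - z * y)^-1)).
  exact: derivable_cst.
apply: (@derivableV _ _ (fun z : cplx R => 1 - z * y)).
  exact: h.
by [].
Qed.

Lemma derivable_sum_fraction (r : seq X) (c : X -> R[i]) (z : cplx R) :
  (forall a, a \in r -> 1 - z * x a != 0) ->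
  derivable (fun z : cplx R => \sum_(a <- r) c a / (1 - z * x a) : cplx R) z 1.
Proof.
elim: r => [|a r IH] h.
  rewrite (_ : (fun z => _) = fun=> 0); first exact: derivable_cst.
  by apply/funext => y; rewrite big_nil.
rewrite (_ : (fun z => _) = (fun z : cplx R => c a / (1 - z * x a) : cplx R) +
    (fun z : cplx R => \sum_(a <- r) c a / (1 - z * x a) : cplx R)); last first.
  by apply/funext => y; rewrite big_cons.
apply: derivableD.
  by apply: derivable_linear_fraction; apply: h; rewrite mem_head.
by apply: IH => b br; apply: h; rewrite inE br orbT.
Qed.

Lemma derivable_rational_quotient (z : cplx R) :
  (forall a, a \in s -> 1 - z * x a != 0) -> rational_B z != 0 ->
  derivable (fun z => rational_A z / rational_B z) z 1.
Proof.
move=> h B0; apply: (@derivableM _ _ rational_A (fun z => (rational_B z)^-1)).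
  exact: derivable_sum_fraction.
by apply: derivableV => //; exact: derivable_sum_fraction.
Qed.

Lemma derivable_rational_eta (z : cplx R) :
  (forall a, a \in s -> 1 - z * x a != 0) -> rational_B z != 0 ->
  derivable rational_eta z 1.
Proof.
move=> h B0; apply: (@derivableM _ _ id (fun z => rational_A z / rational_B z)).
  exact: derivable_id.
exact: derivable_rational_quotient.
Qed.

Lemma derive_rational_eta0 : rational_B 0 != 0 ->
  'D_1 rational_eta 0 = rational_A 0 / rational_B 0.
Proof.
move=> B0; rewrite /rational_eta.
rewrite (@deriveM _ _ id (fun z => rational_A z / rational_B z)); last first.
- by apply: derivable_rational_quotient => // a _; rewrite mul0r subr0 oner_eq0.
- exact: derivable_id.
by rewrite derive_id scale0r add0r /GRing.scale /= mulr1.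
Qed.

Lemma rational_eta_cvg0 : rational_B 0 != 0 -> {for 0, continuous rational_eta}.
Proof.
move=> B0; apply: differentiable_continuous; apply/derivable1_diffP.
by apply: derivable_rational_eta => // a _; rewrite mul0r subr0 oner_eq0.
Qed.

End RationalEta.

(** The measure mu is finitely supported on s, and mu1 carries the mass of each
    atom a = (A a) b of mu at the point A a: the transforms of both measures
    are given by one rational function, up to the dilation by b. *)
Section TransportedEta.
Context {R : realType} {X : ptopologicalType} (i : X -> R[i]).
Hypotheses (ci : ccont i) (inji : injective i).
Variables (mu mu1 : prob R X) (s : seq X) (A : X -> X) (b : X).
Hypotheses (us : uniq s) (s1 : \sum_(a <- s) mass mu a = 1).
Hypothesis iA : {in s &, injective A}.
Hypothesis hA : forall a, a \in s -> i a = i (A a) * i b /\ mass mu1 (A a) = mass mu a.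
Hypothesis b0 : i b != 0.

Let mp := measurable_point_ccont ci inji.
Let x a := i (A a).

Lemma mcauchy_transported z (d : R) : 0 < d ->
  (forall t, d ^+ 2 <= sqmod (1 - z * i t)) ->
  mcauchy i mu1 z = rational_B s (mass mu) x z.
Proof.
move=> d0 hd; have bf := cbounded_meas_mcauchy ci d0 hd.
by rewrite [LHS](cintegral_transported mp us s1 iA _ bf) // => a /hA [].
Qed.

Lemma eta_transform_transported z (d : R) : 0 < d ->
  (forall t, d ^+ 2 <= sqmod (1 - z * i t)) ->
  eta_transform i mu1 z = rational_eta s (mass mu) x z.
Proof.
move=> d0 hd; rewrite (eta_transformE ci mu1 d0 hd) (mcauchy_transported d0 hd).
rewrite rational_B_sub1 // -?mulrA // => a _.
by rewrite -sqmod_gt0; apply: lt_le_trans (hd (A a)); rewrite exprn_gt0.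
Qed.

Lemma eta_transform_untransported z (d : R) : 0 < d ->
  (forall t, d ^+ 2 <= sqmod (1 - z / i b * i t)) ->
  eta_transform i mu (z / i b) = rational_eta s (mass mu) x z.
Proof.
move=> d0 hd; rewrite (eta_transformE ci mu d0 hd).
have k0 a : 1 - z / i b * i a != 0.
  by rewrite -sqmod_gt0; apply: lt_le_trans (hd a); rewrite exprn_gt0.
have e a : a \in s -> 1 - z / i b * i a = 1 - z * x a.
  by move=> /hA [-> _]; rewrite /x; field.
have -> : mcauchy i mu (z / i b) = rational_B s (mass mu) x z.
  have bf := cbounded_meas_mcauchy ci d0 hd.
  rewrite [LHS](cintegral_finite_support mp us s1 bf) /rational_B !big_seq.
  by apply: eq_bigr => a sa; rewrite e.
by rewrite rational_B_sub1 // -?mulrA // => a sa; rewrite -e.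
Qed.

Lemma eta_transform_dirac (delta : prob R X) (c : X) z (d : R) : 0 < d ->
  (forall t, d ^+ 2 <= sqmod (1 - z * i t)) ->
  (forall f, cbounded_meas f -> cintegral delta f = f c) ->
  eta_transform i delta z = z * i c.
Proof.
move=> d0 hd hdelta; rewrite (eta_transformE ci delta d0 hd).
have k0 : 1 - z * i c != 0.
  by rewrite -sqmod_gt0; apply: lt_le_trans (hd c); rewrite exprn_gt0.
rewrite [mcauchy _ _ _]hdelta; last exact: cbounded_meas_mcauchy hd.
by field.
Qed.

End TransportedEta.

(** * Indecomposability: half-line *)

Section PositiveIndecomposable.
Context {R : realType}.
Local Notation X := (nonneg_reals R).

Let mp := measurable_point_ccont ccont_nnreal_val (@nnreal_val_inj R).

Definition nnreal (t : R) (t0 : 0 <= t) : X := SigSub (mem_set (t0 : [set x : R | 0 <= x] t)).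

Section PositiveRationalEta.
Variables (T : choiceType) (s : seq T) (w x : T -> R).
Hypotheses (w0 : forall a, a \in s -> 0 < w a) (w1 : \sum_(a <- s) w a = 1).
Hypothesis x0 : forall a, a \in s -> 0 < x a.
Let xc a : R[i] := (x a)%:C%C.
Local Notation B := (rational_B s w xc).
Local Notation eta := (rational_eta s w xc).

Let s_nonempty : exists a, a \in s.
Proof.
case: s w1 => [|a r _]; last by exists a; rewrite mem_head.
by rewrite big_nil => /esym/eqP; rewrite oner_eq0.
Qed.

Let sum_gt0 (F : T -> R) : (forall a, a \in s -> 0 < F a) -> 0 < \sum_(a <- s) F a.
Proof.
move=> F0; have [a sa] := s_nonempty; rewrite big_seq.
rewrite lt_def sumr_ge0 ?andbT; last by move=> b /F0/ltW.
rewrite psumr_neq0; last by move=> b /F0/ltW.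
by apply/hasP; exists a => //; rewrite sa F0.
Qed.

Let Re_B z : Re (B z) = \sum_(a <- s) w a * (1 - x a * Re z) / sqmod (1 - z * xc a).
Proof.
rewrite (big_morph _ (@Re_add R) (erefl : Re 0 = 0)); apply: eq_bigr => a _.
rewrite Re_mul Re_inv Im_inv Re_add Re_opp Re_mul /=; ring.
Qed.

Let Im_B z : Im (B z) = \sum_(a <- s) w a * (x a * Im z) / sqmod (1 - z * xc a).
Proof.
rewrite (big_morph _ (@Im_add R) (erefl : Im 0 = 0)); apply: eq_bigr => a _.
rewrite Im_mul Re_inv Im_inv Im_add Im_opp Im_mul /=; ring.
Qed.

(** On the two half-planes Im z > 0 and Re z <= 0, which together are a
    neighbourhood of every point where [class_K] requires analyticity, the
    denominators of [rational_eta] do not vanish. *)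
Lemma positive_denominator_neq0 z : 0 < Im z \/ Re z <= 0 ->
  forall a, a \in s -> 1 - z * xc a != 0.
Proof.
move=> hz a /x0 xa; apply/eqP => e; case: hz => h.
  move/(congr1 (@complex.Im R)): e; rewrite Im_add Im_opp Im_mul /=; nra.
move/(congr1 (@complex.Re R)): e; rewrite Re_add Re_opp Re_mul /=; nra.
Qed.

Lemma Im_rational_B_gt0 z : 0 < Im z -> 0 < Im (B z).
Proof.
move=> z0; rewrite Im_B; apply: sum_gt0 => a sa.
rewrite divr_gt0 ?mulr_gt0 ?w0 ?x0 // sqmod_gt0.
by apply: positive_denominator_neq0 => //; left.
Qed.

Lemma rational_B_neq0 z : 0 < Im z \/ Re z <= 0 -> B z != 0.
Proof.
move=> [z0|z0].
  by have := Im_rational_B_gt0 z0; apply: contraTneq => ->; rewrite ltxx.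
have : 0 < Re (B z).
  rewrite Re_B; apply: sum_gt0 => a sa.
  rewrite divr_gt0 ?mulr_gt0 ?w0 //.
    by have := x0 sa; nra.
  by rewrite sqmod_gt0; apply: positive_denominator_neq0 => //; right.
by apply: contraTneq => ->; rewrite ltxx.
Qed.

Lemma Im_rational_eta_gt0 z : 0 < Im z -> 0 < Im (eta z).
Proof.
move=> z0; have hz : 0 < Im z \/ Re z <= 0 by left.
have B0 := rational_B_neq0 hz.
have -> : eta z = 1 - (B z)^-1.
  rewrite /rational_eta mulrA -rational_B_sub1 //; last exact: positive_denominator_neq0.
  by rewrite mulrBl divff // mul1r.
rewrite Im_add Im_opp Im_inv /= add0r mulNr opprK.
by rewrite divr_gt0 ?sqmod_gt0 // Im_rational_B_gt0.
Qed.

Lemma rational_eta_le0 z : z < 0 -> eta z <= 0.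
Proof.
move=> z0; have xa a : a \in s -> 0 <= xc a by move=> sa; rewrite lecR ltW // x0.
have wa a : a \in s -> 0 <= (w a)%:C%C :> R[i] by move=> sa; rewrite lecR ltW // w0.
have d0 a : a \in s -> 0 <= 1 - z * xc a.
  move=> sa; rewrite subr_ge0 (le_trans _ ler01) //.
  by rewrite mulr_le0_ge0 ?xa // ltW.
rewrite mulr_le0_ge0 ?(ltW z0) // divr_ge0 //.
  by rewrite /rational_A big_seq sumr_ge0 // => a sa; rewrite divr_ge0 ?mulr_ge0 ?d0 ?wa ?xa.
by rewrite /rational_B big_seq sumr_ge0 // => a sa; rewrite divr_ge0 ?d0 ?wa.
Qed.

Lemma derivable_rational_eta_near (z : cplx R) : 0 < Im z \/ z < 0 ->
  \forall u \near z, derivable eta u 1.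
Proof.
move=> hz.
have good (u : cplx R) : 0 < Im u \/ Re u <= 0 -> derivable eta u 1.
  move=> hu; apply: derivable_rational_eta; first exact: positive_denominator_neq0.
  exact: rational_B_neq0.
case: hz => h.
  have : \forall u \near nbhs (z : cplx R), 0 < Im u.
    exact: (cvgr_gt (FF := nbhs_filter (z : cplx R)) _ (@Im_continuous R z) _ h).
  by apply: filterS => u hu; apply: good; left.
have h' : Re z < 0 by move: h; case: (z) => p q /=; rewrite ltcE /= => /andP[].
have : \forall u \near nbhs (z : cplx R), Re u < 0.
  exact: (cvgr_lt (FF := nbhs_filter (z : cplx R)) _ (@Re_continuous R z) _ h').
by apply: filterS => u hu; apply: good; right; exact: ltW.
Qed.

End PositiveRationalEta.

Lemma ofreal_opp_cvg0 : - x%:C%C @[x --> (0 : R)^'+] --> (0 : cplx R).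
Proof.
have h : (x%:C%C : cplx R) @[x --> (0 : R)^'+] --> (0%:C%C : cplx R).
  exact: (cvg_at_right_filter (@ofreal_continuous R 0)).
have e : - (0%:C%C : cplx R) = 0 by apply: complex_eqP; rewrite /= oppr0.
have FF : Filter ((0 : R)^'+) by exact: _.
by have := cvgN (FF := FF) h; rewrite e.
Qed.

Lemma class_K_scale (c : R) : 0 < c ->
  class_K (fun z : cplx R => z * c%:C%C) /\ not_identically_zero (fun z : cplx R => z * c%:C%C).
Proof.
move=> c0; have c0' : 0 < c%:C%C :> R[i] by rewrite ltcR.
have der (z : cplx R) : derivable (fun z : cplx R => z * c%:C%C : cplx R) z 1.
  apply: (@derivableM _ _ id (fun _ : cplx R => c%:C%C : cplx R)).
    exact: derivable_id.
  exact: derivable_cst.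
split; last first.
  exists (0 +i* 1)%C; first by rewrite /upper_half_plane /= ltr01.
  apply: mulf_neq0; last by rewrite gt_eqF.
  by rewrite eq_complex /= oner_eq0 andbF.
split.
- split; first by move=> z _; apply: (@filterE _ _ (nbhs_filter (z : cplx R))).
  by move=> z z0; rewrite Im_mul /= mulr0 add0r; apply: mulr_ge0; exact: ltW.
- by move=> z _; apply: (@filterE _ _ (nbhs_filter (z : cplx R))).
- by move=> z z0; rewrite mulr_le0_ge0 ?ltW.
- rewrite -[0 : cplx R](mul0r (c%:C%C : cplx R)); apply: cvgM; last exact: cvg_cst.
  exact: ofreal_opp_cvg0.
Qed.

Lemma class_K_rational_eta (T : choiceType) (s : seq T) (w x : T -> R) (c : R) :
  0 < c -> (forall a, a \in s -> 0 < w a) -> \sum_(a <- s) w a = 1 ->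
  (forall a, a \in s -> 0 < x a) ->
  let f := fun z : cplx R => (c%:C%C : cplx R) * rational_eta s w (fun a => (x a)%:C%C) z in
  class_K f /\ not_identically_zero f.
Proof.
move=> c0 w0 w1 x0 f; have c0' : 0 < c%:C%C :> R[i] by rewrite ltcR.
have der (z : cplx R) : 0 < Im z \/ z < 0 -> \forall u \near z, derivable f u 1.
  move=> hz; have := derivable_rational_eta_near w0 w1 x0 hz; apply: filterS => u du.
  apply: (@derivableM _ _ (fun _ : cplx R => c%:C%C : cplx R)
    (rational_eta s w (fun a => (x a)%:C%C))); last exact: du.
  exact: derivable_cst.
split; last first.
  exists (0 +i* 1)%C; first by rewrite /upper_half_plane /= ltr01.
  apply: mulf_neq0; first by rewrite gt_eqF.
  have := @Im_rational_eta_gt0 T s w x w0 w1 x0 (0 +i* 1)%C ltr01.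
  by apply: contraTneq => ->; rewrite ltxx.
split.
- split; first by move=> z z0; apply: der; left.
  move=> z z0; rewrite Im_mul /= mul0r addr0 mulr_ge0 ?(ltW c0) // ltW //.
  exact: Im_rational_eta_gt0.
- by move=> z z0; apply: der; right.
- by move=> z z0; rewrite mulr_ge0_le0 ?(ltW c0') //; exact: rational_eta_le0.
- rewrite -[0 : cplx R](mulr0 (c%:C%C : cplx R)); apply: cvgM; first exact: cvg_cst.
  have -> : (0 : cplx R) = rational_eta s w (fun a => (x a)%:C%C) 0 by rewrite /rational_eta mul0r.
  apply: (cvg_comp _ _ ofreal_opp_cvg0); apply: rational_eta_cvg0.
  by apply: rational_B_neq0 => //; right.
Qed.

(** If mu2 is the Dirac measure at b, then K_mu1(z) = K_mu(z / b), and mu1 is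
    the convolution of mu with the Dirac measure at 1/b for the subordination
    functions z / b and b K_mu1. *)
Lemma indecomposable_free_mul_pos (mu : Mpos R) (s : seq X) : uniq s ->
  (forall a, a \in s -> 0 < mass (set_val mu) a) ->
  \sum_(a <- s) mass (set_val mu) a = 1 ->
  (forall a, a \in s -> 0 < (set_val a : R)) ->
  ~ dirac_pos mu -> indecomposable (@free_mul_pos R) (@dirac_pos R) mu.
Proof.
move=> us s0 s1 pos nd; split=> // mu1 [mu2 conv].
pose rel (a b1 b2 : X) := (set_val a : R) = set_val b1 * set_val b2.
have rfun (a a' b1 b2 : X) : rel a b1 b2 -> rel a' b1 b2 -> a = a'.
  by rewrite /rel => <- /val_inj.
have [[a sa [b1 [b2 [ra m1]]]]|[b [A [m2 iA hA]]]] :=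
  atoms_of_factor mp rfun us s0 s1
    (fun a sa => free_mul_pos_atom conv (pos a sa) (s0 a sa)).
  left; exists b1; last exact: (mass1_is_dirac_at mp m1).
  rewrite lt_def nnreal_ge0 andbT; apply: contraTneq (pos a sa) => b10.
  by rewrite ra b10 mul0r ltxx.
right.
have [a0 a0s] : exists a, a \in s.
  case: (s) s1 => [|a r _]; last by exists a; rewrite mem_head.
  by rewrite big_nil => /esym/eqP; rewrite oner_eq0.
have Apos a : a \in s -> 0 < (set_val (A a) : R).
  move=> sa; rewrite lt_def nnreal_ge0 andbT; apply: contraTneq (pos a sa) => e.
  by have [ra _] := hA a sa; rewrite ra e mul0r ltxx.
have b0 : 0 < (set_val b : R).
  rewrite lt_def nnreal_ge0 andbT; apply: contraTneq (pos a0 a0s) => e.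
  by have [ra _] := hA a0 a0s; rewrite ra e mulr0 ltxx.
set beta : R := set_val b in b0.
have bi0 : 0 < beta^-1 by rewrite invr_gt0.
have bn0 : nnreal_val b != 0 by rewrite eq_complex /= negb_and gt_eqF.
pose binv : X := nnreal (ltW bi0).
have [delta0 [ddelta idelta]] := @dirac_prob R X mp binv.
have dlt : (delta0 [set x | set_val x = 0%R :> R] < 1)%E.
  rewrite (_ : [set _ | _] = [set nnreal (lexx (0 : R))]); last first.
    by apply/seteqP; split=> x /= => [e|->//]; exact: val_inj.
  rewrite ddelta // diracE /= memNset ?lte_fin ?ltr01 //= => e.
  by have := congr1 (fun x : X => set_val x : R) e; move/eqP; rewrite gt_eqF.
pose delta : Mpos R := SigSub (mem_set (dlt : [set mu : prob R X |
  (mu [set x | set_val x = 0%R] < 1)%E] delta0)).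
exists delta; first by exists binv; [exact: bi0|exact: ddelta].
pose w := mass (set_val mu).
pose x (a : X) : R := set_val (A a).
have hA' a : a \in s -> nnreal_val a = nnreal_val (A a) * nnreal_val b /\
    mass (set_val mu1) (A a) = mass (set_val mu) a.
  by move=> /hA [e1 e2]; split=> //; rewrite /nnreal_val e1 -rmorphM.
have Kmu1 z : 0 < Im z -> K_transform mu1 z = rational_eta s w (fun a => (x a)%:C%C) z.
  move=> z0; have [d d0 hd] := nnreal_kernel_bound z0.
  exact: (eta_transform_transported ccont_nnreal_val (@nnreal_val_inj R) us s1 iA hA' d0 hd).
have Imb z : 0 < Im z -> 0 < Im (z / nnreal_val b).
  by move=> z0; rewrite Im_mul Im_inv Re_inv /sqmod /= !(expr0n, oppr0, mul0r, mulr0, addr0, add0r) mulr_gt0 ?divr_gt0 ?exprn_gt0.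
have Kmu z : 0 < Im z -> K_transform mu (z / nnreal_val b) =
    rational_eta s w (fun a => (x a)%:C%C) z.
  move=> z0; have [d d0 hd] := nnreal_kernel_bound (Imb z z0).
  exact: (eta_transform_untransported ccont_nnreal_val (@nnreal_val_inj R) us s1 hA' bn0 d0 hd).
have Kd z : 0 < Im z -> K_transform delta z = z * (beta^-1)%:C%C.
  move=> z0; have [d d0 hd] := nnreal_kernel_bound z0.
  exact: (eta_transform_dirac ccont_nnreal_val d0 hd idelta).
have be : (nnreal_val b)^-1 = (beta^-1)%:C%C by rewrite fmorphV.
exists (fun z => z * (beta^-1)%:C%C),
  (fun z => beta%:C%C * rational_eta s w (fun a => (x a)%:C%C) z); split.
- exact: class_K_scale.
- exact: class_K_rational_eta.
- move=> z z0; have K1 := Kmu z z0; rewrite be in K1.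
  have E0 : 0 < Im (rational_eta s w (fun a => (x a)%:C%C) z) by exact: Im_rational_eta_gt0.
  rewrite K1 Kmu1 // Kd; last by rewrite Im_mul /= mul0r addr0 mulr_gt0.
  have bb : (beta^-1)%:C%C * beta%:C%C = 1 :> R[i] by rewrite -rmorphM /= mulVf ?gt_eqF.
  split=> //.
    by rewrite mulrA -[z * _ * _]mulrA bb mulr1.
  by rewrite mulrAC [beta%:C%C * _]mulrC bb mul1r.
Qed.

End PositiveIndecomposable.

(** * Indecomposability: circle *)

Section CircleIndecomposable.
Context {R : realType}.
Local Notation X := (unit_circle R).

Let mp := measurable_point_ccont (@ccont_circ_val R) (@circ_val_inj R).

Lemma sqmod_lt1_near (z : cplx R) : sqmod z < 1 -> \forall u \near z, sqmod u < 1.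
Proof.
move=> h; have c : sqmod u @[u --> z] --> sqmod z.
  exact: (@ccont_sqmod R (cplx R) id (conj (@Re_continuous R) (@Im_continuous R))).
exact: (cvgr_lt (FF := nbhs_filter (z : cplx R)) _ c _ h).
Qed.

Lemma class_S_rotation (c : X) : class_S (fun z : cplx R => z * circ_val c).
Proof.
have c0 : circ_val c != 0 by rewrite -sqmod_gt0 sqmod_circ_val.
have der (z : cplx R) : derivable (fun z : cplx R => z * circ_val c : cplx R) z 1.
  apply: (@derivableM _ _ id (fun _ : cplx R => circ_val c : cplx R)).
    exact: derivable_id.
  exact: derivable_cst.
split.
- by move=> z _; apply: (@filterE _ _ (nbhs_filter (z : cplx R))).
- by move=> z /unit_diskP h; rewrite normc_le1 sqmodM sqmod_circ_val mulr1 ltW.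
- by rewrite mul0r.
rewrite (@deriveM _ _ id (fun _ : cplx R => circ_val c : cplx R)); last first.
- exact: derivable_cst.
- exact: derivable_id.
by rewrite derive_cst derive_id scaler0 add0r /GRing.scale /= mulr1.
Qed.

(** As on the half-line, with the subordination functions z / b and b Q_mu1;
    the derivative of the latter at 0 is b times the mean of mu1, which is not
    0 by definition of the semigroup. *)
Lemma indecomposable_free_mul_circ (mu : Mcirc R) (s : seq X) : uniq s ->
  (forall a, a \in s -> 0 < mass (set_val mu) a) ->
  \sum_(a <- s) mass (set_val mu) a = 1 ->
  ~ dirac_circ mu -> indecomposable (@free_mul_circ R) (@dirac_circ R) mu.
Proof.
move=> us s0 s1 nd; split=> // mu1 [mu2 conv].
pose rel (a b1 b2 : X) := circ_val a = circ_val b1 * circ_val b2.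
have rfun (a a' b1 b2 : X) : rel a b1 b2 -> rel a' b1 b2 -> a = a'.
  by rewrite /rel => <- /circ_val_inj.
have [[a sa [b1 [b2 [ra m1]]]]|[b [A [m2 iA hA]]]] :=
  atoms_of_factor mp rfun us s0 s1 (fun a sa => free_mul_circ_atom conv (s0 a sa)).
  by left; exists b1; exact: (mass1_is_dirac_at mp m1).
right.
have bn0 : circ_val b != 0 by rewrite -sqmod_gt0 sqmod_circ_val.
have binvP : [set z : cplx R | `|z| = 1] (circ_val b)^-1.
  by apply/normc_eq1; rewrite sqmodV sqmod_circ_val invr1.
pose binv : X := SigSub (mem_set binvP).
have [delta0 [ddelta idelta]] := @dirac_prob R X mp binv.
have bval : cbounded_meas (fun x : X => set_val x : R[i]).
  apply: (@ccont_bounded_meas _ _ _ 1); first exact: ccont_circ_val.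
  by move=> x; rewrite -[set_val x]/(circ_val x) sqmod_circ_val expr1n.
have dne : cintegral delta0 (fun x : X => set_val x) != 0.
  by rewrite idelta //= invr_eq0.
pose delta : Mcirc R := SigSub (mem_set (dne : [set mu : prob R X |
    cintegral mu (fun x : X => set_val x) != 0] delta0)).
exists delta; first by exists binv.
pose w := mass (set_val mu).
pose x (a : X) : R[i] := circ_val (A a).
have Bmu1 z : sqmod z < 1 -> mcauchy circ_val (set_val mu1) z = rational_B s w x z.
  move=> z1; have [d d0 hd] := circ_kernel_bound z1.
  exact: (mcauchy_transported ccont_circ_val (@circ_val_inj R) us s1 iA hA d0 hd).
have Qmu1 z : sqmod z < 1 -> Q_transform mu1 z = rational_eta s w x z.
  move=> z1; have [d d0 hd] := circ_kernel_bound z1.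
  exact: (eta_transform_transported ccont_circ_val (@circ_val_inj R) us s1 iA hA d0 hd).
have zb z : sqmod (z / circ_val b) = sqmod z by rewrite sqmodM sqmodV sqmod_circ_val invr1 mulr1.
have Qmu z : sqmod z < 1 -> Q_transform mu (z / circ_val b) = rational_eta s w x z.
  move=> z1; have [|d d0 hd] := @circ_kernel_bound R (z / circ_val b); first by rewrite zb.
  exact: (eta_transform_untransported ccont_circ_val (@circ_val_inj R) us s1 hA bn0 d0 hd).
have Qd z : sqmod z < 1 -> Q_transform delta z = z * circ_val binv.
  move=> z1; have [d d0 hd] := circ_kernel_bound z1.
  exact: (eta_transform_dirac ccont_circ_val d0 hd idelta).
have B0 z : sqmod z < 1 -> rational_B s w x z != 0.
  move=> z1; have := mcauchy_circ_bound (set_val mu1) z1; rewrite Bmu1 //.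
  apply: contraTneq => ->; rewrite -ltNge /sqmod /= expr0n /=; lra.
have d0 z : sqmod z < 1 -> forall a, a \in s -> 1 - z * x a != 0.
  move=> z1 a _; have [d d0 hd] := circ_kernel_bound z1.
  by rewrite -sqmod_gt0; apply: lt_le_trans (hd (A a)); rewrite exprn_gt0.
have q1 z : sqmod z < 1 -> sqmod (rational_eta s w x z) < 1.
  move=> z1; rewrite -Qmu1 //; exact: le_lt_trans (sqmod_eta_transform_le _ z1) z1.
have dereta z : sqmod z < 1 -> derivable (rational_eta s w x) z 1.
  by move=> z1; apply: derivable_rational_eta; [exact: d0|exact: B0].
have q0 : sqmod (0 : R[i]) < 1 by rewrite /sqmod /= expr0n addr0 ltr01.
exists (fun z => z * circ_val binv), (fun z => circ_val b * rational_eta s w x z); split.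
- exact: class_S_rotation.
- split.
  + move=> z /unit_diskP z1; have := sqmod_lt1_near z1; apply: filterS => u u1.
    apply: (@derivableM _ _ (fun _ : cplx R => circ_val b : cplx R) (rational_eta s w x)).
      exact: derivable_cst.
    exact: dereta.
  + move=> z /unit_diskP z1; rewrite normc_le1 sqmodM sqmod_circ_val mul1r.
    exact/ltW/q1.
  + by rewrite /rational_eta mul0r mulr0.
  + rewrite (@deriveM _ _ (fun _ : cplx R => circ_val b : cplx R) (rational_eta s w x)); last first.
    * exact: dereta.
    * exact: derivable_cst.
    rewrite derive_cst scaler0 addr0 derive_rational_eta0; last exact: B0.
    rewrite /GRing.scale /= mulf_neq0 // mulf_neq0 ?invr_eq0 ?B0 //.
    have -> : rational_A s w x 0 = cintegral (set_val mu1) (fun x : X => set_val x).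
      rewrite (cintegral_transported mp us s1 iA _ bval); last by move=> a /hA [].
      by apply: eq_bigr => a _; rewrite mul0r subr0 divr1.
    exact: (set_valP mu1).
- move=> z /unit_diskP z1; have K1 := Qmu z z1.
  have -> : z * circ_val binv = z / circ_val b by [].
  rewrite K1 Qmu1 // Qd; last by rewrite sqmodM sqmod_circ_val mul1r q1.
  split=> //; first by rewrite mulrA mulfVK.
  have -> : circ_val binv = (circ_val b)^-1 by [].
  by rewrite mulrAC divff ?mul1r.
Qed.

End CircleIndecomposable.

(** * Weak approximation by finitely supported measures *)

Lemma cvg_initial_topology (S : choiceType) (T : topologicalType) (f : S -> T)
    (u : nat -> S) (x : S) :
  f (u n) @[n --> \oo] --> f x ->
  u n @[n --> \oo] --> (x : initial_topology f).
Proof.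
move=> h A [_ [[C oC <-] Cx sub]].
have : \forall n \near \oo, C (f (u n)) by apply: h; exact: open_nbhs_nbhs.
by apply: filterS => n /sub.
Qed.

Lemma prob_cvg {R : realType} {X : ptopologicalType} (nu : nat -> prob R X) (mu : prob R X) :
  (forall f : X -> R, continuous f -> (exists M, forall x, `|f x| <= M) ->
    Rintegral (nu n) setT f @[n --> \oo] --> Rintegral mu setT f) ->
  nu n @[n --> \oo] --> mu.
Proof.
move=> h; apply: cvg_initial_topology.
apply/cvg_sup => f.
apply: (@cvg_initial_topology _ _ (fun g : {ptws @bounded_continuous R X -> R} => g f)).
have [cf [M [_ bf]]] := set_valP f.
apply: h => //; exists (`|M| + 1) => x; apply: bf => //.
by rewrite (le_lt_trans (ler_norm M)) // ltrDl.
Qed.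

Section Levels.
Context {R : realType} {X : ptopologicalType}.

(** Rounding down of nonnegative numbers, capped at N so as to take finitely
    many values. *)
Definition level (N : nat) (t : R) : nat := minn N (Num.truncn t).

Lemma bounded_meas_ge (h : X -> R) (c : R) : continuous h ->
  bounded_meas (T := borel X) (fun x => (c <= h x)%R%:R : R).
Proof.
move=> ch; have mh := continuous_borel_measurable ch.
pose U : set (borel X) := (h : borel X -> R) @^-1` `[c, +oo[.
have mU : measurable U by rewrite -[U]setTI; exact: mh.
have -> : (fun x : borel X => (c <= h x)%R%:R : R) = \1_U.
  apply/funext => x; rewrite indicE; congr (nat_of_bool _)%:R.
  by apply/idP/idP; rewrite inE /U /= in_itv /= andbT.
split; first exact: measurable_indic.
by exists 1 => x; rewrite indicE; case: (_ \in _); rewrite ?normr1 ?normr0.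
Qed.

Lemma bounded_meas_lt_level (N k : nat) (h : X -> R) : continuous h ->
  bounded_meas (T := borel X) (fun x => (k < level N (h x))%N%:R : R).
Proof.
move=> ch; have [kN|kN] := ltnP k N.
  have -> : (fun x => (k < level N (h x))%N%:R) = (fun x => (k.+1%:R <= h x)%R%:R : R).
    by apply/funext => x; rewrite /level leq_min kN truncn_gt_nat.
  exact: bounded_meas_ge.
have -> : (fun x => (k < level N (h x))%N%:R) = (fun x : X => 0 : R).
  by apply/funext => x; rewrite /level leq_min ltnNge kN.
exact: bounded_meas_cst.
Qed.

(** The indicator of the level k is the difference of the indicators of the
    levels >= k and > k. *)
Lemma bounded_meas_level (N k : nat) (h : X -> R) : continuous h ->
  bounded_meas (T := borel X) (fun x => (level N (h x) == k)%:R : R).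
Proof.
move=> ch.
have -> : (fun x => (level N (h x) == k)%:R) =
    (fun x => (if k is j.+1 then (j < level N (h x))%N%:R else 1) +
       - (k < level N (h x))%N%:R : R).
  apply/funext => x; move: (level _ _) => l.
  case: k => [|k]; first by case: l => [|l]; rewrite ?subr0 ?subrr.
  rewrite eqn_leq leqNgt; have := @ltnW k.+1 l.
  by case: (k.+1 < l)%N; case: (k < l)%N => //= hl; rewrite ?subrr ?subr0 //; have := hl isT.
apply: bounded_measD; last by apply: bounded_measN; exact: bounded_meas_lt_level.
by case: k => [|k]; [exact: bounded_meas_cst|exact: bounded_meas_lt_level].
Qed.

End Levels.

(** The space X is embedded in the complex plane by i, and P is a dense subset
    of it in which the atoms are to be found.  The plane is cut in squares of
    side 1/(n+1); [phi n] sends a point of a square to a fixed point of P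
    close to this square.  The coordinates h1 and h2 are rescaled so that the
    squares within distance n + 1 of the origin have as lower corners the
    integer points of [0, N n] x [0, N n]. *)
Section Approximation.
Context {R : realType} {X : ptopologicalType} (i : X -> R[i]).
Hypotheses (ci : ccont i) (inji : injective i).
Hypothesis i_embedding : forall (u : nat -> X) x, ccvg (i \o u) (i x) -> u n @[n --> \oo] --> x.
Variables (P : set X) (p q : X).
Hypotheses (Pp : P p) (Pq : P q).
Hypothesis P_dense : forall x (e : R), 0 < e ->
  exists y, [/\ P y, `|Re (i y) - Re (i x)| <= e & `|Im (i y) - Im (i x)| <= e].

Let mp := measurable_point_ccont ci inji.

Lemma finite_prob_support (I : finType) (w : I -> R) (a : I -> X) (nu : prob R X) :
  (forall k, 0 <= w k) -> \sum_k w k = 1 ->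
  (forall f, bounded_meas (T := borel X) f -> Rintegral nu setT f = \sum_k w k * f (a k)) ->
  exists s : seq X, [/\ uniq s, forall x, x \in s -> 0 < mass nu x,
    \sum_(x <- s) mass nu x = 1, forall x, x \in s -> exists k, x = a k &
    forall k, 0 < w k -> a k \in s].
Proof.
move=> w0 w1 hnu.
have massE' x : mass nu x = \sum_k w k * (a k == x)%:R.
  by rewrite -(Rintegral_point mp) hnu //; exact: bounded_meas_point.
pose r := undup (codom a); have ur : uniq r by exact: undup_uniq.
have r1 : \sum_(x <- r) mass nu x = 1.
  rewrite -(Rintegral_mem mp) // hnu; last exact: bounded_meas_mem.
  rewrite -[RHS]w1; apply: eq_bigr => k _.
  have ar : a k \in r by rewrite mem_undup codom_f.
  by rewrite /= ar mulr1.
exists [seq x <- r | 0 < mass nu x]; split.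
- by rewrite filter_uniq.
- by move=> x; rewrite mem_filter => /andP[].
- rewrite big_filter -r1 [RHS](bigID (fun x => 0 < mass nu x)) /=.
  rewrite [X in _ + X]big1 ?addr0 // => x; rewrite -leNgt => h.
  by apply/eqP; rewrite eq_le h mass_ge0.
- by move=> x; rewrite mem_filter mem_undup => /andP[_ /codomP].
- move=> k wk; rewrite mem_filter mem_undup codom_f andbT massE'.
  rewrite (bigD1 k) //= eqxx mulr1 ltr_wpDr // sumr_ge0 // => j _.
  by rewrite mulr_ge0.
Qed.

Let h1 (n : nat) (x : X) : R := n.+1%:R * (Re (i x) + n.+1%:R).
Let h2 (n : nat) (x : X) : R := n.+1%:R * (Im (i x) + n.+1%:R).
Let N (n : nat) := (2 * n.+1 ^ 2)%N.
Let good n (k1 k2 : nat) : set X :=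
  [set y | [/\ P y, `|h1 n y - k1%:R| <= 2 & `|h2 n y - k2%:R| <= 2]].
Let G n (k1 k2 : nat) : X := xget p (good n k1 k2).
Let phi n (x : X) : X := G n (level (N n) (h1 n x)) (level (N n) (h2 n x)).

Let ch1 n : continuous (h1 n).
Proof.
by move=> x; apply: cvgM; [exact: cvg_cst|apply: cvgD; [exact: ci.1|exact: cvg_cst]].
Qed.

Let ch2 n : continuous (h2 n).
Proof.
by move=> x; apply: cvgM; [exact: cvg_cst|apply: cvgD; [exact: ci.2|exact: cvg_cst]].
Qed.

Let PG n k1 k2 : P (G n k1 k2).
Proof. by rewrite /G; case: xgetP => [y _ []|_]. Qed.

(** For |t| <= n + 1 the rescaled coordinate lies in [0, N n], where the cap of
    [level] has no effect. *)
Let level_close n (t : R) : `|t| <= n.+1%:R ->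
  `|n.+1%:R * (t + n.+1%:R) - (level (N n) (n.+1%:R * (t + n.+1%:R)))%:R| <= 1.
Proof.
rewrite ler_norml => /andP[t1 t2]; set y := _ * _.
have y0 : 0 <= y by rewrite mulr_ge0 //; lra.
have yN : y <= (N n)%:R.
  rewrite /N natrM natrX /y; have : (0 : R) <= n.+1%:R by []; nra.
have := truncn_itv y0; rewrite /level.
have -> : minn (N n) (Num.truncn y) = Num.truncn y.
  apply/minn_idPr; rewrite -(ler_nat R); apply: le_trans yN.
  by have /andP[] := truncn_itv y0.
move=> /andP[a1]; rewrite -natr1 => a2; rewrite ger0_norm; lra.
Qed.

Let phi_close n x : `|Re (i x)| <= n.+1%:R -> `|Im (i x)| <= n.+1%:R ->
  `|Re (i (phi n x)) - Re (i x)| <= 3 / n.+1%:R /\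
  `|Im (i (phi n x)) - Im (i x)| <= 3 / n.+1%:R.
Proof.
move=> rx jx; have n0 : 0 < n.+1%:R :> R by [].
have c1 := level_close rx; have c2 := level_close jx.
have good_phi : good n (level (N n) (h1 n x)) (level (N n) (h2 n x)) (phi n x).
  rewrite /phi /G; case: xgetP => // none; exfalso.
  have [|y [Py y1 y2]] := @P_dense x n.+1%:R^-1; first by rewrite invr_gt0.
  apply: (none y); split => //.
    have : `|h1 n y - h1 n x| <= 1.
      rewrite /h1 -mulrBr opprD addrACA subrr addr0 normrM gtr0_norm //.
      by rewrite mulrC -ler_pdivlMr // mul1r.
    rewrite -/(h1 n x) in c1; move: c1; rewrite !ler_norml => /andP[? ?] /andP[? ?].
    by apply/andP; split; lra.
  have : `|h2 n y - h2 n x| <= 1.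
    rewrite /h2 -mulrBr opprD addrACA subrr addr0 normrM gtr0_norm //.
    by rewrite mulrC -ler_pdivlMr // mul1r.
  rewrite -/(h2 n x) in c2; move: c2; rewrite !ler_norml => /andP[? ?] /andP[? ?].
  by apply/andP; split; lra.
have [_ g1 g2] := good_phi; split.
  rewrite ler_pdivlMr // mulrC -[X in X * _](gtr0_norm n0) -normrM.
  rewrite -/(h1 n x) in c1; move: c1 g1; rewrite /h1 !ler_norml => /andP[? ?] /andP[? ?].
  by apply/andP; split; lra.
rewrite ler_pdivlMr // mulrC -[X in X * _](gtr0_norm n0) -normrM.
rewrite -/(h2 n x) in c2; move: c2 g2; rewrite /h2 !ler_norml => /andP[? ?] /andP[? ?].
by apply/andP; split; lra.
Qed.

Let phi_cvg x : phi n x @[n --> \oo] --> x.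
Proof.
have near1 (t : R) : \forall n \near \oo, `|t| <= n.+1%:R.
  near=> n; apply: (@le_trans _ _ n%:R); last by rewrite ler_nat.
  by near: n; exact: nbhs_infty_ger.
have h3 : 3 / n.+1%:R @[n --> \oo] --> (0 : R).
  by rewrite -(mulr0 3); apply: cvgM; [exact: cvg_cst|exact: cvg_harmonic].
apply: i_embedding; split; apply/subr_cvg0/norm_cvg0P.
  apply: (@squeeze_cvgr _ _ _ _ (fun=> 0) (fun n => 3 / n.+1%:R)) => //.
    near=> n; rewrite normr_ge0 /=.
    by apply: (phi_close _ _).1; near: n; exact: near1.
  exact: cvg_cst.
apply: (@squeeze_cvgr _ _ _ _ (fun=> 0) (fun n => 3 / n.+1%:R)) => //.
  near=> n; rewrite normr_ge0 /=.
  by apply: (phi_close _ _).2; near: n; exact: near1.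
exact: cvg_cst.
Unshelve. all: by end_near. Qed.

Let code n : finType := ('I_(N n).+1 * 'I_(N n).+1)%type.
Let E n (k : code n) (x : X) : R :=
  (level (N n) (h1 n x) == k.1)%:R * (level (N n) (h2 n x) == k.2)%:R.

Let bE n k : bounded_meas (T := borel X) (@E n k).
Proof. by apply: bounded_measM; exact: bounded_meas_level. Qed.

(** Exactly one square contains x. *)
Let comp_phiE n (f : X -> R) x : f (phi n x) = \sum_(k : code n) f (G n k.1 k.2) * @E n k x.
Proof.
have l1 : (level (N n) (h1 n x) < (N n).+1)%N by rewrite ltnS geq_minl.
have l2 : (level (N n) (h2 n x) < (N n).+1)%N by rewrite ltnS geq_minl.
rewrite (bigD1 (Ordinal l1, Ordinal l2)) //= big1 ?addr0.
  by rewrite /E /= !eqxx !mulr1.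
move=> [k1 k2]; rewrite xpair_eqE negb_and -!val_eqE /= => h.
rewrite /E /= ![level _ _ == _]eq_sym.
by case/orP: h => /negbTE ->; rewrite ?mul0r ?mulr0.
Qed.

Let bf_phi n (f : X -> R) : bounded_meas (T := borel X) (fun x => f (phi n x)).
Proof.
rewrite (_ : (fun x => _) = fun x => \sum_(k : code n) f (G n k.1 k.2) * @E n k x); last first.
  by apply/funext => x; exact: comp_phiE.
apply: bounded_meas_sum => k; apply: bounded_measM => //; exact: bounded_meas_cst.
Qed.

Let Rintegral_phi n (mu : prob R X) (f : X -> R) :
  Rintegral mu setT (fun x => f (phi n x)) =
  \sum_(k : code n) Rintegral mu setT (@E n k) * f (G n k.1 k.2).
Proof.
rewrite (_ : (fun x => _) = fun x => \sum_(k : code n) f (G n k.1 k.2) * @E n k x); last first.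
  by apply/funext => x; exact: comp_phiE.
rewrite Rintegral_bd_sum; last first.
  by move=> k; apply: bounded_measM => //; exact: bounded_meas_cst.
by apply: eq_bigr => k _; rewrite Rintegral_bdZ // mulrC.
Qed.

Let approximant (mu : prob R X) n : exists nus : prob R X * seq X,
  [/\ uniq nus.2, forall x, x \in nus.2 -> 0 < mass nus.1 x,
     \sum_(x <- nus.2) mass nus.1 x = 1, forall x, x \in nus.2 -> P x &
     p \in nus.2 /\ q \in nus.2] /\
  forall f, bounded_meas (T := borel X) f -> Rintegral nus.1 setT f =
    (1 - n.+1%:R^-1) * Rintegral mu setT (fun x => f (phi n x)) +
    n.+1%:R^-1 * ((f p + f q) / 2).
Proof.
pose t : R := n.+1%:R^-1.
have t0 : 0 < t by rewrite invr_gt0.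
have t1 : t <= 1 by rewrite invf_le1 // ler1n.
(* The mass t is split between p and q, which makes both of them atoms. *)
pose w (k : code n + bool) : R :=
  if k is inl k' then (1 - t) * Rintegral mu setT (@E n k') else t / 2.
pose a (k : code n + bool) : X :=
  match k with inl k' => G n k'.1 k'.2 | inr true => p | inr false => q end.
have sumE (f : X -> R) : \sum_k w k * f (a k) =
    (1 - t) * Rintegral mu setT (fun x => f (phi n x)) + t * ((f p + f q) / 2).
  rewrite big_sumType big_bool /= Rintegral_phi mulr_sumr; congr (_ + _); last by lra.
  by apply: eq_bigr => k _; rewrite mulrA.
have w0 k : 0 <= w k.
  case: k => [k|b] /=; last by rewrite divr_ge0 // ltW.
  apply: mulr_ge0; first by rewrite subr_ge0.
  by apply: Rintegral_ge0 => x _; apply: mulr_ge0.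
have w1 : \sum_k w k = 1.
  have := sumE (fun=> 1); under eq_bigr do rewrite mulr1; move=> ->.
  by rewrite Rintegral_prob_cst; lra.
have [nu hnu] := finite_prob a w0 w1.
have [s [us s0 s1 sa ws]] := finite_prob_support w0 w1 hnu.
exists (nu, s); split; last by move=> f bf; rewrite hnu // sumE.
split=> //=.
- by move=> x /sa [[k|[]] ->] //=; exact: PG.
- split; first by apply: (ws (inr true)); rewrite divr_gt0.
  by apply: (ws (inr false)); rewrite divr_gt0.
Qed.

(** For each n the measure is the image of mu under [phi n], reduced by the
    factor 1 - 1/(n+1) and completed by two equal masses at p and q.  As
    [phi n] converges pointwise to the identity, the integral of a bounded
    continuous function converges by dominated convergence. *)
Lemma finite_support_approximation (mu : prob R X) :
  exists (nu : nat -> prob R X) (s : nat -> seq X),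
  (forall n, [/\ uniq (s n), forall x, x \in s n -> 0 < mass (nu n) x,
     \sum_(x <- s n) mass (nu n) x = 1, forall x, x \in s n -> P x &
     p \in s n /\ q \in s n]) /\
  forall f : X -> R, continuous f -> (exists M, forall x, `|f x| <= M) ->
    Rintegral (nu n) setT f @[n --> \oo] --> Rintegral mu setT f.
Proof.
have [nus hnus] := choice (approximant mu).
exists (fun n => (nus n).1), (fun n => (nus n).2); split; first by move=> n; case: (hnus n).
move=> f cf [M hM].
have bf : bounded_meas (T := borel X) f.
  by split; [exact: continuous_borel_measurable|exists M].
rewrite (_ : (fun n => _) = fun n => (1 - n.+1%:R^-1) * Rintegral mu setT (fun x => f (phi n x)) +
    n.+1%:R^-1 * ((f p + f q) / 2)); last first.
  by apply/funext => n; have [_ ->] := hnus n.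
have t0 : n.+1%:R^-1 @[n --> \oo] --> (0 : R) by exact: cvg_harmonic.
have fphi (x : X) : f (phi n x) @[n --> \oo] --> f x.
  by move=> A Af; have := cf x _ Af; exact: phi_cvg.
have -> : Rintegral mu setT f = (1 - 0) * Rintegral mu setT f + 0 * ((f p + f q) / 2) by lra.
apply: cvgD; apply: cvgM => //; last exact: cvg_cst.
  by apply: cvgB => //; exact: cvg_cst.
apply: (@bounded_convergence _ _ _ _ _ _ M).
- by move=> n; case: (bf_phi n f).
- exact: bf.1.
- by move=> n x.
- exact: fphi.
Qed.

End Approximation.

(** * Density of indecomposable measures *)

Lemma two_atoms_not_dirac {R : realType} {X : ptopologicalType} (mu : prob R X) (p q : X) :
  (forall b, measurable ([set b] : set (borel X))) ->
  p != q -> 0 < mass mu p -> 0 < mass mu q -> forall c, ~ is_dirac_at c mu.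
Proof.
move=> mp pq hp hq c hc.
have e x : 0 < mass mu x -> c = x.
  rewrite (is_dirac_at_mass mp hc); case: eqP => // _; by rewrite ltxx.
by move: pq; rewrite -(e p hp) -(e q hq) eqxx.
Qed.

Section Density.
Context {R : realType}.

Lemma ccvg_cvg (u : nat -> cplx R) (z : cplx R) : ccvg u z -> u n @[n --> \oo] --> z.
Proof.
move=> /(fun h => ccvgD h (ccvg_cst (- z))); rewrite subrr => /ccvg_sqmod.
rewrite [sqmod 0](_ : _ = 0); last by rewrite /sqmod /= expr0n addr0.
move=> h; apply/cvgrPdist_lt => e e0.
have ee : e = (Re e)%:C%C.
  by apply: complex_eqP => //; move: e0; case: e => a b /=; rewrite ltcE /= => /andP[/eqP].
have r0 : 0 < Re e by move: e0; rewrite ee ltcR.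
have e20 : (0 : R) < Re e ^+ 2 by rewrite exprn_gt0.
have FF : Filter \oo by exact: _.
have := cvgr_lt (FF := FF) _ h _ e20; apply: filterS => n hn.
by rewrite ee normc_lt_real // -sqmodN opprB.
Qed.

Lemma dense_of_cvg (T : topologicalType) (S : set T) :
  (forall x : T, exists2 u : nat -> T, (forall n, S (u n)) & u n @[n --> \oo] --> x) -> dense S.
Proof.
move=> h O [x Ox] oO; have [u Su ux] := h x.
have [N _ hN] : \forall n \near \oo, O (u n) by apply: ux; exact: open_nbhs_nbhs.
by exists (u N); split; [apply: hN => /=|exact: Su].
Qed.

Lemma dense_indecomposable_free_add :
  dense (indecomposable (@free_add R) (@dirac_add R) : set (Madd R)).
Proof.
apply: dense_of_cvg => mu.
have [|||||nu [s [hs hcv]]] := @finite_support_approximation R R (fun t => t%:C%C)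
  ccont_real _ _ setT 0 1 _ _ _ mu.
- by move=> x y [].
- by move=> u x [].
- by [].
- by [].
- by move=> x e e0; exists x; rewrite !subrr normr0 ltW.
exists nu; last by apply: prob_cvg.
move=> n; have [us s0 s1 _ [ps qs]] := hs n.
apply: (indecomposable_free_add us s0 s1) => -[c].
apply: (@two_atoms_not_dirac R R (nu n) 0 1 measurable_point_real).
- by rewrite eq_sym oner_eq0.
- exact: s0.
- exact: s0.
Qed.

Lemma dense_indecomposable_free_mul_pos :
  dense (indecomposable (@free_mul_pos R) (@dirac_pos R) : set (Mpos R)).
Proof.
apply: dense_of_cvg => mu.
pose X := nonneg_reals R.
pose one : X := @nnreal R 1 ler01.
pose two : X := @nnreal R 2 (ler0n R 2).
have one_two : one != two.
  by apply/eqP => /(congr1 (fun x : X => set_val x : R)) /eqP; rewrite lt_eqF // ltr1n.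
have [||||nu [s [hs hcv]]] := @finite_support_approximation R X nnreal_val
  ccont_nnreal_val (@nnreal_val_inj R) _ [set x : X | 0 < (set_val x : R)] one two _ _ _
  (set_val mu).
- by move=> u x [h _]; apply: cvg_initial_topology.
- exact: ltr01.
- exact: ltr0n.
- move=> x e e0; have xe : 0 <= (set_val x : R) + e by rewrite addr_ge0 ?nnreal_ge0 // ltW.
  exists (nnreal xe); split => /=.
  + by rewrite ltr_wpDl ?nnreal_ge0.
  + by rewrite addrC addKr ger0_norm // ltW.
  + by rewrite subrr normr0 ltW.
have mp := measurable_point_ccont ccont_nnreal_val (@nnreal_val_inj R).
have n0 n : (nu n [set x : X | set_val x = 0%R :> R] < 1)%E.
  have [us s0 s1 sP [ps qs]] := hs n.
  pose zero : X := nnreal (lexx (0 : R)).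
  have -> : [set x : X | set_val x = 0%R :> R] = [set zero].
    by apply/seteqP; split=> x /= => [e|->//]; exact: val_inj.
  have zo : zero != one.
    by apply/eqP => /(congr1 (fun x : X => set_val x : R)) /eqP; rewrite lt_eqF // ltr01.
  have := @sum_mass_le1 _ _ mp (nu n) [:: zero; one].
  rewrite /= inE zo => /(_ isT); rewrite big_cons big_seq1 => h.
  rewrite (massE mp) lte_fin; have := s0 _ ps; lra.
pose nu' n : Mpos R := SigSub (mem_set (n0 n : [set mu : prob R X |
  (mu [set x | set_val x = 0%R] < 1)%E] (nu n))).
exists nu'; last by apply: cvg_initial_topology; apply: prob_cvg.
move=> n; have [us s0 s1 sP [ps qs]] := hs n.
apply: (indecomposable_free_mul_pos (mu := nu' n) us s0 s1 sP) => -[c _].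
by apply: (two_atoms_not_dirac mp one_two); exact: s0.
Qed.

Lemma dense_indecomposable_free_mul_circ :
  dense (indecomposable (@free_mul_circ R) (@dirac_circ R) : set (Mcirc R)).
Proof.
apply: dense_of_cvg => mu.
pose X := unit_circle R.
pose one : X := SigSub (mem_set (normr1 _ : [set z : cplx R | `|z| = 1] 1)).
have None : [set z : cplx R | `|z| = 1] (-1) by rewrite /= normrN1.
pose mone : X := SigSub (mem_set None).
have one_mone : one != mone.
  apply/eqP => /(congr1 (fun x : X => Re (set_val x : R[i]))) /= /eqP.
  by rewrite gt_eqF // ltrN10.
have [||||nu [s [hs hcv]]] := @finite_support_approximation R X circ_val
  ccont_circ_val (@circ_val_inj R) _ setT one mone _ _ _ (set_val mu).
- move=> u x h; apply: cvg_initial_topology; exact: ccvg_cvg.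
- by [].
- by [].
- by move=> x e e0; exists x; rewrite !subrr normr0 ltW.
have mp := measurable_point_ccont (@ccont_circ_val R) (@circ_val_inj R).
have mean_cvg : ccvg (fun n => cintegral (nu n) (fun x : X => set_val x : R[i]))
    (cintegral (set_val mu) (fun x : X => set_val x : R[i])).
  have [cr cj] := @ccont_circ_val R.
  split; apply: hcv => //; exists 1 => x.
    by apply: normr_Re_le_sqmod => //; rewrite expr1n sqmod_circ_val.
  by apply: normr_Im_le_sqmod => //; rewrite expr1n sqmod_circ_val.
(* The mean is a weakly continuous function of the measure, hence not 0 for
   the approximants from some rank N on. *)
have [N _ hN] : \forall n \near \oo, cintegral (nu n) (fun x : X => set_val x : R[i]) != 0.
  have m0 : 0 < sqmod (cintegral (set_val mu) (fun x : X => set_val x : R[i])).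
    by rewrite sqmod_gt0; exact: (set_valP mu).
  have FF : Filter \oo by exact: _.
  have := cvgr_gt (FF := FF) _ (ccvg_sqmod mean_cvg) _ m0.
  by apply: filterS => n; rewrite sqmod_gt0.
have n0 n : cintegral (nu (n + N)%N) (fun x : X => set_val x : R[i]) != 0.
  by apply: hN; rewrite /= leq_addl.
pose nu' n : Mcirc R := SigSub (mem_set (n0 n : [set mu : prob R X |
    cintegral mu (fun x : X => set_val x) != 0] (nu (n + N)%N))).
exists nu'.
  move=> n; have [us s0 s1 sP [ps qs]] := hs (n + N)%N.
  apply: (indecomposable_free_mul_circ (mu := nu' n) us s0 s1) => -[c].
  by apply: (two_atoms_not_dirac mp one_mone); exact: s0.
apply: cvg_initial_topology; apply: prob_cvg => f cf bf.
have addN : (n + N)%N @[n --> \oo] --> \oo by exact: cvg_addnr.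
exact: (cvg_comp _ (fun n => Rintegral (nu n) setT f) addN (hcv f cf bf)).
Qed.
End Density.

Theorem corollary2p15 (R : realType) :
  [/\ dense (indecomposable (@free_add R) (@dirac_add R) : set (Madd R)),
      dense (indecomposable (@free_mul_pos R) (@dirac_pos R) : set (Mpos R)) &
      dense (indecomposable (@free_mul_circ R) (@dirac_circ R)
             : set (Mcirc R))].
Proof.
split.
- exact: dense_indecomposable_free_add.
- exact: dense_indecomposable_free_mul_pos.
- exact: dense_indecomposable_free_mul_circ.
Qed.
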